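(* Let $k,\kappa\ge1$ be integers, let $T,N,\lambda>0$, let $X=[0,T]\times\mathbb{R}^\kappa$ and $$Y=\{\nu\in H^2([0,T];\mathbb{R}^\kappa):|\nu(t)|\le N\ \ \forall t\in[0,T]\}.$$ Define $d:X\times Y\to[0,\infty)$ by $d((t,z),\nu)=|z-\nu(t)|^2$ and $r:Y^k\to[0,\infty)$ by $r(\mu)=\sum_{j=1}^k\|\partial^2\mu_j\|_{L^2}^2$. Let $P$ be a probability measure on $X$ with compact support, and let $\xi_i=(t_i,z_i)$, $i\in\mathbb{N}$, be independent samples from $P$, defined on a probability space $(\Omega,\mathcal{F},\mathbb{P})$. Define $f_n,f_\infty:Y^k\to\mathbb{R}$ by $$f_n(\mu)=\frac1n\sum_{i=1}^n\min_{1\le j\le k}|z_i-\mu_j(t_i)|^2+\lambda\sum_{j=1}^k\|\partial^2\mu_j\|_{L^2}^2,$$ $$f_\infty(\mu)=\int_X\min_{1\le j\le k}|z-\mu_j(t)|^2\,P(\mathrm{d}(t,z))+\lambda\sum_{j=1}^k\|\partial^2\mu_j\|_{L^2}^2.$$ Then: (1) any sequence of minimizers $\mu^n\in Y^k$ of $f_n$ is $\mathbb{P}$-almost surely weakly precompact (in $H^2$), and any weak limit point of $\mu^n$ minimizes $f_\infty$; (2) if $\mu^{n_m}\rightharpoonup\mu$ is a weakly converging (in $H^2$) subsequence of minimizers, then the convergence is uniform (in $C^0$).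
   Context: $|\cdot|$ is the Euclidean norm on $\mathbb{R}^\kappa$. $H^2([0,T];\mathbb{R}^\kappa)$ is the Sobolev space of functions $[0,T]\to\mathbb{R}^\kappa$ whose weak derivatives $\partial^i$ up to order $2$ are in $L^2$, with norm $\|\nu\|_{H^2}^2=\sum_{i=0}^2\|\partial^i\nu\|_{L^2}^2$; its elements are identified with their continuous representatives. Minimizers of $f_n$ and $f_\infty$ are understood over $Y^k$. Weak convergence of $\mu^n=(\mu_1^n,\dots,\mu_k^n)$ in $H^2$ means weak convergence of each component in $H^2([0,T];\mathbb{R}^\kappa)$. A sequence is weakly precompact if every subsequence has a weakly convergent further subsequence; a weak limit point is the weak limit of some subsequence. *)

(* Defs.v *)
From HB Require Import structures.
From mathcomp Require Import all_boot all_order all_algebra finmap.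
From mathcomp Require Import all_classical all_reals all_analysis.

Set Implicit Arguments.
Unset Strict Implicit.
Unset Printing Implicit Defensive.
Import Order.TTheory GRing.Theory Num.Theory.
Import numFieldTopology.Exports numFieldNormedType.Exports.

Local Open Scope classical_set_scope.
Local Open Scope ring_scope.

(* The library norm on ['rV_n] is the sup norm, hence a separate definition. *)
Definition enorm (R : realType) (n : nat) (x : 'rV[R]_n) : R :=
  Num.sqrt (\sum_(c < n) x ord0 c ^+ 2).

(* Curves [0, T] -> R^kappa are represented by total functions of which only
   the restriction to [0, T] is ever used. *)
Definition curve (R : realType) (kappa : nat) : Type := R -> 'rV[R]_kappa.

Definition inL2 (R : realType) (kappa : nat) (T : R) (g : curve R kappa) : Prop :=
  (forall c : 'I_kappa,
      measurable_fun `[0, T] (fun t : R => g t ord0 c : R)) /\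
  (@lebesgue_measure R).-integrable `[0, T] (fun t => (enorm (g t) ^+ 2)%:E).

Definition L2norm (R : realType) (kappa : nat) (T : R) (g : curve R kappa) : R :=
  Num.sqrt (\int[@lebesgue_measure R]_(t in `[0, T]) (enorm (g t) ^+ 2)).

Definition test_function (R : realType) (T : R) (phi : R -> R) : Prop :=
  [/\ forall (m : nat) (x : R), derivable (derive1n m phi) x 1,
      compact (closure [set x | phi x != 0]) &
      closure [set x | phi x != 0] `<=` `]0, T[].

Definition weak_derivative (R : realType) (kappa : nat) (T : R) (i : nat)
    (nu g : curve R kappa) : Prop :=
  forall (c : 'I_kappa) (phi : R -> R), test_function T phi ->
    \int[@lebesgue_measure R]_(t in `[0, T]) (nu t ord0 c * derive1n i phi t) =
    (-1) ^+ i * \int[@lebesgue_measure R]_(t in `[0, T]) (g t ord0 c * phi t).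

(* Continuity on [0, T] selects the continuous representative of the class. *)
Definition inH2 (R : realType) (kappa : nat) (T : R) (nu : curve R kappa) : Prop :=
  {within `[0, T], continuous nu} /\
  forall i : nat, (i <= 2)%N ->
    exists g : curve R kappa, inL2 T g /\ weak_derivative T i nu g.

(* The L^2 weak derivative is unique up to a null set; [xget] picks a
   representative (and the junk value 0 when there is none). *)
Definition wderiv (R : realType) (kappa : nat) (T : R) (i : nat)
    (nu : curve R kappa) : curve R kappa :=
  xget (fun=> 0) [set g : R -> 'rV[R]_kappa | inL2 T g /\ weak_derivative T i nu g].

Definition H2norm (R : realType) (kappa : nat) (T : R) (nu : curve R kappa) : R :=
  Num.sqrt (\sum_(i < 3) L2norm T (wderiv T i nu) ^+ 2).

(* F, restricted to H^2([0, T]; R^kappa), is a bounded linear functional. *)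
Definition H2_dual (R : realType) (kappa : nat) (T : R)
    (F : curve R kappa -> R) : Prop :=
  (forall (a : R) (u v : curve R kappa), inH2 T u -> inH2 T v ->
      F (fun t => a *: u t + v t) = a * F u + F v) /\
  (exists C : R, forall u : curve R kappa, inH2 T u -> `|F u| <= C * H2norm T u).

Definition H2_weak_cvg (R : realType) (kappa : nat) (T : R)
    (u : nat -> curve R kappa) (v : curve R kappa) : Prop :=
  [/\ forall m, inH2 T (u m), inH2 T v &
      forall F : curve R kappa -> R, H2_dual T F ->
        (fun m => F (u m)) @ \oo --> F v].

Definition curves (R : realType) (k kappa : nat) : Type := 'I_k -> curve R kappa.

Definition weak_cvg (R : realType) (k kappa : nat) (T : R)
    (u : nat -> curves R k kappa) (v : curves R k kappa) : Prop :=
  forall j : 'I_k, H2_weak_cvg T (fun m => u m j) (v j).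

Definition extraction (s : nat -> nat) : Prop :=
  forall m n : nat, (m < n)%N -> (s m < s n)%N.

Definition weakly_precompact (R : realType) (k kappa : nat) (T : R)
    (u : nat -> curves R k kappa) : Prop :=
  forall s : nat -> nat, extraction s ->
    exists (s' : nat -> nat) (v : curves R k kappa),
      extraction s' /\ weak_cvg T (fun m => u (s (s' m))) v.

Definition weak_limit_point (R : realType) (k kappa : nat) (T : R)
    (u : nat -> curves R k kappa) (v : curves R k kappa) : Prop :=
  exists s : nat -> nat, extraction s /\ weak_cvg T (fun m => u (s m)) v.

Definition inY (R : realType) (kappa : nat) (T N : R) (nu : curve R kappa) : Prop :=
  inH2 T nu /\ forall t : R, 0 <= t <= T -> enorm (nu t) <= N.

Definition inYk (R : realType) (k kappa : nat) (T N : R)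
    (mu : curves R k kappa) : Prop :=
  forall j : 'I_k, inY T N (mu j).

(* R x R^kappa with its Borel sigma-algebra; a measure (resp. random variable)
   on X is one on this space of full mass on (resp. with values in) [Xset]. *)
Definition data (R : realType) (kappa : nat) :=
  g_sigma_algebraType (@open (R * 'rV[R]_kappa)%type).

Definition Xset (R : realType) (kappa : nat) (T : R) : set (data R kappa) :=
  [set x : R * 'rV[R]_kappa | 0 <= x.1 <= T].
Arguments Xset {R} kappa T _.

Definition msupport (R : realType) (kappa : nat)
    (P : set (data R kappa) -> \bar R) : set (R * 'rV[R]_kappa) :=
  [set x | forall U : set (R * 'rV[R]_kappa), open U -> U x -> (0 < P U)%E].

Definition sqdist (R : realType) (kappa : nat) (x : R * 'rV[R]_kappa)
    (nu : curve R kappa) : R :=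
  enorm (x.2 - nu x.1) ^+ 2.

Definition min_dist (R : realType) (k kappa : nat) (hk : (0 < k)%N)
    (mu : curves R k kappa) (x : R * 'rV[R]_kappa) : R :=
  \big[Num.min/sqdist x (mu (Ordinal hk))]_(j < k) sqdist x (mu j).

Definition reg (R : realType) (k kappa : nat) (T : R)
    (mu : curves R k kappa) : R :=
  \sum_(j < k) L2norm T (wderiv T 2 (mu j)) ^+ 2.

(* The samples are numbered from 0: the first n of them are x 0, ..., x (n-1). *)
Definition f_emp (R : realType) (k kappa : nat) (hk : (0 < k)%N) (T lambda : R)
    (x : nat -> data R kappa) (n : nat) (mu : curves R k kappa) : R :=
  n%:R^-1 * (\sum_(i < n) min_dist hk mu (x i)) + lambda * reg T mu.

Definition f_lim (R : realType) (k kappa : nat) (hk : (0 < k)%N) (T lambda : R)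
    (P : {measure set (data R kappa) -> \bar R}) (mu : curves R k kappa) : R :=
  \int[P]_(x in Xset kappa T) min_dist hk mu x + lambda * reg T mu.

Definition minimizer (R : realType) (k kappa : nat) (T N : R)
    (f : curves R k kappa -> R) (mu : curves R k kappa) : Prop :=
  inYk T N mu /\ forall nu : curves R k kappa, inYk T N nu -> f mu <= f nu.

Definition iid_samples (R : realType) (kappa : nat) (d : measure_display)
    (Omega : measurableType d) (Pr : probability Omega R)
    (P : {measure set (data R kappa) -> \bar R})
    (xi : nat -> Omega -> data R kappa) : Prop :=
  [/\ forall i, measurable_fun setT (xi i),
      forall i (B : set (data R kappa)), measurable B -> Pr (xi i @^-1` B) = P B &
      forall (J : {fset nat}) (B : nat -> set (data R kappa)),
        (forall i, measurable (B i)) ->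
        Pr (\bigcap_(i in [set` J]) (xi i @^-1` B i)) =
        (\prod_(i <- J) Pr (xi i @^-1` B i))%E].

(* Main.v *)
Require Import Defs.
From mathcomp Require Import all_boot all_order all_algebra finmap.
From mathcomp Require Import all_classical all_reals all_analysis.
From mathcomp Require Import measurable_realfun.
From mathcomp Require Import ring lra zify.
Set Implicit Arguments.
Unset Strict Implicit.
Unset Printing Implicit Defensive.
Import Order.TTheory GRing.Theory Num.Theory.
Import numFieldTopology.Exports numFieldNormedType.Exports.
Local Open Scope classical_set_scope.
Local Open Scope ring_scope.

(** Why minimizers of the empirical functionals converge.

    Compactness. For curves bounded by [N], the energy |u''|^2 controls the whole
    Sobolev norm: the mean of u' is controlled by the end points of u, and its
    oscillation by u'' ([H2_bounded]). Comparing a minimizer with the zero curves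
    bounds its energy, hence its norm ([minimizers_bounded]). The Sobolev space is
    complete ([H2_complete]), and in a complete space with a scalar product bounded
    sequences have weakly convergent subsequences ([bounded_weak_subseq]). The
    weak limit is obtained without representing functionals by vectors: it is the
    strong limit of vectors of almost least norm in the convex hulls of the tails.

    Uniform convergence. A curve is the primitive of its weak derivative
    ([weak_derivative_primitive]), so it is Hoelder continuous with exponent 1/2
    and a constant given by its norm ([H2_holder]). Hence point evaluations are
    bounded functionals. A weakly convergent sequence is bounded
    ([weakly_bounded_bounded]), converges at every point and is equicontinuous;
    it therefore converges uniformly ([H2_weak_cvg_sup]), which is the second
    claim.

    Sampling. Almost surely all the samples lie in a bounded region, and their
    frequencies in each of the countably many cells with rational corners converge
    to the probabilities of the cells ([cell_frequencies]). The distance of a data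
    point to the nearest of finitely many Sobolev curves varies little across
    small cells ([min_dist_osc]). So the data terms of all the competitors
    converge outside one null set, although there are uncountably many
    competitors ([empirical_min_dist_cvg]).

    Limit points. Let minimizers [u m] converge weakly to [v]. Uniform convergence
    makes the data terms of [u m] and of [v] close, uniformly in the number of
    samples ([empirical_weak_cvg]), and the energy is weakly lower semicontinuous
    ([H2_weak_lsc]). For every competitor [nu] this gives
      f_lim v <= liminf f_n (u m) <= lim f_n nu = f_lim nu,
    that is, [v] minimizes the limit functional ([weak_limit_minimizes]). *)

(** * Subsequences *)

Lemma extraction_comp (s t : nat -> nat) :
  extraction s -> extraction t -> extraction (s \o t).
Proof. by move=> hs ht m n mn /=; apply/hs/ht. Qed.

Lemma extraction_ge (s : nat -> nat) : extraction s -> forall n, (n <= s n)%N.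
Proof.
by move=> hs; elim=> [//|n IH]; apply: (leq_ltn_trans IH); apply: hs.
Qed.

Lemma extraction_cvg (T : topologicalType) (u : nat -> T) (l : T) s :
  extraction s -> u @ \oo --> l -> (fun m => u (s m)) @ \oo --> l.
Proof.
move=> hs; apply: cvg_comp; apply/cvgnyPge => A; exists A => // n /= An.
exact: leq_trans An (extraction_ge hs n).
Qed.

Lemma exists_extraction (P : nat -> nat -> Prop) :
  (forall m n, exists i, (n <= i)%N /\ P m i) ->
  exists s, extraction s /\ forall m, P m (s m).
Proof.
move=> H; pose f m n := sval (cid (H m n)).
have Hf m n : (n <= f m n)%N /\ P m (f m n) by exact: (svalP (cid (H m n))).
pose s := fix s m := if m is m'.+1 then f m (s m').+1 else f 0%N 0%N.
have s_lt m : (s m < s m.+1)%N by have [] := Hf m.+1 (s m).+1.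
exists s; split; last by case=> [|m] /=; apply Hf.
move=> m n; elim: n => // n IH; rewrite ltnS leq_eqVlt => /predU1P[->//|/IH].
by move=> /ltn_trans; apply.
Qed.

(** A free ultrafilter assigns a limit to all the sequences at once, which
    replaces the usual nested choice of subsequences. *)
Lemma diagonal_extraction (R : realType) (a : nat -> nat -> R) :
  (forall j, exists M : R, forall m, `|a j m| <= M) ->
  exists s, extraction s /\
    forall j, exists l : R, (fun m => a j (s m)) @ \oo --> l.
Proof.
move=> bnd; have [U [ultraU ooU]] := ultraFilterLemma (F := \oo%classic : set (set nat)) _.
have FU : ProperFilter U by exact: ultra_proper.
have /boolp.choice[p pP] : forall j, exists p : R, a j @ U --> p.
  move=> j; have [M aM] := bnd j.
  have [|p [_ clp]] := @segment_compact R (- M) M (a j @ U) _.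
    by apply: (@filterE _ U) => m; rewrite /= in_itv/= -ler_norml.
  exists p => A /= pA; have [//|UnA] := in_ultra_setVsetC (a j @^-1` A) ultraU.
  by have [x [nAx Ax]] := clp (~` A) A UnA pA.
pose P m i := forall j, (j <= m)%N -> `|p j - a j i| < m.+1%:R^-1.
have [m n|s [exs sP]] := @exists_extraction P.
  have UP : U [set i | (n <= i)%N /\ P m i].
    apply: filterI; first by apply: ooU; exists n.
    suff UQ k : U [set i | forall j, (j < k)%N -> `|p j - a j i| < m.+1%:R^-1].
      by apply: filterS (UQ m.+1) => i /= Hi j jm; apply: Hi.
    elim: k => [|k IH]; first by apply: filterE.
    have /cvgrPdist_lt/(_ m.+1%:R^-1) := pP k.
    rewrite invr_gt0 ltr0n => /(_ isT) H.
    apply: filterS2 IH H => i /= Hi1 Hi2 j; rewrite ltnS leq_eqVlt.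
    by move=> /predU1P[->//|/Hi1].
  by have [i] := filter_ex UP; exists i.
exists s; split => // j; exists (p j); apply/cvgrPdist_lt => e e0.
near=> m; have jm : (j <= m)%N by near: m; exists j.
apply: (lt_trans (sP m j jm)).
near: m; exact: near_infty_natSinv_lt (PosNum e0).
Unshelve. all: try exact: eventually_filter. all: end_near. Qed.

(** * Weak compactness in semi-inner product spaces *)

(** The form may be degenerate and is linear on the domain [D] only: a weak
    derivative is determined up to a null set, so that the scalar product of
    curves is of this kind before passing to any quotient. *)
Record semi_inner (R : realType) (V : lmodType R) (D : V -> Prop)
    (B : V -> V -> R) : Prop := SemiInner {
  si_dom0 : D 0;
  si_domP : forall a u v, D u -> D v -> D (a *: u + v);
  siC : forall u v, D u -> D v -> B u v = B v u;
  siP : forall a u v w, D u -> D v -> D w ->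
    B (a *: u + v) w = a * B u w + B v w;
  si_ge0 : forall u, D u -> 0 <= B u u }.

Definition semi_complete (R : realType) (V : lmodType R) (D : V -> Prop)
    (B : V -> V -> R) : Prop :=
  forall u : nat -> V, (forall n, D (u n)) ->
    (forall e : R, 0 < e -> exists N, forall m n, (N <= m)%N -> (N <= n)%N ->
       B (u m - u n) (u m - u n) < e) ->
    exists v, D v /\ forall e : R, 0 < e -> exists N, forall n, (N <= n)%N ->
       B (u n - v) (u n - v) < e.

Definition si_dual (R : realType) (V : lmodType R) (D : V -> Prop)
    (B : V -> V -> R) (F : V -> R) : Prop :=
  (forall a u v, D u -> D v -> F (a *: u + v) = a * F u + F v) /\
  (exists C : R, forall u, D u -> `|F u| <= C * Num.sqrt (B u u)).

Section semi_inner_theory.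
Context (R : realType) (V : lmodType R) (D : V -> Prop) (B : V -> V -> R).
Hypothesis H : semi_inner D B.
Implicit Types (u v w : V) (a : R).
Notation nrm u := (Num.sqrt (B u u)).

Lemma si_domD u v : D u -> D v -> D (u + v).
Proof. by move=> Du Dv; rewrite -[u]scale1r; apply: (si_domP H). Qed.

Lemma si_domZ a u : D u -> D (a *: u).
Proof. by move=> Du; rewrite -[_ *: _]addr0; apply: (si_domP H) => //; exact: (si_dom0 H). Qed.

Lemma si_domB u v : D u -> D v -> D (u - v).
Proof. by move=> Du Dv; rewrite -scaleN1r; apply: si_domD => //; exact: si_domZ. Qed.

Lemma siDl u v w : D u -> D v -> D w -> B (u + v) w = B u w + B v w.
Proof. by move=> *; rewrite -[u in LHS]scale1r (siP H)// mul1r. Qed.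

Lemma si0l w : D w -> B 0 w = 0.
Proof.
move=> Dw; have D0 := si_dom0 H.
by have := siDl D0 D0 Dw; rewrite addr0 => /esym/eqP; rewrite -subr_eq0 addrK => /eqP.
Qed.

Lemma siZl a u w : D u -> D w -> B (a *: u) w = a * B u w.
Proof.
by move=> Du Dw; rewrite -[_ *: _]addr0 (siP H)// ?si0l ?addr0//; exact: (si_dom0 H).
Qed.

Lemma siBl u v w : D u -> D v -> D w -> B (u - v) w = B u w - B v w.
Proof.
by move=> Du Dv Dw; rewrite -scaleN1r siDl ?siZl ?mulN1r//; exact: si_domZ.
Qed.

Lemma siDr u v w : D u -> D v -> D w -> B w (u + v) = B w u + B w v.
Proof.
by move=> *; rewrite (siC H) ?siDl//; [congr (_ + _); exact: (siC H)|exact: si_domD].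
Qed.

Lemma siZr a u w : D u -> D w -> B w (a *: u) = a * B w u.
Proof.
by move=> *; rewrite (siC H) ?siZl//; [congr (_ * _); exact: (siC H)|exact: si_domZ].
Qed.

Lemma siBr u v w : D u -> D v -> D w -> B w (u - v) = B w u - B w v.
Proof.
by move=> *; rewrite (siC H) ?siBl//; [congr (_ - _); exact: (siC H)|exact: si_domB].
Qed.

Lemma si_sqrD u v : D u -> D v ->
  B (u + v) (u + v) = B u u + 2 * B u v + B v v.
Proof.
move=> Du Dv; rewrite siDl ?siDr//; last exact: si_domD.
rewrite (siC H Dv Du); ring.
Qed.

Lemma si_sqrB u v : D u -> D v ->
  B (u - v) (u - v) = B u u - 2 * B u v + B v v.
Proof.
move=> Du Dv; rewrite siBl ?siBr//; last exact: si_domB.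
rewrite (siC H Dv Du); ring.
Qed.

Lemma si_sqrZ a u : D u -> B (a *: u) (a *: u) = a ^+ 2 * B u u.
Proof. by move=> Du; rewrite siZl ?siZr ?mulrA ?expr2//; exact: si_domZ. Qed.

Lemma si_cauchy_schwarz u v : D u -> D v -> B u v ^+ 2 <= B u u * B v v.
Proof.
move=> Du Dv; have pos t : 0 <= B u u + 2 * t * B u v + t ^+ 2 * B v v.
  have := si_ge0 H (si_domD Du (si_domZ t Dv)).
  by rewrite si_sqrD ?si_sqrZ ?siZr ?mulrA//; exact: si_domZ.
have [Bv|Bv] := eqVneq (B v v) 0.
  rewrite Bv mulr0; have [->|Buv] := eqVneq (B u v) 0; first by rewrite expr0n.
  have := pos (- (B u u + 1) / (2 * B u v)).
  rewrite Bv mulr0 addr0 (_ : 2 * _ * _ = - (B u u + 1)); last by field.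
  by move=> h; exfalso; lra.
have Bv0 : 0 < B v v by rewrite lt_def Bv (si_ge0 H).
have := pos (- B u v / B v v).
rewrite (_ : _ + _ = (B u u * B v v - B u v ^+ 2) / B v v); last by field.
by rewrite pmulr_lge0 ?invr_gt0// subr_ge0.
Qed.

Lemma si_normE u : D u -> nrm u ^+ 2 = B u u.
Proof. by move=> Du; rewrite sqr_sqrtr// (si_ge0 H). Qed.

Lemma si_norm_cs u v : D u -> D v -> `|B u v| <= nrm u * nrm v.
Proof.
move=> Du Dv; rewrite -sqrtrM ?(si_ge0 H)// -sqrtr_sqr ler_wsqrtr//.
exact: si_cauchy_schwarz.
Qed.

Lemma si_normD u v : D u -> D v -> nrm (u + v) <= nrm u + nrm v.
Proof.
move=> Du Dv; have Duv := si_domD Du Dv.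
rewrite -(@ler_pXn2r _ 2) ?nnegrE ?addr_ge0 ?sqrtr_ge0// si_normE// si_sqrD//.
rewrite sqrrD !si_normE// lerD2r lerD2l mulr_natl lerMn2r /=.
by apply: le_trans (ler_norm _) _; exact: si_norm_cs.
Qed.

Lemma si_normZ a u : D u -> nrm (a *: u) = `|a| * nrm u.
Proof. by move=> Du; rewrite si_sqrZ// sqrtrM ?sqr_ge0// sqrtr_sqr. Qed.

Lemma si_normC u v : D u -> D v -> nrm (u - v) = nrm (v - u).
Proof.
move=> Du Dv; rewrite -[u - v]opprB -[- (v - u)]scaleN1r si_normZ ?normrN1 ?mul1r//.
exact: si_domB.
Qed.

Lemma si_dualB F u v : si_dual D B F -> D u -> D v -> F (u - v) = F u - F v.
Proof.
by move=> [FP _] Du Dv; rewrite -scaleN1r addrC FP// mulN1r addrC.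
Qed.

Lemma si_dual_inner w : D w -> si_dual D B (B^~ w).
Proof.
move=> Dw; split=> [a u v Du Dv|]; first exact: (siP H).
by exists (nrm w) => u Du; rewrite mulrC; exact: si_norm_cs.
Qed.

End semi_inner_theory.

(** Midpoints alone suffice: they are all that the parallelogram identity
    compares. *)
Inductive midpoint_hull (R : realType) (V : lmodType R) (A : V -> Prop) : V -> Prop :=
| Midpoint_base u : A u -> midpoint_hull A u
| Midpoint_mid u v : midpoint_hull A u -> midpoint_hull A v ->
    midpoint_hull A (2^-1 *: (u + v)).

Section weak_compactness.
Context (R : realType) (V : lmodType R) (D : V -> Prop) (B : V -> V -> R).
Hypothesis H : semi_inner D B.
Hypothesis complete : semi_complete D B.
Implicit Types (u v w : V) (a : R) (x : nat -> V).

Let tail x n : V -> Prop := fun u => exists m, (n <= m)%N /\ u = x m.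

Let tail_hull_le x m n u : (n <= m)%N ->
  midpoint_hull (tail x m) u -> midpoint_hull (tail x n) u.
Proof.
move=> nm; elim=> [v [k [mk ->]]|v w _ IHv _ IHw].
  by apply: Midpoint_base; exists k; rewrite (leq_trans nm).
exact: Midpoint_mid.
Qed.

Let hull_dom x n u : (forall n, D (x n)) -> midpoint_hull (tail x n) u -> D u.
Proof.
move=> Dx; elim=> [v [m [_ ->]]//|v w _ Dv _ Dw].
by apply: (si_domZ H); exact: (si_domD H).
Qed.

Let hull_dual x n u F (l e : R) : (forall n, D (x n)) -> si_dual D B F ->
  (forall m, (n <= m)%N -> `|F (x m) - l| <= e) ->
  midpoint_hull (tail x n) u -> `|F u - l| <= e.
Proof.
move=> Dx [FP _] Fl; elim=> [v [m [nm ->]]|v w hv IHv hw IHw]; first exact: Fl.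
have Dv := hull_dom Dx hv; have Dw := hull_dom Dx hw.
have F0 : F 0 = 0.
  have := FP 1 0 0 (si_dom0 H) (si_dom0 H).
  by rewrite scaler0 addr0 mul1r => /eqP; rewrite -subr_eq0 opprD addNKr oppr_eq0 => /eqP.
rewrite -[_ *: _]addr0 FP//; [|exact: (si_domD H)|exact: (si_dom0 H)].
rewrite F0 -[v]scale1r FP// mul1r.
move: IHv IHw; rewrite !ler_norml => /andP[? ?] /andP[? ?]; apply/andP; split; lra.
Qed.

(** The least norms over the convex hulls of the tails increase to a limit. By the
    parallelogram identity, hull vectors that almost attain them form a Cauchy
    sequence, since their midpoints cannot be much shorter. *)
Lemma tail_hull_limit x M : (forall n, D (x n)) -> (forall n, B (x n) (x n) <= M) ->
  exists y, D y /\ forall (e : R) n, 0 < e ->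
    exists z, [/\ D z, midpoint_hull (tail x n) z & B (z - y) (z - y) < e].
Proof.
move=> Dx xM; pose S n := [set B z z | z in midpoint_hull (tail x n)].
pose d n := inf (S n).
have S0 n : S n !=set0.
  by exists (B (x n) (x n)), (x n) => //; apply: Midpoint_base; exists n.
have Slb n : lbound (S n) 0.
  by move=> _ [z hz <-]; apply: (si_ge0 H); exact: hull_dom hz.
have hS n : has_inf (S n) by split => //; exists 0.
have d_le n z : midpoint_hull (tail x n) z -> d n <= B z z.
  by move=> hz; apply: ge_inf; [exists 0|exists z].
have d_nd m n : (m <= n)%N -> d m <= d n.
  move=> mn; apply: lb_le_inf => // _ [z hz <-]; apply: d_le.
  exact: tail_hull_le hz.
have dM n : d n <= M.
  apply: le_trans (xM n); apply: d_le.
  by apply: Midpoint_base; exists n.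
have /cvg_ex[l /= dl] : cvgn d.
  by apply: nondecreasing_is_cvgn => //; exists M => _ [n _ <-].
have dl_le n : d n <= l.
  have <- := cvg_lim (@Rhausdorff R) dl.
  by apply: nondecreasing_cvgn_le => //; apply/cvg_ex; exists l.
have yex n : exists z, midpoint_hull (tail x n) z /\ B z z < d n + n.+1%:R^-1.
  have [_ [z hz <-]] := inf_adherent (ltac:(by rewrite invr_gt0 ltr0n) : 0 < n.+1%:R^-1 :> R) (hS n).
  by exists z.
pose y n := sval (cid (yex n)).
have hy n : midpoint_hull (tail x n) (y n) by exact: (svalP (cid (yex n))).1.
have yd n : B (y n) (y n) < d n + n.+1%:R^-1 by exact: (svalP (cid (yex n))).2.
have Dy n : D (y n) by exact: hull_dom (hy n).
have [|v [Dv yv]] := @complete y Dy.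
  move=> e e0; have e80 : 0 < e / 8 by lra.
  move/cvgrPdist_lt : dl => /(_ _ e80)[N1 _ dN1].
  have [N2 _ N2e] := near_infty_natSinv_lt (PosNum e80).
  pose N := maxn N1 N2; exists N => m n Nm Nn.
  have hN k : (N <= k)%N -> midpoint_hull (tail x N) (y k).
    by move=> Nk; apply: tail_hull_le (hy k).
  have := d_le N _ (Midpoint_mid (hN _ Nm) (hN _ Nn)).
  rewrite (si_sqrB H)// (si_sqrZ H) ?(si_sqrD H)//; last exact: (si_domD H).
  have dNl := dN1 N (leq_maxl _ _).
  have mN2 : (N2 <= m)%N by rewrite (leq_trans _ Nm)// leq_maxr.
  have nN2 : (N2 <= n)%N by rewrite (leq_trans _ Nn)// leq_maxr.
  have /= mi := N2e _ mN2; have /= ni := N2e _ nN2.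
  have ydm := yd m; have ydn := yd n; have dlm := dl_le m; have dln := dl_le n.
  move: dNl; rewrite /= ger0_norm ?subr_ge0//.
  set u := m.+1%:R^-1 in mi ydm *; set w := n.+1%:R^-1 in ni ydn *.
  set s := (2^-1) ^+ 2; have -> : s = 4^-1 by rewrite /s expr2; field.
  move=> dNl h; lra.
exists v; split => // e n e0; have [N yN] := yv e e0.
exists (y (maxn n N)); split => //; last by apply: yN; rewrite leq_maxr.
by apply: tail_hull_le (hy _); rewrite leq_maxl.
Qed.

(** A bounded functional close to [l] on a tail is close to [l] on its convex
    hull, hence at a strong limit of hull vectors. *)
Lemma hull_limit_dual x y F l : (forall n, D (x n)) -> D y ->
  (forall (e : R) n, 0 < e ->
    exists z, [/\ D z, midpoint_hull (tail x n) z & B (z - y) (z - y) < e]) ->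
  si_dual D B F -> (fun n => F (x n)) @ \oo --> l -> F y = l.
Proof.
move=> Dx Dy hy dF Fl; apply/eqP; rewrite -subr_eq0 -normr_le0.
apply/ler_addgt0Pl => e e0; rewrite addr0.
have [C FC] := dF.2.
have e2 : 0 < e / 2 by lra.
move/cvgrPdist_le : Fl => /(_ _ e2)[N _ FN].
pose C' := Num.max C 1.
have C'0 : 0 < C' by rewrite /C' lt_max ltr01 orbT.
have [|z [Dz hz zy]] := hy ((e / 2 / C') ^+ 2) N; first by rewrite exprn_gt0 ?divr_gt0.
have Fz : `|F z - l| <= e / 2.
  by apply: hull_dual hz => // m Nm; rewrite distrC; exact: FN.
have Fzy : `|F y - F z| <= e / 2.
  rewrite distrC -(si_dualB dF)//; apply: le_trans (FC _ (si_domB H Dz Dy)) _.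
  apply: (@le_trans _ _ (C' * (e / 2 / C'))); last by rewrite mulrC divfK// gt_eqF.
  apply: (@le_trans _ _ (C' * Num.sqrt (B (z - y) (z - y)))).
    by rewrite ler_wpM2r ?sqrtr_ge0// le_max lexx.
  rewrite ler_wpM2l ?(ltW C'0)//.
  have q0 : 0 <= e / 2 / C' by rewrite divr_ge0 ?(ltW C'0) ?(ltW e2).
  by rewrite -[leRHS](ger0_norm q0) -sqrtr_sqr ler_wsqrtr// ltW.
have := ler_normD (F y - F z) (F z - l); rewrite addrA subrK; lra.
Qed.

(** Along a subsequence all the products with the [x j] converge; let [y] be its
    hull limit. A functional [F] that does not converge to [F y] would, along a
    further subsequence, converge to another value, which is [F y'] for the new
    hull limit [y']. But [y - y'] is orthogonal to all the [x j], so to both hull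
    limits, and its norm is zero. *)
Theorem bounded_weak_subseq x M :
  (forall n, D (x n)) -> (forall n, B (x n) (x n) <= M) ->
  exists s v, [/\ extraction s, D v &
    forall F, si_dual D B F -> (fun m => F (x (s m))) @ \oo --> F v].
Proof.
move=> Dx xM.
have xMj j m : `|B (x m) (x j)| <= M.
  apply: le_trans (si_norm_cs H (Dx m) (Dx j)) _.
  have M0 : 0 <= M by apply: le_trans (xM 0); exact: (si_ge0 H).
  by rewrite -[leRHS](sqr_sqrtr M0) expr2 ler_pM ?sqrtr_ge0// ler_wsqrtr.
have [|s [exs sL]] := @diagonal_extraction R (fun j m => B (x m) (x j)).
  by move=> j; exists M.
pose x' m := x (s m); have Dx' n : D (x' n) by exact: Dx.
have [y [Dy hy]] := tail_hull_limit Dx' (fun n => xM (s n)).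
exists s, y; split => // F dF; apply: contrapT => notFy.
have [e [e0 He]] : exists e : R, 0 < e /\
    forall n, exists m, (n <= m)%N /\ e <= `|F y - F (x' m)|.
  apply: contrapT => nex; apply: notFy; apply/cvgrPdist_lt => e e0.
  apply: contrapT => nnear; apply: nex; exists e; split => // n.
  apply: contrapT => nm; apply: nnear; exists n => // m /= nlm.
  by rewrite ltNge; apply/negP => ?; apply: nm; exists m.
have [t [ext Ht]] := @exists_extraction (fun _ m => e <= `|F y - F (x' m)|) (fun _ => He).
have [C FC] := dF.2.
have [|t' [ext' /(_ 0%N)[l Fl]]] := @diagonal_extraction R (fun _ m => F (x' (t m))).
  move=> _; exists (`|C| * Num.sqrt M) => m.
  apply: le_trans (FC _ (Dx' _)) _.
  apply: (@le_trans _ _ (`|C| * Num.sqrt (B (x' (t m)) (x' (t m))))).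
    by rewrite ler_wpM2r ?sqrtr_ge0// ler_norm.
  by rewrite ler_wpM2l// ler_wsqrtr// xM.
pose x2 m := x' (t (t' m)); have Dx2 n : D (x2 n) by exact: Dx'.
have [y' [Dy' hy']] := tail_hull_limit Dx2 (fun n => xM _).
have Fy' : F y' = l by apply: hull_limit_dual hy' dF Fl.
have Byx j : B (y - y') (x j) = 0.
  have [L xL] := sL j; have dj := si_dual_inner H (Dx j).
  rewrite (siBl H)// (hull_limit_dual Dx' Dy hy dj xL).
  rewrite (hull_limit_dual Dx2 Dy' hy' dj (l := L)) ?subrr//.
  exact: (extraction_cvg (extraction_comp ext ext') xL).
have Dw : D (y - y') by exact: (si_domB H).
have Bw v z : (forall n, D (z n)) -> (forall n, exists j, z n = x j) -> D v ->
    (forall (e : R) n, 0 < e -> exists u,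
      [/\ D u, midpoint_hull (tail z n) u & B (u - v) (u - v) < e]) ->
    B v (y - y') = 0.
  move=> Dz zx Dv hv; apply: (hull_limit_dual Dz Dv hv (si_dual_inner H Dw)).
  rewrite (_ : (fun n => _) = fun=> 0); first exact: cvg_cst.
  by apply/funext => n; have [j ->] := zx n; rewrite (siC H).
have Bww : B (y - y') (y - y') = 0.
  rewrite (siBl H)// (Bw y x') ?(Bw y' x2) ?subrr// => n; last by exists (s n).
  by exists (s (t (t' n))).
have Fyy : F y = F y'.
  apply/eqP; rewrite -subr_eq0 -(si_dualB dF)// -normr_le0.
  by apply: le_trans (FC _ Dw) _; rewrite Bww sqrtr0 mulr0.
move/cvgrPdist_lt : Fl => /(_ _ e0)[N _ /(_ N (leqnn N))/=].
by rewrite -Fy' -Fyy ltNge (Ht (t' N)).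
Qed.

(** Sokal's proof of the uniform boundedness principle: build a series of terms
    [z i] of norm [3 ^- i], choosing each sign so that the product of the partial
    sum with a very long [x (m i)] is at least that of the last term. *)
Theorem weakly_bounded_bounded x : (forall n, D (x n)) ->
  (forall y, D y -> exists M : R, forall n, `|B (x n) y| <= M) ->
  exists M, forall n, B (x n) (x n) <= M.
Proof.
move=> Dx wb; apply: contrapT => unb.
have ex (K : R) : exists n, K < Num.sqrt (B (x n) (x n)).
  apply: contrapT => nK; apply: unb; exists (`|K| ^+ 2) => n.
  rewrite -(si_normE H)// ler_pXn2r ?nnegrE ?sqrtr_ge0//.
  apply: le_trans (ler_norm K); rewrite leNgt; apply/negP => ?.
  by apply: nK; exists n.
(* Norms above [4 ^+ i] beat steps of length [3 ^- i], while all the steps after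
   the [i]-th together are only half as long as the [i]-th. *)
pose m i := sval (cid (ex (4 ^+ i))).
have mP i : 4 ^+ i < Num.sqrt (B (x (m i)) (x (m i))) by exact: (svalP (cid (ex _))).
pose c i : R := Num.sqrt (B (x (m i)) (x (m i))).
have c0 i : 0 < c i by apply: lt_trans (mP i); rewrite exprn_gt0.
pose z i := (3 ^- i / c i) *: x (m i).
have Dz i : D (z i) by exact: (si_domZ H).
have r0 i : (0 : R) < 3 ^- i by rewrite invr_gt0 exprn_gt0.
have nz i : Num.sqrt (B (z i) (z i)) = 3 ^- i.
  rewrite (si_normZ H)// -/(c i) ger0_norm ?divr_ge0 ?(ltW (c0 i)) ?(ltW (r0 i))//.
  by rewrite divfK// gt_eqF.
have Bz i : B (x (m i)) (z i) = 3 ^- i * c i.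
  rewrite (siZr H)// -(si_normE H)// -/(c i) expr2 mulrA divfK// gt_eqF//.
pose step y i := if 3 ^- i * c i <= `|B (x (m i)) (y + z i)| then y + z i else y - z i.
have Dstep y i : D y -> D (step y i).
  by move=> Dy; rewrite /step; case: ifP => _; [exact: (si_domD H)|exact: (si_domB H)].
have stepP y i : D y -> 3 ^- i * c i <= `|B (x (m i)) (step y i)|.
  move=> Dy; rewrite /step; case: ifPn => //; rewrite -ltNge.
  rewrite (siDr H)// (siBr H)// Bz => h.
  have q : 0 < 3 ^- i * c i by rewrite mulr_gt0.
  set b := B _ _ in h *; set q' := 3 ^- i * c i in h q *.
  rewrite -normrN; apply: le_trans (ler_norm _).
  move: h; rewrite ltr_norml => /andP[? ?]; lra.
have step_dist y i : D y -> Num.sqrt (B (step y i - y) (step y i - y)) <= 3 ^- i.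
  move=> Dy; rewrite /step; case: ifP => _; first by rewrite addrAC subrr add0r nz.
  by rewrite addrAC subrr add0r -scaleN1r (si_normZ H)// normrN1 mul1r nz.
pose Y := fix Y i := if i is i'.+1 then step (Y i') i else step 0 0%N.
have DY i : D (Y i) by elim: i => [|i IH]; apply: Dstep => //; exact: (si_dom0 H).
have YP i : 3 ^- i * c i <= `|B (x (m i)) (Y i)|.
  by case: i => [|i]; apply: stepP => //; exact: (si_dom0 H).
have Ydist i p : Num.sqrt (B (Y (i + p)%N - Y i) (Y (i + p)%N - Y i)) <=
    2^-1 * 3 ^- i * (1 - 3 ^- p).
  elim: p => [|p IH].
    by rewrite addn0 subrr (si0l H) ?sqrtr0 ?expr0 ?invr1 ?subrr ?mulr0//; exact: (si_dom0 H).
  rewrite addnS (_ : Y _ - Y i = (Y (i + p).+1 - Y (i + p)%N) + (Y (i + p)%N - Y i)); last first.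
    by rewrite addrA subrK.
  apply: le_trans (si_normD H _ _) _; try exact: (si_domB H).
  have := step_dist (Y (i + p)%N) (i + p).+1 (DY _); rewrite -/(Y _) => h.
  apply: le_trans (lerD h IH) _.
  rewrite le_eqVlt; apply/orP; left; apply/eqP.
  rewrite -addnS exprD !exprS; field.
  by rewrite !expf_neq0.
have r_small (e : R) : 0 < e -> exists N : nat, forall n, (N <= n)%N -> (3 ^- n : R) < e.
  move=> e0; have [N _ Ne] := near_infty_natSinv_lt (PosNum e0).
  exists N => n /Ne /=; apply: le_lt_trans; rewrite lef_pV2 ?posrE ?exprn_gt0//.
  by rewrite -natrX ler_nat ltn_expl.
have dY i n : (i <= n)%N -> Num.sqrt (B (Y n - Y i) (Y n - Y i)) <= 2^-1 * 3 ^- i.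
  move=> /subnKC <-; apply: le_trans (Ydist _ _) _.
  by rewrite ler_piMr ?mulr_ge0 ?(ltW (r0 _))// gerBl ltW.
have [|y [Dy Yy]] := @complete Y DY.
  move=> e e0; have [N /(_ N (leqnn N)) NP] := r_small (Num.min e 1) (ltac:(by rewrite lt_min e0 ltr01)).
  exists N => p n Np Nn; have DB q q' : D (Y q - Y q') by exact: (si_domB H).
  rewrite -(si_normE H)//.
  have h : Num.sqrt (B (Y p - Y n) (Y p - Y n)) <= 3 ^- N.
    rewrite (_ : Y p - Y n = (Y p - Y N) + (Y N - Y n)); last by rewrite addrA subrK.
    apply: le_trans (si_normD H _ _) _ => //.
    rewrite (si_normC H (DY N) (DY n)).
    by have := dY _ _ Np; have := dY _ _ Nn; lra.
  move: NP; rewrite lt_min => /andP[N1 N2].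
  apply: le_lt_trans (_ : 3 ^- N * 3 ^- N < e).
    by rewrite expr2 ler_pM ?sqrtr_ge0.
  by rewrite (lt_trans _ N1)// gtr_pMl.
have yY i : Num.sqrt (B (y - Y i) (y - Y i)) <= 2^-1 * 3 ^- i.
  apply/ler_addgt0Pl => e e0; have [N NP] := Yy (e ^+ 2) (exprn_gt0 2 e0).
  pose n := maxn N i; rewrite (_ : y - Y i = (y - Y n) + (Y n - Y i)); last first.
    by rewrite addrA subrK.
  apply: le_trans (si_normD H _ _) _; try exact: (si_domB H).
  apply: lerD; last by apply: dY; exact: leq_maxr.
  rewrite (si_normC H)// -[leRHS](ger0_norm (ltW e0)) -sqrtr_sqr ler_wsqrtr// ltW//.
  by apply: NP; exact: leq_maxl.
have [M xM] := wb y Dy.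
have big i : 2^-1 * (3 ^- i * 4 ^+ i) <= M.
  apply: le_trans (xM (m i)).
  have h1 : `|B (x (m i)) (y - Y i)| <= c i * (2^-1 * 3 ^- i).
    apply: le_trans (si_norm_cs H (Dx _) (si_domB H Dy (DY i))) _.
    by rewrite ler_wpM2l ?(ltW (c0 i)).
  have h2 := YP i.
  have h3 : 3 ^- i * 4 ^+ i <= 3 ^- i * c i by rewrite ler_wpM2l ?(ltW (r0 i)) ?ltW.
  rewrite -[X in `|B _ X|](subrK (Y i)) (siDr H)//; last exact: (si_domB H).
  have := lerB_normD (B (x (m i)) (Y i)) (B (x (m i)) (y - Y i)).
  rewrite [X in _ <= `|X| -> _]addrC; lra.
have bern (i : nat) : 1 + i%:R / 3 <= 3 ^- i * 4 ^+ i :> R.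
  elim: i => [|i IH]; first by rewrite !expr0 invr1 mul0r addr0 mul1r.
  have i0 : (0 : R) <= i%:R by [].
  rewrite (_ : 3 ^- i.+1 * 4 ^+ i.+1 = 3 ^- i * 4 ^+ i * (4 / 3) :> R).
    by rewrite -natr1; lra.
  by rewrite !exprS; field; rewrite expf_neq0.
pose K := Num.trunc (6 * `|M|).
have := bern K.+1; have := big K.+1; have := truncnS_gt (6 * `|M|).
have := ler_norm M; rewrite -/K; lra.
Qed.

End weak_compactness.

(** * Completeness of square integrable functions *)

Section square_integrable.
Context (R : realType) (d : measure_display) (X : measurableType d)
  (mu : {measure set X -> \bar R}) (D : set X).
Hypothesis mD : measurable D.
Implicit Types f g h : X -> R^o.

(** The codomain [R^o] makes functions a module over [R], as the abstract theory
    requires. *)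
Definition sq_integrable (f : X -> R^o) : Prop :=
  measurable_fun D (f : X -> R) /\ mu.-integrable D (fun x => ((f x : R) ^+ 2)%:E).

Definition L2_inner (f g : X -> R^o) : R := \int[mu]_(x in D) ((f x : R) * g x).

Lemma sq_integrable_mul f g : sq_integrable f -> sq_integrable g ->
  mu.-integrable D (fun x => ((f x : R) * g x)%:E).
Proof.
move=> [mf f2] [mg g2].
have := integrableD mD f2 g2; apply: le_integrable => //.
  by apply/measurable_EFinP; exact: measurable_funM.
move=> x Dx; rewrite /= lee_fin.
rewrite [leRHS]ger0_norm ?addr_ge0 ?sqr_ge0// normrM.
have := sqr_ge0 (`|f x| - `|g x|); rewrite sqrrB !real_normK ?num_real//.
have := mulr_ge0 (normr_ge0 (f x)) (normr_ge0 (g x)).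
set a := `|f x| * `|g x|; lra.
Qed.

Lemma sq_integrableP (a : R) f g : sq_integrable f -> sq_integrable g ->
  sq_integrable (a *: f + g).
Proof.
move=> sf sg; have [mf f2] := sf; have [mg g2] := sg; split.
  by apply: measurable_funD => //; exact: measurable_funM.
have fg := sq_integrable_mul sf sg.
have := integrableD mD (integrableD mD (integrableZl mD (a ^+ 2) f2)
  (integrableZl mD (2 * a) fg)) g2.
apply: eq_integrable => // x _ /=; rewrite -!EFinM -!EFinD; congr EFin.
rewrite !fctE /GRing.scale /=; ring.
Qed.

Lemma sq_integrable0 : sq_integrable 0.
Proof.
split; first exact: measurable_cst.
by apply: eq_integrable (integrable0 mu D) => // x _; rewrite expr0n.
Qed.

Lemma sq_integrableB f g : sq_integrable f -> sq_integrable g ->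
  sq_integrable (f - g).
Proof.
by move=> sf sg; rewrite addrC -scaleN1r; exact: sq_integrableP.
Qed.

Lemma L2_semi_inner : semi_inner sq_integrable L2_inner.
Proof.
split; [exact: sq_integrable0|exact: sq_integrableP| | |].
- by move=> f g _ _; apply: eq_Rintegral => x _; rewrite mulrC.
- move=> a f g h sf sg sh; have fh := sq_integrable_mul sf sh.
  have gh := sq_integrable_mul sg sh.
  rewrite /L2_inner -RintegralZl// -RintegralD//.
    by apply: eq_Rintegral => x _; rewrite !fctE /GRing.scale /= mulrDl mulrA.
  by apply: eq_integrable (integrableZl mD a fh) => // x _ /=; rewrite EFinM.
- by move=> f _; apply: Rintegral_ge0 => x _; rewrite -expr2 sqr_ge0.
Qed.

Lemma L2_innerE f : sq_integrable f ->
  (L2_inner f f)%:E = (\int[mu]_(x in D) ((f x : R) ^+ 2)%:E)%E.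
Proof.
move=> [_ f2]; rewrite -[RHS]fineK; last exact: integrable_fin_num.
by congr EFin.
Qed.

(** Fatou's lemma turns a Cauchy bound into the bound at an a.e. limit. *)
Lemma L2_limit_bound (u : nat -> X -> R^o) f (e : R) :
  (forall n, sq_integrable (u n)) -> measurable_fun D (f : X -> R) ->
  (\forall x \ae mu, D x -> (fun n => (u n x : R)) @ \oo --> (f x : R)) ->
  (exists N : nat, forall n, (N <= n)%N -> L2_inner (u n) (u n) <= e) ->
  sq_integrable f /\ L2_inner f f <= e.
Proof.
move=> su mf uf [N uN].
have mF (g : X -> R^o) : measurable_fun D (g : X -> R) ->
    measurable_fun D (fun x => ((g x : R) ^+ 2)%:E).
  by move=> mg; apply/measurable_EFinP; exact: measurable_funX.
have key : (\int[mu]_(x in D) ((f x : R) ^+ 2)%:E <= e%:E)%E.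
  apply: (@le_trans _ _ (\int[mu]_(x in D) limn_einf (fun n => ((u n x : R) ^+ 2)%:E))%E).
    rewrite le_eqVlt; apply/orP; left; apply/eqP/ae_eq_integral => //.
    - exact: mF.
    - under eq_fun do rewrite -[limn_einf _]oppeK -limn_esupN.
      apply: measurableT_comp => //; apply: measurable_fun_limn_esup => n.
      by apply: measurableT_comp => //; apply: mF; exact: (su n).1.
    - apply: filterS uf => x ux Dx.
      have c : (fun n => ((u n x : R) ^+ 2)%:E) @ \oo --> ((f x : R) ^+ 2)%:E.
        apply/cvg_EFin; first exact: nearW.
        by rewrite /comp /=; under eq_fun do rewrite expr2; rewrite expr2; apply: cvgM; exact: ux.
      rewrite is_cvg_limn_einfE; last by apply/cvg_ex; eexists; exact: c.
      by apply/esym; apply: cvg_lim c; exact: ereal_hausdorff.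
  apply: le_trans (fatou _ _ _ _) _ => //.
  - by move=> n; apply: mF; exact: (su n).1.
  - by move=> n x _; rewrite lee_fin sqr_ge0.
  rewrite limn_einf_lim; apply: lime_le; first exact: is_cvg_einfs.
  apply: nearW => n.
  apply: ereal_inf_le; exists (\int[mu]_(x in D) ((u (maxn n N) x : R) ^+ 2)%:E)%E.
    by exists (maxn n N) => //=; exact: leq_maxl.
  by rewrite -L2_innerE// lee_fin uN// leq_maxr.
have sf : sq_integrable f.
  split => //; apply/integrableP; split; first exact: mF.
  under eq_integral do rewrite gee0_abs ?lee_fin ?sqr_ge0//.
  by apply: le_lt_trans key _; rewrite ltry.
by split => //; rewrite -lee_fin L2_innerE.
Qed.

(** The increments are dominated by a multiple of [2 ^- i]. *)
Lemma telescope_sq_cvg (a : nat -> R) (K : R) :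
  (forall i, 4 ^+ i * (a i.+1 - a i) ^+ 2 <= K) -> exists l : R, a @ \oo --> l.
Proof.
move=> aK; suff : cvgn a by move=> /cvg_ex[l al]; exists l.
have K0 : 0 <= K by apply: le_trans (aK 0%N); rewrite mulr_ge0 ?sqr_ge0.
rewrite (_ : a = fun n => a 0%N + series (telescope a) n); last first.
  by apply/funext => n; rewrite -eq_sum_telescope.
apply: is_cvgD; first exact: is_cvg_cst.
apply: normed_cvg.
apply: (@series_le_cvg _ _ (geometric (Num.sqrt K) 2^-1)).
- by move=> n /=.
- by move=> n /=; rewrite mulr_ge0 ?sqrtr_ge0 ?exprn_ge0.
- move=> n; rewrite /telescope /=.
  rewrite -(@ler_pXn2r _ 2) ?nnegrE ?mulr_ge0 ?sqrtr_ge0 ?exprn_ge0//.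
  rewrite exprMn sqr_sqrtr// exprVn exprVn -!exprM mulnC exprM real_normK ?num_real//.
  by rewrite ler_pdivlMr ?exprn_gt0// mulrC (_ : 2 ^+ 2 = 4) ?aK//; ring.
- by apply: is_cvg_geometric_series; rewrite ger0_norm ?invr_ge0// invf_lt1 ?ltr1n.
Qed.

(** The series of the [4 ^+ i * (u i.+1 - u i) ^+ 2] has integral at most the sum
    of the [2 ^- i], hence is finite almost everywhere. *)
Lemma L2_fast_subseq_ae (u : nat -> X -> R^o) :
  (forall n, sq_integrable (u n)) ->
  (forall i, L2_inner (u i.+1 - u i) (u i.+1 - u i) <= 8 ^- i) ->
  \forall x \ae mu, D x -> exists l : R, (fun i => (u i x : R)) @ \oo --> l.
Proof.
move=> su u8; pose h i (x : X) := (4 ^+ i * ((u i.+1 x : R) - u i x) ^+ 2)%:E.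
have h0 i x : (0 <= h i x)%E by rewrite lee_fin mulr_ge0 ?sqr_ge0 ?exprn_ge0.
have mh i : measurable_fun D (h i).
  apply/measurable_EFinP; apply: measurable_funM => //.
  by apply: measurable_funX; apply: measurable_funB; apply: (su _).1.
have ih i : (\int[mu]_(x in D) h i x <= (2 ^- i)%:E)%E.
  have sB := sq_integrableB (su i.+1) (su i).
  under eq_integral do rewrite /h EFinM.
  rewrite integralZl//; last by case: sB.
  rewrite (_ : (\int[mu]_(x in D) _)%E = (L2_inner (u i.+1 - u i) (u i.+1 - u i))%:E).
    rewrite -EFinM lee_fin.
    apply: le_trans (ler_wpM2l _ (u8 i)) _; first by rewrite exprn_ge0.
    rewrite le_eqVlt; apply/orP; left; apply/eqP.
    by rewrite (_ : 8 = 4 * 2 :> R) ?exprMn; [field; rewrite !expf_neq0|ring].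
  by rewrite L2_innerE.
have mS : measurable_fun D (fun x => \sum_(0 <= i <oo) h i x)%E.
  by apply: ge0_emeasurable_sum.
have iS : mu.-integrable D (fun x => \sum_(0 <= i <oo) h i x)%E.
  apply/integrableP; split => //.
  under eq_integral do rewrite gee0_abs ?nneseries_ge0//.
  rewrite integral_nneseries//.
  apply: (@le_lt_trans _ _ (\sum_(0 <= i <oo) (2 ^- i : R)%:E)%E).
    by apply: lee_nneseries => // i _ _; exact: integral_ge0.
  have := @cvg_geometric_eseries_half R 2 0.
  rewrite [X in eseries X](_ : _ = fun k => (2 ^- k)%:E); last first.
    by apply/funext => k; rewrite addn1 natrX exprS invfM mulrA divff ?mul1r.
  by move/cvg_lim => ->//; rewrite ltry.
have := integrable_ae mD iS; apply: filterS => x + Dx => /(_ Dx) fx.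
apply: (@telescope_sq_cvg _ (fine (\sum_(0 <= i <oo) h i x)%E)) => i.
rewrite -lee_fin fineK//.
apply: le_trans (nneseries_lim_ge i.+1 _); last by move=> k _ _; exact: h0.
by rewrite big_nat_recr//= leeDr// sume_ge0.
Qed.

(** Riesz and Fischer: a fast subsequence converges almost everywhere, and Fatou's
    lemma shows that its limit is also the limit in norm. *)
Lemma L2_complete : semi_complete sq_integrable L2_inner.
Proof.
move=> u su cu.
have [i n|s [exs sP]] := @exists_extraction (fun i n => forall p q, (n <= p)%N -> (n <= q)%N ->
   L2_inner (u p - u q) (u p - u q) < 8 ^- i).
  have [|N NP] := cu (8 ^- i); first by rewrite invr_gt0 exprn_gt0.
  exists (maxn n N); split; first exact: leq_maxl.
  move=> p q; rewrite !geq_max => /andP[_ Np] /andP[_ Nq]; exact: NP.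
pose w i := u (s i); have sw i : sq_integrable (w i) by exact: su.
have [f mf wf] : exists2 f : X -> R^o, measurable_fun D (f : X -> R) &
    \forall x \ae mu, D x -> (fun i => (w i x : R)) @ \oo --> (f x : R).
  exists (fun x => fine (limn_esup (fun i => (w i x : R)%:E)) : R^o).
    apply: (@measurable_comp _ _ _ _ _ _ setT) => //.
    by apply: measurable_fun_limn_esup => n; apply/measurable_EFinP; exact: (sw n).1.
  have := L2_fast_subseq_ae sw _.
  have h8 i : L2_inner (w i.+1 - w i) (w i.+1 - w i) <= 8 ^- i.
    by apply/ltW/sP => //; exact/ltnW/exs.
  move=> /(_ h8); apply: filterS => x + Dx => /(_ Dx)[l wl].
  have c : (fun i => (w i x : R)%:E) @ \oo --> l%:E.
    by apply/cvg_EFin; [exact: nearW|].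
  rewrite is_cvg_limn_esupE; last by apply/cvg_ex; eexists; exact: c.
  by rewrite (cvg_lim _ c)//.
have key n e : 0 < e -> (exists N : nat, forall m, (N <= m)%N ->
    L2_inner (u m - u n) (u m - u n) <= e) ->
    sq_integrable (f - u n) /\ L2_inner (f - u n) (f - u n) <= e.
  move=> e0 [N NP].
  apply: (@L2_limit_bound (fun i => w i - u n)).
  - by move=> i; exact: sq_integrableB.
  - by apply: measurable_funB => //; exact: (su n).1.
  - apply: filterS wf => x + Dx => /(_ Dx) wx.
    by apply: cvgB => //; exact: cvg_cst.
  - exists N => i Ni; apply: NP; apply: leq_trans Ni _; exact: extraction_ge.
have [N1 NP1] := cu 1 ltr01.
have sf : sq_integrable f.
  have [|sfu _] := key N1 1 ltr01.
    by exists N1 => m N1m; apply/ltW/NP1.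
  rewrite -[f](subrK (u N1)) -[f - _]scale1r; exact: sq_integrableP.
exists f; split => // e e0; have e2 : 0 < e / 2 by lra.
have [N NP] := cu _ e2; exists N => n Nn.
have [|_ fu] := key n _ e2.
  by exists N => m Nm; apply/ltW/NP.
have H := L2_semi_inner.
rewrite -opprB -scaleN1r (si_sqrZ H); last exact: sq_integrableB.
by rewrite sqrrN expr1n mul1r; apply: le_lt_trans fu _; lra.
Qed.

End square_integrable.

(** * Smooth bumps *)

Section bump.
Context (R : realType).
Implicit Types (f g : R -> R) (x : R).

(** The family [x ^- n * exp (- 1 / x)] on the positive half line is stable
    under derivation up to linear combinations. *)
Definition flat_exp (n : nat) (x : R) : R :=
  if 0 < x then x^-1 ^+ n * expR (- x^-1) else 0.

(** From [expR y >= (y / m) ^+ m] for [m = n + 2] and [y = x^-1]. *)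
Lemma flat_exp_small n : exists C : R, forall x, `|flat_exp n x| <= C * x ^+ 2.
Proof.
pose m := n.+2; exists (m%:R ^+ m) => x; rewrite /flat_exp.
have [x0|x0] := ltP 0 x; last by rewrite normr0 mulr_ge0 ?sqr_ge0 ?exprn_ge0.
rewrite ger0_norm ?mulr_ge0 ?expR_ge0 ?exprn_ge0 ?invr_ge0 ?(ltW x0)//.
have m0 : (0 : R) < m%:R by [].
set y := x^-1; have y0 : 0 < y by rewrite invr_gt0.
have -> : x = y^-1 by rewrite invrK.
have h : (y / m%:R) ^+ m <= expR y.
  rewrite -[y in leRHS](@divfK _ m%:R) ?gt_eqF// expRM_natr.
  rewrite ler_pXn2r ?nnegrE ?expR_ge0 ?divr_ge0 ?(ltW y0)//.
  by apply: le_trans (expR_ge1Dx _); lra.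
rewrite expRN ler_pdivrMr ?expR_gt0//.
apply: le_trans (_ : _ <= m%:R ^+ m * y^-1 ^+ 2 * (y / m%:R) ^+ m) _; last first.
  by rewrite ler_pM2l// mulr_gt0 ?exprn_gt0 ?invr_gt0.
rewrite le_eqVlt; apply/orP; left; apply/eqP.
rewrite (exprMn _ y m%:R^-1) [m%:R^-1 ^+ m]exprVn.
have M0 : (m%:R : R) ^+ m != 0 by rewrite expf_neq0 ?gt_eqF.
set M := _ ^+ m in M0 *; have -> : y ^+ m = y ^+ n * y ^+ 2 by rewrite -exprD addn2.
by field; rewrite M0 gt_eqF.
Qed.

Lemma is_derive_quadratic f C : (forall x, `|f x| <= C * x ^+ 2) ->
  is_derive (0 : R) 1 (f : R -> R) 0.
Proof.
move=> fC; have f0 : f 0 = 0.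
  by apply/eqP; rewrite -normr_le0; have := fC 0; rewrite expr0n mulr0.
have C0 : 0 <= C by have := fC 1; rewrite expr1n mulr1; apply: le_trans.
have key : (fun h : R => h^-1 *: ((f \o shift 0) (h *: (1 : R)) - f 0)) @ 0^' --> (0 : R).
  apply/cvgrPdist_lt => e e0; near=> h.
  have h0 : h != 0 by near: h; exact: nbhs_dnbhs_neq.
  rewrite sub0r normrN /= f0 subr0 addr0 /GRing.scale /= mulr1 normrM normfV.
  rewrite mulrC ltr_pdivrMr ?normr_gt0//.
  apply: le_lt_trans (fC h) _; rewrite -real_normK ?num_real// expr2 mulrA.
  rewrite ltr_pM2r ?normr_gt0//.
  apply: (@le_lt_trans _ _ ((C + 1) * `|h|)); first by rewrite ler_wpM2r// lerDl.
  rewrite -ltr_pdivlMl ?ltr_wpDl//.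
  near: h; apply: dnbhs0_lt; rewrite mulr_gt0 ?invr_gt0 ?ltr_wpDl//.
by apply: DeriveDef; [apply/cvg_ex; exists 0|exact: cvg_lim key].
Unshelve. all: by end_near. Qed.

Lemma is_derive_flat_exp n x :
  is_derive x 1 (flat_exp n : R -> R) (flat_exp n.+2 x - n%:R * flat_exp n.+1 x).
Proof.
have [x0|x0|->] := ltgtP x 0.
- have -> : flat_exp n.+2 x - n%:R * flat_exp n.+1 x = 0.
    by rewrite /flat_exp !ltNge (ltW x0)/= mulr0 subr0.
  apply: (@near_eq_is_derive _ _ _ (cst 0)).
  near=> y; rewrite /flat_exp ltNge ifF//; apply/negbTE; rewrite negbK ltW//.
  by near: y; exact: lt_nbhsl.
- apply: (@near_eq_is_derive _ _ _ (fun y : R => y^-1 ^+ n * expR (- y^-1) : R)).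
    near=> y; rewrite /flat_exp ifT//.
    by near: y; exact: lt_nbhsr.
  have dV : is_derive x 1 (fun y : R => y^-1) (- x ^- 2).
    apply: is_derive_eq (@is_deriveV _ (fun y => y) x 1 1 _ (is_derive_id x 1)) _.
      by rewrite gt_eqF.
    by rewrite /GRing.scale /= mulr1.
  have dX := is_deriveX n dV.
  have dN := is_deriveN dV.
  have dE := @is_derive1_comp R expR (fun y => - y^-1) x _ _ (is_derive_expR (- x^-1)) dN.
  rewrite (_ : (fun y => _) = (GRing.inv : R -> R) ^+ n * (expR \o (fun y => - y^-1))); last first.
    by apply/funext => y; rewrite fctE exprfctE.
  apply: is_derive_eq (is_deriveM dX dE) _; rewrite exprfctE.
  rewrite /flat_exp x0 /= /GRing.scale /=.
  case: n {dX} => [|n] /=; first by rewrite !expr0 !mul0r; field; rewrite gt_eqF.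
  by rewrite !exprS; field; rewrite gt_eqF.
- rewrite {2 3}/flat_exp ltxx mulr0 subr0.
  by have [C HC] := flat_exp_small n; exact: is_derive_quadratic HC.
Unshelve. all: by end_near. Qed.

(** An algebra of functions closed under derivation, so that all its members are
    smooth at once. *)
Inductive smooth_alg : (R -> R) -> Prop :=
| Smooth_flat n : smooth_alg (flat_exp n)
| Smooth_cst c : smooth_alg (cst c)
| Smooth_add f g : smooth_alg f -> smooth_alg g -> smooth_alg (f \+ g)
| Smooth_mul f g : smooth_alg f -> smooth_alg g -> smooth_alg (f \* g)
| Smooth_affine a b f : smooth_alg f -> smooth_alg (fun x => f (a * x + b)).

Lemma smooth_alg_derive f : smooth_alg f ->
  exists2 f', smooth_alg f' & forall x, is_derive x 1 (f : R -> R) (f' x).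
Proof.
elim=> {f} [n|c|f g _ [f' sf' df] _ [g' sg' dg]|f g sf [f' sf' df] sg [g' sg' dg]|a b f sf [f' sf' df]].
- exists (flat_exp n.+2 \+ (cst (- n%:R) \* flat_exp n.+1)).
    by apply: Smooth_add; [|apply: Smooth_mul]; constructor.
  by move=> x; rewrite /= mulNr; exact: is_derive_flat_exp.
- by exists (cst 0) => [|x]; [constructor|exact: is_derive_cst].
- by exists (f' \+ g') => [|x]; [constructor|exact: is_deriveD].
- exists ((f' \* g) \+ (f \* g')); first by constructor; constructor.
  move=> x; apply: is_derive_eq (is_deriveM (df x) (dg x)) _.
  by rewrite /GRing.scale /= addrC [f' x * _]mulrC.
- exists (cst a \* (fun x => f' (a * x + b))); first by do 2 constructor.
  move=> x; have da : is_derive x 1 (fun x : R => a * x + b) a.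
    rewrite (_ : (fun x => _) = (a *: (id : R -> R)) + cst b) //.
    apply: is_derive_eq (is_deriveD (is_deriveZ a (is_derive_id x 1)) (is_derive_cst b x 1)) _.
    by rewrite addr0 /GRing.scale /= mulr1.
  by apply: is_derive_eq (@is_derive1_comp R f (fun x => a * x + b) x _ _ (df _) da) _; rewrite /= mulrC.
Qed.

Definition smooth f : Prop := forall (m : nat) (x : R), derivable (derive1n m f) x 1.

Lemma derive1_is_derive f f' : (forall x, is_derive x 1 (f : R -> R) (f' x)) ->
  derive1 f = f'.
Proof. by move=> df; apply/funext => x; rewrite derive1E; have [] := df x. Qed.

Lemma smooth_alg_smooth f : smooth_alg f -> smooth f.
Proof.
move=> sf m; elim: m f sf => [|m IH] f sf x.
  by have [f' _ df] := smooth_alg_derive sf; have [] := df x.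
have [f' sf' df] := smooth_alg_derive sf.
by rewrite derive1Sn (derive1_is_derive df); exact: IH.
Qed.

Lemma smooth_derive1 f : smooth f -> smooth (derive1 f).
Proof. by move=> sf m x; rewrite -derive1Sn; exact: sf. Qed.

Lemma smooth_derivable f x : smooth f -> derivable f x 1.
Proof. by move=> sf; have := sf 0%N x. Qed.

Lemma smooth_continuous f : smooth f -> continuous f.
Proof.
move=> sf x; apply: differentiable_continuous.
by apply/derivable1_diffP; exact: smooth_derivable.
Qed.

Lemma smooth_derive1_inv f g : (forall x, is_derive x 1 (f : R -> R) (g x)) ->
  smooth g -> smooth f.
Proof.
move=> df sg [|m] x; first by have [] := df x.
by rewrite derive1Sn (derive1_is_derive df); exact: sg.
Qed.

Lemma smoothZ (a : R) f : smooth f -> smooth (fun x => a * f x).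
Proof.
move=> sf m x; have -> : derive1n m (fun x => a * f x) = a *: derive1n m f.
  elim: m => [//|m IH]; rewrite !derive1nS IH; apply/funext => y.
  rewrite derive1E deriveZ; last exact: sf.
  by rewrite fctE derive1E.
by apply: derivableZ; exact: sf.
Qed.

Lemma smoothD f g : smooth f -> smooth g -> smooth (f \+ g).
Proof.
move=> sf sg m x; have -> : derive1n m (f \+ g) = derive1n m f + derive1n m g.
  elim: m => [//|m IH]; rewrite !derive1nS IH; apply/funext => y.
  by rewrite derive1E deriveD ?fctE ?derive1E.
by apply: derivableD; [exact: sf|exact: sg].
Qed.

(** A compact support inside [`]0, T[] leaves a margin at both ends. *)
Lemma test_functionP T f : test_function T f <->
  smooth f /\ exists a b, [/\ 0 < a, b < T & forall x, ~~ (a <= x <= b) -> f x = 0].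
Proof.
split=> [[sf cK KT]|[sf [a [b [a0 bT fab]]]]]; last first.
  have sub : closure [set x | f x != 0] `<=` `[a, b].
    rewrite [X in _ `<=` X](closure_id _).1; last exact: interval_closed.
    apply: closureS => x /= fx; rewrite in_itv/=; apply: contraNT fx => xab.
    by apply/eqP/fab.
  split => //; last first.
    apply: subset_trans sub _ => x /=; rewrite !in_itv/= => /andP[ax xb].
    by rewrite (lt_le_trans a0)// (le_lt_trans xb).
  by apply: subclosed_compact sub; [exact: closed_closure|exact: segment_compact].
split => //; set K := closure _ in cK KT.
have fK x : ~ K x -> f x = 0.
  by move=> Kx; apply/eqP; apply: contra_notT Kx => fx; exact: subset_closure.
have [K0|/set0P K0] := eqVneq K set0.
  exists 1, (T - 1); split; [by []|by rewrite gtrBl|move=> x _; apply: fK].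
  by rewrite K0.
have cid_ : {within K, continuous (id : R -> R)}.
  by apply: continuous_subspaceT => x; exact: cvg_id.
have [a aK amin] := compact_EVT_min K0 cK cid_.
have [b bK bmax] := compact_EVT_max K0 cK cid_.
exists a, b; split.
- by have := KT a (set_mem aK); rewrite /= in_itv/= => /andP[].
- by have := KT b (set_mem bK); rewrite /= in_itv/= => /andP[].
- move=> x xab; apply: fK => Kx; case/negP: xab.
  by rewrite amin ?bmax// inE.
Qed.

Lemma test_function_derive T f : test_function T f -> test_function T (derive1 f).
Proof.
move=> /test_functionP[sf [a [b [a0 bT fab]]]]; apply/test_functionP; split.
  exact: smooth_derive1.
exists a, b; split => // x xab; rewrite derive1E.
have -> : 'D_1 f x = 'D_1 (cst 0 : R -> R) x; last exact: derive_cst.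
apply: near_eq_derive; move: xab; rewrite negb_and -!ltNge => /orP[xa|bx].
  near=> y; apply: fab; rewrite negb_and -ltNge; apply/orP; left.
  by near: y; exact: lt_nbhsl.
near=> y; apply: fab; rewrite negb_and -!ltNge; apply/orP; right.
by near: y; exact: lt_nbhsr.
Unshelve. all: by end_near. Qed.

(** The factor [n.+1] sharpens the two transitions, so that the bumps increase to
    the indicator of the interval. *)
Definition itv_bump (a b : R) (n : nat) (x : R) : R :=
  flat_exp 0 (n.+1%:R * (x - a)) * flat_exp 0 (n.+1%:R * (b - x)).

Lemma flat_exp0_le1 x : 0 <= flat_exp 0 x <= 1.
Proof.
rewrite /flat_exp expr0; case: ltP => [x0|_]; last by rewrite lexx ler01.
by rewrite mul1r expR_ge0 expR_le1 oppr_le0 invr_ge0 ltW.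
Qed.

Lemma itv_bump_le1 a b n x : 0 <= itv_bump a b n x <= 1.
Proof.
have /andP[u0 u1] := flat_exp0_le1 (n.+1%:R * (x - a)).
have /andP[v0 v1] := flat_exp0_le1 (n.+1%:R * (b - x)).
by rewrite /itv_bump mulr_ge0//= mulr_ile1.
Qed.

Lemma itv_bump_test T a b n : 0 < a -> b < T -> test_function T (itv_bump a b n).
Proof.
move=> a0 bT; apply/test_functionP; split; last first.
  exists a, b; split => // x; rewrite negb_and -!ltNge /itv_bump => /orP[xa|bx].
    by rewrite {1}/flat_exp pmulr_rgt0// subr_gt0 ltNge (ltW xa)/= mul0r.
  by rewrite {2}/flat_exp pmulr_rgt0// subr_gt0 ltNge (ltW bx)/= mulr0.
apply: smooth_alg_smooth.
rewrite (_ : itv_bump a b n =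
  (fun x => flat_exp 0 (n.+1%:R * x + - (n.+1%:R * a))) \*
  (fun x => flat_exp 0 ((- n.+1%:R) * x + n.+1%:R * b))); last first.
  by apply/funext => x; rewrite /itv_bump /= !mulrBr mulNr [- _ + _]addrC.
by constructor; apply: Smooth_affine; constructor.
Qed.

Lemma itv_bump_cvg a b x :
  itv_bump a b n x @[n --> \oo] --> (\1_`]a, b[%classic x : R).
Proof.
have c (y : R) : 0 < y -> flat_exp 0 (n.+1%:R * y) @[n --> \oo] --> (1 : R).
  move=> y0; rewrite (_ : (fun n => _) = fun n => expR (- (n.+1%:R^-1 * y^-1))); last first.
    by apply/funext => n; rewrite /flat_exp pmulr_rgt0// y0 expr0 mul1r invfM.
  rewrite [X in _ --> X](_ : 1 = expR (- (0 * y^-1))); last by rewrite mul0r oppr0 expR0.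
  apply: continuous_cvg; first exact: continuous_expR.
  by apply: cvgN; apply: cvgMl; exact: cvg_harmonic.
rewrite indicE; case: (boolP (x \in _)) => [|xab].
  rewrite inE/= in_itv/= => /andP[ax xb]; rewrite -[1%:R](mulr1 1).
  by apply: cvgM; apply: c; rewrite subr_gt0.
rewrite (_ : (fun n => _) = fun=> 0); first exact: cvg_cst.
apply/funext => n; have : ~~ (a < x < b).
  by apply: contra xab; rewrite inE/= in_itv.
rewrite negb_and -!leNgt /itv_bump => /orP[xa|bx].
  by rewrite {1}/flat_exp pmulr_rgt0// subr_gt0 ltNge xa/= mul0r.
by rewrite {2}/flat_exp pmulr_rgt0// subr_gt0 ltNge bx/= mulr0.
Qed.

End bump.

(** * Weak derivatives on an interval *)

Section interval_L2.
Context (R : realType) (T : R).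
Notation mu := (@lebesgue_measure R).
Notation I := (`[0, T]%classic : set R).
Notation sqI := (sq_integrable mu I).
Notation ip := (L2_inner mu I).
Notation nrm f := (Num.sqrt (ip f f)).
Implicit Types (f g w : R -> R^o) (phi psi : R -> R).

Let mI : measurable (I : set (measurableTypeR R)).
Proof. exact: measurable_itv. Qed.

Let siI := L2_semi_inner mu mI.

Lemma sqI_continuous f : {within I, continuous (f : R -> R)} -> sqI f.
Proof.
move=> cf; split; first exact: subspace_continuous_measurable_fun.
apply: (@continuous_compact_integrable R (fun x => (f x : R) ^+ 2)).
  exact: segment_compact.
by move=> x; apply: cvgM; exact: cf.
Qed.

Lemma sqI_cst (c : R) : sqI (cst c).
Proof. by apply: sqI_continuous; apply: continuous_subspaceT => x; exact: cvg_cst. Qed.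

Lemma sqI_integrable f : sqI f -> mu.-integrable I (EFin \o (f : R -> R)).
Proof.
move=> sf; have := sq_integrable_mul mI sf (sqI_cst 1).
by apply: eq_integrable => // x _ /=; rewrite mulr1.
Qed.

Lemma sqI_test phi : test_function T phi -> sqI phi.
Proof.
move=> [sphi _ _]; apply: sqI_continuous; apply: continuous_subspaceT.
exact: smooth_continuous.
Qed.

Lemma sqI_indic (a b : R) : sqI (\1_`]a, b]).
Proof.
split; first exact: measurable_indic.
apply: (@le_integrable _ _ _ mu _ _ _ (fun=> 1%E)) => //.
- by apply/measurable_EFinP; apply: measurable_funX; exact: measurable_indic.
- by move=> x _; rewrite /= lee_fin indicE; case: (_ \in _); rewrite ?expr1n ?expr0n/= normr1// normr0.
- exact: (sqI_integrable (sqI_cst 1)).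
Qed.

Definition primitive (g : R -> R^o) (t : R) : R := \int[mu]_(s in `[0, t]) (g s : R).

Lemma ip_indic g (A : set R) : ip (\1_A) g = \int[mu]_(x in I `&` A) (g x : R).
Proof.
rewrite Rintegral_mkcondr; apply: eq_Rintegral => x _.
by rewrite patchE indicE; case: (x \in _); rewrite ?mul1r ?mul0r.
Qed.

Lemma setI_subitv (s t : R) : 0 <= s -> t <= T -> I `&` `]s, t]%classic = `]s, t]%classic.
Proof.
move=> s0 tT; apply/seteqP; split=> x /=; rewrite !in_itv/=; first by case.
by move=> /andP[sx xt]; rewrite sx xt (le_trans s0 (ltW sx)) (le_trans xt tT).
Qed.

Lemma primitiveB g (s t : R) : sqI g -> 0 <= s -> s <= t -> t <= T ->
  primitive g t - primitive g s = ip (\1_`]s, t]) g.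
Proof.
move=> sg s0 st tT; rewrite ip_indic setI_subitv// /primitive Rintegral_itvB ?bnd_simp//.
apply: integrableS (sqI_integrable sg) => //.
by move=> x /=; rewrite !in_itv/= => /andP[-> /le_trans]; exact.
Qed.

Lemma indic_sqr (s t : R) : 0 <= s -> s <= t -> t <= T ->
  ip (\1_`]s, t]) (\1_`]s, t]) = t - s.
Proof.
move=> s0 st tT; rewrite ip_indic setI_subitv// (@eq_Rintegral _ _ _ mu _ (cst 1)); last first.
  by move=> x /set_mem xst; rewrite indicE mem_set.
rewrite (@Rintegral_cst _ _ _ mu) // mul1r.
have h : lebesgue_measure (`]s, t]%classic : set R) = (t - s)%:E.
  rewrite lebesgue_measure_itv/= lte_fin -EFinB.
  by move: st; rewrite le_eqVlt => /predU1P[->|->//]; rewrite ltxx subrr.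
exact: (congr1 (fine : \bar R -> R) h).
Qed.

(** Cauchy-Schwarz against the indicator of the interval from [s] to [t]. *)
Lemma primitive_holder g (s t : R) : sqI g -> 0 <= s -> s <= t -> t <= T ->
  `|primitive g t - primitive g s| <= Num.sqrt (t - s) * nrm g.
Proof.
move=> sg s0 st tT; rewrite primitiveB// -indic_sqr//.
by apply: si_norm_cs siI _ _ _ _ => //; exact: sqI_indic.
Qed.

Lemma primitive_continuous g : sqI g -> {within I, continuous (primitive g)}.
Proof.
move=> sg; have [T0|T0] := leP 0 T.
  by apply: parameterized_integral_continuous => //; exact: sqI_integrable.
by rewrite set_itv_ge ?bnd_simp -?ltNge//; exact: continuous_subspace0.
Qed.

Lemma sqI_primitive g : sqI g -> sqI (primitive g).
Proof. by move=> sg; apply: sqI_continuous; exact: primitive_continuous. Qed.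

(** The fundamental lemma of the calculus of variations. Bumps increasing to the
    indicators of intervals show that the integral of [w] over every interval
    vanishes; then [w] vanishes at its Lebesgue points. *)
Lemma sqI_zero_of_test w : sqI w ->
  (forall phi, test_function T phi -> ip w phi = 0) -> ae_eq mu I w (cst 0).
Proof.
move=> sw w0.
have iw := sqI_integrable sw.
have wab (a b : R) : 0 < a -> b < T -> \int[mu]_(x in `[a, b]) (w x : R) = 0.
  move=> a0 bT.
  have sub : (`]a, b[ : set R) `<=` I.
    by move=> x /=; rewrite !in_itv/= => /andP[ax xb]; rewrite (ltW (lt_trans a0 ax)) (ltW (lt_trans xb bT)).
  have [ab|ba] := ltP a b; last first.
    move: ba; rewrite le_eqVlt => /predU1P[->|ba].
      by rewrite set_itv1 Rintegral_set1.
    by rewrite set_itv_ge ?bnd_simp -?ltNge// Rintegral_set0.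
  rewrite -Rintegral_itv_obnd_cbnd; last first.
    apply: integrableS iw => //= x /=; rewrite !in_itv/= => /andP[ax xb].
    by rewrite (ltW (lt_trans a0 ax)) (ltW (le_lt_trans xb bT)).
  rewrite -Rintegral_itv_bndo_bndc; last exact: integrableS iw.
  have -> : \int[mu]_(x in `]a, b[) (w x : R) = ip (\1_`]a, b[) w.
    by rewrite ip_indic setIC; congr (Rintegral _ _ _); apply/esym/setIidl.
  have mw := sw.1.
  have [| | | | |_ _ cv] := @dominated_convergence _ _ _ mu I mI
    (fun n x => (itv_bump a b n x * w x)%:E) (fun x => (\1_`]a, b[%classic x * (w x : R))%:E)
    (fun x => `|w x|%:E).
  - move=> n; apply/measurable_EFinP; apply: measurable_funM => //.
    exact: (sqI_test (itv_bump_test n a0 bT)).1.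
  - by apply/measurable_EFinP; apply: measurable_funM => //; exact: measurable_indic.
  - apply: aeW => x Ix; apply/cvg_EFin; first exact: nearW.
    by apply: cvgMl; exact: itv_bump_cvg.
  - exact: integrable_norm.
  - apply: aeW => x n Ix; rewrite /= lee_fin normrM.
    have /andP[b0 b1] := itv_bump_le1 a b n x.
    by rewrite ler_piMl// ger0_norm.
  have E n : (\int[mu]_(x in I) (itv_bump a b n x * w x)%:E = 0)%E.
    have tb := itv_bump_test n a0 bT.
    rewrite -[LHS]fineK; last first.
      by apply: integrable_fin_num => //; apply: sq_integrable_mul => //; exact: sqI_test.
    congr EFin; rewrite -[RHS](w0 _ tb); apply: eq_Rintegral => x _; exact: mulrC.
  have cv0 : (fun _ : nat => 0%E : \bar R) @ \oo -->
      (\int[mu]_(x in I) (\1_`]a, b[%classic x * (w x : R))%:E)%E.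
    apply: cvg_trans cv.
    rewrite (_ : (fun=> _) = (fun n => (\int[mu]_(x in I) (itv_bump a b n x * w x)%:E)%E))//.
    by apply/funext => n; rewrite E.
  have h := cvg_unique (@ereal_hausdorff R) cv0 (cvg_cst _).
  by rewrite /L2_inner /Rintegral h.
have loc := integrable_locally mI iw.
have ae_neq (c : R) : \forall x \ae mu, x != c.
  exists [set c]; split => //; first exact: lebesgue_measure_set1.
  by move=> x /= /negP; rewrite negbK => /eqP.
have := lebesgue_differentiation loc.
apply: (@filterS3 _ _ (ae_filter_ringOfSetsType mu) _ _ _ _ _ (ae_neq 0) (ae_neq T)) => x x0 xT lx Ix.
have {Ix x0 xT} /andP[x0 xT] : 0 < x < T.
  by move: Ix; rewrite /= in_itv/= !lt_neqAle xT [0 == _]eq_sym x0.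
have ix : mu.-integrable [set` `[x / 2, T]] (EFin \o (w \_ I)).
  have sub : `[x / 2, T]%classic `<=` I.
    by move=> y /=; rewrite !in_itv/= => /andP[xy ->]; rewrite (le_trans _ xy)// divr_ge0// ltW.
  have i2 : mu.-integrable [set` `[x / 2, T]] (EFin \o (w : R -> R)) by apply: integrableS iw.
  move: i2; apply: eq_integrable => // y yI.
  by rewrite /= patchE mem_set//; apply: sub; exact: set_mem.
have x2 : x / 2 < x by lra.
have [_ dF] := @FTC1_lebesgue_pt _ (w \_ I) (BLeft (x / 2)) x T xT ix (ltac:(by rewrite lte_fin)) lx.
move: dF; rewrite patchE mem_set => [<-|]; last by rewrite /= in_itv/= !ltW.
rewrite derive1E -[RHS](derive_cst (0 : R) x (1 : R)).
apply: near_eq_derive; near=> y.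
have yT : y < T by near: y; exact: lt_nbhsl.
rewrite -[RHS](wab (x / 2) y)//; last lra.
apply: eq_Rintegral => z; rewrite inE/= in_itv/= => /andP[xz zy].
rewrite patchE mem_set//= in_itv/= (le_trans zy (ltW yT)) andbT (le_trans _ xz)//; lra.
Unshelve. all: by end_near. Qed.

Lemma test_bounded phi : test_function T phi -> exists M : R, forall x, `|phi x| <= M.
Proof.
move=> /test_functionP[sphi [a [b [a0 bT phi0]]]].
have c : {within `[a, b], continuous (fun x => `|phi x|)}.
  apply: continuous_subspaceT => x; apply: cvg_norm.
  exact: smooth_continuous.
have [ab|ba] := leP a b; last first.
  exists 0 => x; rewrite phi0 ?normr0// negb_and -!ltNge.
  by case: ltP => //= ax; exact: lt_le_trans ax.
have [m _ mP] := EVT_max ab c; exists `|phi m| => x.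
have [xab|xab] := boolP (a <= x <= b); first by apply: mP; rewrite in_itv.
by rewrite phi0// normr0.
Qed.

Lemma test_derive_integral phi s : test_function T phi -> 0 <= s <= T ->
  (\int[mu]_(x in `[s, T]) (derive1 phi x)%:E = (- phi s)%:E)%E.
Proof.
move=> tphi /andP[s0 sT].
have [sphi [a [b [a0 bT phi0]]]] := (test_functionP T phi).1 tphi.
have phiT : phi T = 0 by apply: phi0; rewrite negb_and -!ltNge bT orbT.
have [sT'|sT'] := ltP s T; last first.
  have -> : s = T by apply/eqP; rewrite eq_le sT.
  by rewrite set_itv1 integral_set1 phiT oppr0.
have cphi := smooth_continuous sphi.
rewrite (@continuous_FTC2 _ _ phi)//; first by rewrite phiT sub0e.
- by apply: continuous_subspaceT; apply: smooth_continuous; exact: smooth_derive1.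
- split; first by move=> x _; exact: smooth_derivable.
    by apply: cvg_at_right_filter; exact: cphi.
  by apply: cvg_at_left_filter; exact: cphi.
Qed.

(** Integration by parts when one factor is merely a primitive: exchange the order
    of integration over the triangle [s <= t]. *)
Lemma ip_primitive_derive g phi : sqI g -> test_function T phi ->
  ip (primitive g) (derive1 phi) = - ip g phi.
Proof.
move=> sg tphi; have td := test_function_derive tphi.
have [M phiM] := test_bounded td.
pose phi' := (derive1 phi) \_ I; pose g' := (g : R -> R) \_ I.
have ig := sqI_integrable sg.
have mphi' : measurable_fun setT phi'.
  apply/(measurable_restrictT _ mI); exact: (sqI_test td).1.
have mg' : measurable_fun setT g' by apply/(measurable_restrictT _ mI); exact: sg.1.
have ig' : mu.-integrable setT (EFin \o g').
  by rewrite -restrict_EFin; apply/integrable_restrict => //; rewrite setTI.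
pose F (p : measurableTypeR R * measurableTypeR R) : \bar R :=
  (if (p.2 : R) <= p.1 then phi' p.1 * g' p.2 else 0)%:E.
have mF : measurable_fun setT F.
  apply/measurable_EFinP; apply: measurable_fun_ifT => //.
  - by apply: measurable_fun_ler; [exact: measurable_snd|exact: measurable_fst].
  - by apply: measurable_funM; apply: measurableT_comp => //; exact: measurable_fst.
have iFt t : (\int[mu]_s F (t, s) = (phi' t * primitive g t)%:E)%E.
  have [tI|tI] := boolP (t \in I); last first.
    rewrite /phi' patchE (negbTE tI) mul0r integral0_eq// => s _.
    by rewrite /F /= /phi' patchE (negbTE tI) mul0r if_same.
  have /andP[t0 tT] : 0 <= t <= T by move: tI; rewrite inE/= in_itv.
  have sub : `[0, t]%classic `<=` I.
    by move=> x /=; rewrite !in_itv/= => /andP[-> /le_trans]; exact.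
  have igt : mu.-integrable `[0, t]%classic (EFin \o (g : R -> R)) by apply: integrableS ig.
  transitivity (\int[mu]_(s in `[0%R, t]) ((phi' t)%:E * (g s : R)%:E))%E.
    rewrite [RHS]integral_mkcond; apply: eq_integral => s _; rewrite patchE /F /=.
    case: (boolP (s \in _)) => [|/negP st].
      rewrite inE/= in_itv/= => /andP[s0 st]; rewrite st EFinM; congr (_ * _)%E.
      by rewrite /g' patchE mem_set//; apply: sub; rewrite /= in_itv/= s0.
    case: ifPn => // st'; rewrite /g' patchE; case: ifPn => [|_]; last by rewrite mulr0.
    rewrite inE/= in_itv/= => /andP[s0 _]; exfalso; apply: st.
    by rewrite inE/= in_itv/= s0.
  rewrite integralZl// EFinM; congr (_ * _)%E.
  by rewrite /primitive /Rintegral fineK//; exact: integrable_fin_num.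
have iFs s : (\int[mu]_t F (t, s) = (- (g' s * phi s))%:E)%E.
  have [sI|sI] := boolP (s \in I); last first.
    rewrite /g' patchE (negbTE sI) mul0r oppr0 integral0_eq// => t _.
    by rewrite /F /= /g' patchE (negbTE sI) mulr0 if_same.
  have /andP[s0 sT] : 0 <= s <= T by move: sI; rewrite inE/= in_itv.
  have sub : `[s, T]%classic `<=` I.
    by move=> x /=; rewrite !in_itv/= => /andP[sx ->]; rewrite (le_trans s0).
  have igt : mu.-integrable `[s, T]%classic (EFin \o derive1 phi).
    by apply: integrableS (sqI_integrable (sqI_test td)).
  transitivity (\int[mu]_(t in `[s, T]) ((g' s)%:E * (derive1 phi t)%:E))%E.
    rewrite [RHS]integral_mkcond; apply: eq_integral => t _; rewrite patchE /F /=.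
    case: (boolP (t \in _)) => [|/negP st].
      rewrite inE/= in_itv/= => /andP[st tT]; rewrite st mulrC EFinM; congr (_ * _)%E.
      by rewrite /phi' patchE mem_set//; apply: sub; rewrite /= in_itv/= st.
    case: ifPn => // st'; rewrite /phi' patchE; case: ifPn => [|_]; last by rewrite mul0r.
    rewrite inE/= in_itv/= => /andP[_ tT]; exfalso; apply: st.
    by rewrite inE/= in_itv/= st'.
  by rewrite integralZl// test_derive_integral ?s0// -EFinM mulrN.
have iF : (mu \x mu)%E.-integrable setT F.
  apply/(integrable12ltyP _ _ mF).
  pose G := (\int[mu]_s `|(g' s)%:E|)%E.
  have Gfin : G \is a fin_num.
    have /integrableP[_] := ig'; rewrite -ge0_fin_numE//; exact: integral_ge0.
  have G0 : (0 <= G)%E by apply: integral_ge0.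
  apply: (@le_lt_trans _ _ (\int[mu]_t ((M * fine G) * \1_I t)%:E)%E).
    apply: ge0_le_integral => //.
    - by move=> t _; apply: integral_ge0.
    - have mF' : measurable_fun setT (fun p => `|F p|)%E by apply: measurableT_comp.
      by apply: (measurable_fun_fubini_tonelli_F (fun p => `|F p|)%E) => //.
    - by apply/measurable_EFinP; apply: measurable_funM => //; exact: measurable_indic.
    move=> t _.
    apply: (@le_trans _ _ (\int[mu]_s ((M * \1_I t)%:E * `|(g' s)%:E|))%E).
      apply: ge0_le_integral => //.
      - by apply: measurableT_comp => //; apply: measurableT_comp => //.
      - by apply: emeasurable_funM => //; do 2 apply: measurableT_comp => //.
      move=> s _; rewrite /F /= -EFinM lee_fin; case: ifP => _; last first.
        by rewrite normr0 !mulr_ge0//; exact: le_trans (phiM 0).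
      rewrite normrM ler_wpM2r// /phi' patchE indicE; case: (t \in _).
        by rewrite mulr1.
      by rewrite normr0 mulr0.
    rewrite ge0_integralZl//.
    - by rewrite -/G -[G in leLHS]fineK// -EFinM lee_fin mulrAC.
    - by do 2 apply: measurableT_comp => //.
    - by rewrite lee_fin mulr_ge0//; exact: le_trans (phiM 0).
  under eq_integral do rewrite EFinM.
  have i1 := @integrable_indic_itv R 0 T true false.
  rewrite integralZl//; have /fineK <- := integrable_fin_num measurableT i1.
  by rewrite -EFinM ltry.
have := Fubini iF.
under eq_integral do rewrite iFt.
under [in X in _ = X -> _]eq_integral do rewrite iFs.
have eqI (h : R -> R) k : (forall x, (h \_ I) x = k x) ->
    (\int[mu]_x (k x)%:E = \int[mu]_(x in I) (h x)%:E)%E.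
  move=> hk; rewrite [RHS]integral_mkcond; apply: eq_integral => x _.
  by rewrite -hk restrict_EFin.
rewrite (eqI (fun t => primitive g t * derive1 phi t)); last first.
  by move=> x; rewrite /phi' !patchE; case: ifP => _; rewrite ?mul0r// mulrC.
rewrite (eqI (fun t => - ((g t : R) * phi t))); last first.
  by move=> x; rewrite /g' !patchE; case: ifP => _; rewrite ?mul0r ?oppr0.
move=> h; rewrite /L2_inner {1}/Rintegral h.
have igp := sq_integrable_mul mI sg (sqI_test tphi).
by rewrite -mulN1r -RintegralZl//; congr fine; apply: eq_integral => x _; rewrite mulN1r.
Qed.

Lemma sqI_eq_of_test f g : sqI f -> sqI g ->
  (forall phi, test_function T phi -> ip f phi = ip g phi) -> ae_eq mu I f g.
Proof.
move=> sf sg fg; have := sqI_zero_of_test (sq_integrableB mI sf sg) _.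
move=> /(_ _)[|N [mN N0 sub]].
  by move=> phi tphi; rewrite (siBl siI)// ?fg ?subrr//; exact: sqI_test.
exists N; split => // x nfg; apply: sub => /= h; apply: nfg => Ix.
by apply/eqP; rewrite -subr_eq0; apply/eqP; exact: h.
Qed.

(** The mean of [chi] is the value of its primitive beyond the support. *)
Lemma test_antiderivative chi : test_function T chi -> ip (cst 1) chi = 0 ->
  exists2 phi, test_function T phi & derive1 phi = chi.
Proof.
move=> tchi; rewrite /L2_inner; under eq_Rintegral do rewrite mul1r.
move=> chi0; have [schi [a [b [a0 bT zchi]]]] := (test_functionP T chi).1 tchi.
have cchi := smooth_continuous schi.
have ichi u : mu.-integrable `[0, u] (EFin \o chi).
  apply: continuous_compact_integrable; first exact: segment_compact.
  exact: continuous_subspaceT.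
pose phi (x : R) : R := \int[mu]_(t in `[0, x]) chi t.
have phi_lt (x : R) : x < a -> phi x = 0.
  move=> xa; rewrite /phi /Rintegral integral0_eq// => t; rewrite /= in_itv/= => /andP[_ tx].
  by rewrite zchi// negb_and -!ltNge (le_lt_trans tx xa).
have phi_gt (x : R) : b < x -> phi x = 0.
  move=> bx; rewrite -chi0 /phi [LHS]Rintegral_mkcond [RHS]Rintegral_mkcond.
  apply: eq_Rintegral => t _; rewrite !patchE !mem_setE !in_itv/=.
  have [tb|bt] := leP t b; first by rewrite (le_trans tb (ltW bx)) (le_trans tb (ltW bT)).
  by rewrite zchi ?if_same// negb_and -!ltNge bt orbT.
have dphi (x : R) : is_derive x 1 (phi : R -> R) (chi x).
  have [x0|x0] := ltP 0 x; last first.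
    rewrite zchi; last by rewrite negb_and -!ltNge (le_lt_trans x0 a0).
    apply: (@near_eq_is_derive _ _ _ (cst 0)).
    near=> y; rewrite phi_lt//; near: y; apply: lt_nbhsl; exact: le_lt_trans x0 a0.
  have x1 : x < x + 1 by rewrite ltrDl.
  have [dx dE] := continuous_FTC1_closed x1 (ichi _) x0 (cchi x).
  by apply: DeriveDef; [exact: dx|rewrite -derive1E; exact: dE].
exists phi; last exact: derive1_is_derive.
apply/test_functionP; split; first exact: smooth_derive1_inv dphi schi.
exists a, b; split => // x; rewrite negb_and -!ltNge => /orP[]; [exact: phi_lt|exact: phi_gt].
Unshelve. all: by end_near. Qed.

(** Some test function [psi] has nonzero mean, otherwise the constant 1 would
    vanish almost everywhere. Every test function differs from a multiple of [psi]
    by one of mean zero, that is, by the derivative of a test function. *)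
Lemma weak_derivative0_cst w : 0 < T -> sqI w ->
  (forall phi, test_function T phi -> ip w (derive1 phi) = 0) ->
  exists c : R, ae_eq mu I w (cst c).
Proof.
move=> T0 sw w0.
have [psi tpsi psi0] : exists2 psi, test_function T psi & ip (cst 1) psi != 0.
  apply: contrapT => npsi.
  have [N [mN N0 sub]] : ae_eq mu I (cst 1 : R -> R) (cst 0 : R -> R).
    apply: sqI_zero_of_test; first exact: sqI_cst.
    move=> phi tphi; apply: contrapT => /eqP h; apply: npsi; by exists phi.
  have : (mu I <= mu N)%E.
    apply: le_measure; rewrite ?inE// => x Ix; apply: sub => /= /(_ Ix)/eqP.
    by rewrite oner_eq0.
  have := lebesgue_measure_itv `[0, T]; rewrite /= => ->; rewrite N0 lte_fin T0.
  by rewrite sube0 lee_fin leNgt T0.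
have sp := sqI_test tpsi; have s1 := sqI_cst 1.
pose c := ip w psi / ip (cst 1) psi; exists c.
apply: sqI_eq_of_test => //; first exact: sqI_cst.
move=> phi tphi; have sphi := sqI_test tphi.
pose m := ip (cst 1) phi / ip (cst 1) psi.
have tchi : test_function T (fun x => phi x + - m * psi x).
  have [s1' [a1 [b1 [a10 b1T z1]]]] := (test_functionP T phi).1 tphi.
  have [s2 [a2 [b2 [a20 b2T z2]]]] := (test_functionP T psi).1 tpsi.
  apply/test_functionP; split.
    rewrite -[X in smooth X]/(phi \+ (fun x => - m * psi x)).
    apply: smoothD; [exact: s1'|apply: smoothZ; exact: s2].
  exists (Num.min a1 a2), (Num.max b1 b2); split.
  - by rewrite lt_min a10.
  - by rewrite gt_max b1T.
  - move=> x; rewrite ge_min le_max !negb_and !negb_or => h.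
    case/orP: h => /andP[h1 h2]; rewrite z1 ?z2 ?mulr0 ?addr0//.
    - by rewrite negb_and h2.
    - by rewrite negb_and h1.
    - by rewrite negb_and h2 orbT.
    - by rewrite negb_and h1 orbT.
have E v : sqI v -> ip v (fun x => phi x + - m * psi x) = ip v phi - m * ip v psi.
  move=> sv; have -> : (fun x => phi x + - m * psi x) = (- m) *: (psi : R -> R^o) + phi.
    by apply/funext => x; rewrite addrC.
  by rewrite (siDr siI) ?(siZr siI) ?mulNr 1?addrC//; exact: (si_domZ siI).
have [phi' tphi' dphi'] := test_antiderivative tchi (ltac:(by rewrite E// /m divfK// subrr)).
have := w0 _ tphi'; rewrite dphi' E// => /eqP; rewrite subr_eq0 => /eqP ->.
have -> : cst c = c *: (cst 1 : R -> R^o).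
  by apply/funext => x; apply/esym; exact: mulr1.
by rewrite (siZl siI)// /m /c; field.
Qed.

(** The difference of [w] and the primitive of [g] has weak derivative zero. *)
Lemma weak_derivative_primitive w g : 0 < T -> sqI w -> sqI g ->
  (forall phi, test_function T phi -> ip w (derive1 phi) = - ip g phi) ->
  exists c : R, ae_eq mu I w (fun t => c + primitive g t).
Proof.
move=> T0 sw sg wg; have sG := sqI_primitive sg.
have sB := sq_integrableB mI sw sG.
have [|c [N [mN N0 sub]]] := weak_derivative0_cst T0 sB.
  move=> phi tphi; have st := sqI_test (test_function_derive tphi).
  by rewrite (siBl siI)// wg// ip_primitive_derive// subrr.
exists c, N; split => // x h; apply: sub => /= h'; apply: h => Ix.
by rewrite -(h' Ix) fctE subrK.
Qed.

End interval_L2.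

(** * The Sobolev space as a semi-inner product space *)

Section row_norms.
Context (R : realType) (kappa : nat).
Implicit Types (x y : 'rV[R]_kappa).

Lemma enorm_sqr x : enorm x ^+ 2 = \sum_(c < kappa) x ord0 c ^+ 2.
Proof. by rewrite sqr_sqrtr// sumr_ge0// => c _; exact: sqr_ge0. Qed.

Lemma rv_norm_lt x (e : R) : 0 < e -> (forall c, `|x ord0 c| < e) -> `|x| < e.
Proof.
move=> e0 xe; rewrite /Num.norm /= mx_normrE; apply/bigmax_ltP; split => // -[i c] _ /=.
by rewrite (ord1 i).
Qed.

Lemma coord_le_norm x c : `|x ord0 c| <= `|x|.
Proof.
by rewrite [leRHS]/Num.norm /= mx_normrE (le_bigmax _ (fun ij => `|x ij.1 ij.2|) (ord0, c)).
Qed.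

Lemma coord_le_enorm x c : `|x ord0 c| <= enorm x.
Proof.
rewrite -sqrtr_sqr ler_wsqrtr// (bigD1 c)//= lerDl sumr_ge0// => i _; exact: sqr_ge0.
Qed.

Lemma row_within_continuous (I : set R) (u : R -> 'rV[R]_kappa) :
  (forall c, {within I, continuous (fun t => u t ord0 c : R)}) -> {within I, continuous u}.
Proof.
move=> cu x; apply/cvgrPdist_lt => e e0.
have : \forall t \near nbhs (x : subspace I), forall c, `|u x ord0 c - u t ord0 c| < e.
  by apply: filter_forall => c; have /cvgrPdist_lt/(_ e e0) := cu c x.
by apply: filterS => t ut; apply: rv_norm_lt => // c; rewrite !mxE.
Qed.

Lemma coord_within_continuous (I : set R) (u : R -> 'rV[R]_kappa) c :
  {within I, continuous u} -> {within I, continuous (fun t => u t ord0 c : R)}.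
Proof.
move=> cu x; apply/cvgrPdist_lt => e e0.
have /cvgrPdist_lt/(_ e e0) := cu x; apply: filterS => t; apply: le_lt_trans.
by have := coord_le_norm (u x - u t) c; rewrite !mxE.
Qed.

End row_norms.

Section H2.
Context (R : realType) (kappa : nat) (T : R).
Notation mu := (@lebesgue_measure R).
Notation I := (`[0, T]%classic : set R).
Notation sqI := (sq_integrable mu I).
Notation ip := (L2_inner mu I).
Notation V := (R -> 'rV[R]_kappa).
Implicit Types (u v w g h : R -> 'rV[R]_kappa) (phi : R -> R).

Let mI : measurable (I : set (measurableTypeR R)).
Proof. exact: measurable_itv. Qed.
Let siI := L2_semi_inner mu mI.

Definition coordf (c : 'I_kappa) u : R -> R^o := fun t => u t ord0 c.

Lemma coordfP (a : R) u v c : coordf c (a *: u + v) = a *: coordf c u + coordf c v.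
Proof. by apply/funext => t; rewrite /coordf !fctE !mxE. Qed.

Lemma inL2P g : inL2 T g <-> forall c, sqI (coordf c g).
Proof.
split=> [[mg ig] c|sg].
  split; first exact: mg.
  apply: le_integrable ig => //.
    by apply/measurable_EFinP; apply: measurable_funX; exact: mg.
  move=> t _; rewrite /= lee_fin !ger0_norm ?sqr_ge0// -[leLHS]real_normK ?num_real//.
  by rewrite ler_pXn2r ?nnegrE ?sqrtr_ge0// coord_le_enorm.
split=> [c|]; first exact: (sg c).1.
have : mu.-integrable I (fun t => (\sum_c ((coordf c g t : R) ^+ 2)%:E)%E).
  by apply: integrable_sum => // c _; exact: (sg c).2.
by apply: eq_integrable => // t _; rewrite sumEFin enorm_sqr.
Qed.

Lemma L2norm_sqr g : inL2 T g -> L2norm T g ^+ 2 = \sum_(c < kappa) ip (coordf c g) (coordf c g).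
Proof.
move=> /inL2P sg; rewrite sqr_sqrtr; last first.
  by apply: Rintegral_ge0 => t _; exact: sqr_ge0.
apply: EFin_inj; rewrite -sumEFin.
under [RHS]eq_bigr => c _ do rewrite (L2_innerE mI (sg c)).
rewrite -integral_sum//; last by move=> c; exact: (sg c).2.
rewrite /Rintegral fineK; last first.
  by apply: integrable_fin_num => //; have [_] := (inL2P g).2 sg.
by apply: eq_integral => t _; rewrite sumEFin enorm_sqr.
Qed.

Lemma weak_derivative_ip i u g c phi : weak_derivative T i u g -> test_function T phi ->
  ip (coordf c u) (derive1n i phi) = (-1) ^+ i * ip (coordf c g) phi.
Proof. by move=> wg tphi; exact: wg. Qed.

Definition is_wderiv i u g : Prop := inL2 T g /\ weak_derivative T i u g.

Lemma test_function_iter phi i : test_function T phi -> test_function T (derive1n i phi).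
Proof.
by move=> tphi; elim: i => [//|i IH]; rewrite derive1nS; exact: test_function_derive.
Qed.

Lemma sqI_test_iter phi i : test_function T phi -> sqI (derive1n i phi).
Proof. by move=> tphi; apply: sqI_test; exact: test_function_iter. Qed.

Lemma inH2_sqI u c : inH2 T u -> sqI (coordf c u).
Proof. by move=> [cu _]; apply: sqI_continuous; exact: coord_within_continuous. Qed.

Lemma wderivP i u : inH2 T u -> (i <= 2)%N -> is_wderiv i u (wderiv T i u).
Proof.
move=> [_ hu] i2; rewrite /wderiv; case: xgetP => [g -> //|h].
by have [g gP] := hu i i2; have := h g.
Qed.

Lemma is_wderiv_unique i u g h c : is_wderiv i u g -> is_wderiv i u h ->
  ae_eq mu I (coordf c g) (coordf c h).
Proof.
move=> [/inL2P sg wg] [/inL2P sh wh]; apply: sqI_eq_of_test => // phi tphi.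
have := wg c phi tphi; rewrite (wh c phi tphi) => /eqP.
have s0 : (-1 : R) ^+ i != 0 by rewrite expf_neq0// oppr_eq0 oner_eq0.
by move=> /eqP/(mulfI s0)/esym.
Qed.

Lemma is_wderivP i (a : R) u v g h : inH2 T u -> inH2 T v ->
  is_wderiv i u g -> is_wderiv i v h -> is_wderiv i (a *: u + v) (a *: g + h).
Proof.
move=> hu hv [/inL2P sg wg] [/inL2P sh wh]; split.
  by apply/inL2P => c; rewrite coordfP; exact: (si_domP siI).
move=> c phi tphi; have st := sqI_test tphi; have sti := sqI_test_iter i tphi.
have E w1 w2 psi : sqI (coordf c w1) -> sqI (coordf c w2) -> sqI psi ->
    \int[mu]_(t in I) ((a *: w1 + w2) t ord0 c * psi t) =
    a * ip (coordf c w1) psi + ip (coordf c w2) psi.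
  by move=> s1 s2 sp; rewrite -(siP siI)// -coordfP.
rewrite !E//; try exact: inH2_sqI.
rewrite (weak_derivative_ip c wg tphi) (weak_derivative_ip c wh tphi).
by rewrite mulrDr mulrCA.
Qed.

Lemma is_wderiv0 i : is_wderiv i (0 : V) (0 : V).
Proof.
have c0 c : coordf c (0 : V) = 0 by apply/funext => t; rewrite /coordf mxE.
split; first by apply/inL2P => c; rewrite c0; exact: (si_dom0 siI).
move=> c phi tphi.
have E psi : sqI psi -> \int[mu]_(t in I) ((0 : V) t ord0 c * psi t) = 0.
  by move=> sp; rewrite -[RHS](si0l siI sp) -(c0 c).
by rewrite !E ?mulr0//; [exact: sqI_test|exact: sqI_test_iter].
Qed.

Lemma inH2_0 : inH2 T (0 : V).
Proof.
split; first by apply: continuous_subspaceT => x; exact: cvg_cst.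
by move=> i _; exists 0; exact: is_wderiv0.
Qed.

Lemma inH2P (a : R) u v : inH2 T u -> inH2 T v -> inH2 T (a *: u + v).
Proof.
move=> hu hv; split.
  move=> x; apply: cvgD; last exact: hv.1.
  by apply: cvgZr; exact: hu.1.
move=> i i2; exists (a *: wderiv T i u + wderiv T i v).
by apply: is_wderivP => //; exact: wderivP.
Qed.

Lemma ip_ae_eq (f g h : R -> R^o) : sqI f -> sqI g -> sqI h -> ae_eq mu I f g ->
  ip f h = ip g h.
Proof.
move=> sf sg sh fg; congr fine; apply: ae_eq_integral => //.
- by apply/measurable_EFinP; apply: measurable_funM; [exact: sf.1|exact: sh.1].
- by apply/measurable_EFinP; apply: measurable_funM; [exact: sg.1|exact: sh.1].
- have [N [mN N0 sub]] := fg; exists N; split => // x h'; apply: sub => /= e.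
  by apply: h' => Ix /=; rewrite e.
Qed.

Lemma wderiv_coord_sqI i u c : inH2 T u -> (i <= 2)%N -> sqI (coordf c (wderiv T i u)).
Proof. by move=> hu i2; have [/inL2P] := wderivP hu i2. Qed.

Lemma ip_wderivP i (a : R) u v c (h : R -> R^o) : inH2 T u -> inH2 T v -> (i <= 2)%N ->
  sqI h -> ip (coordf c (wderiv T i (a *: u + v))) h =
  a * ip (coordf c (wderiv T i u)) h + ip (coordf c (wderiv T i v)) h.
Proof.
move=> hu hv i2 sh; have huv := inH2P a hu hv.
have wu := wderivP hu i2; have wv := wderivP hv i2.
have w := is_wderivP a hu hv wu wv.
have su := wderiv_coord_sqI c hu i2; have sv := wderiv_coord_sqI c hv i2.
rewrite -(siP siI)// -coordfP; apply: ip_ae_eq => //.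
- exact: wderiv_coord_sqI.
- by rewrite coordfP; exact: (si_domP siI).
- by apply: is_wderiv_unique w; exact: wderivP.
Qed.

Definition H2_inner u v : R :=
  \sum_(i < 3) \sum_(c < kappa) ip (coordf c (wderiv T i u)) (coordf c (wderiv T i v)).

Lemma ord3_le2 (i : 'I_3) : (i <= 2)%N.
Proof. by rewrite -ltnS. Qed.

Lemma H2normE u : inH2 T u -> H2norm T u = Num.sqrt (H2_inner u u).
Proof.
move=> hu; congr Num.sqrt; apply: eq_bigr => i _; apply: L2norm_sqr.
by have [] := wderivP hu (ord3_le2 i).
Qed.

Lemma H2_semi_inner : semi_inner (inH2 T : V -> Prop) H2_inner.
Proof.
split; [exact: inH2_0|exact: inH2P| | |].
- move=> u v hu hv; apply: eq_bigr => i _; apply: eq_bigr => c _.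
  by apply: (siC siI); apply: wderiv_coord_sqI => //; exact: ord3_le2.
- move=> a u v w hu hv hw; rewrite /H2_inner mulr_sumr -big_split; apply: eq_bigr => i _.
  rewrite mulr_sumr -big_split; apply: eq_bigr => c _ /=; apply: ip_wderivP => //.
    exact: ord3_le2.
  by apply: wderiv_coord_sqI => //; exact: ord3_le2.
- move=> u hu; apply: sumr_ge0 => i _; apply: sumr_ge0 => c _.
  by apply: (si_ge0 siI); apply: wderiv_coord_sqI => //; exact: ord3_le2.
Qed.

Lemma H2_dualE (F : V -> R) : H2_dual T F <-> si_dual (inH2 T) H2_inner F.
Proof.
split=> -[FP [C FC]]; (split; [exact: FP|exists C => u hu]).
  by rewrite -H2normE//; exact: FC.
by rewrite H2normE//; exact: FC.
Qed.

End H2.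

(** * Hoelder continuity and completeness *)

Section H2_analysis.
Context (R : realType) (kappa : nat) (T : R).
Hypothesis T0 : 0 < T.
Notation mu := (@lebesgue_measure R).
Notation I := (`[0, T]%classic : set R).
Notation sqI := (sq_integrable mu I).
Notation ip := (L2_inner mu I).
Notation nrm f := (Num.sqrt (ip f f)).
Notation V := (R -> 'rV[R]_kappa).
Notation B := (H2_inner T).
Implicit Types (u v w g h : R -> 'rV[R]_kappa) (phi : R -> R).

Let mI : measurable (I : set (measurableTypeR R)).
Proof. exact: measurable_itv. Qed.
Let siI := L2_semi_inner mu mI.
Let siH := @H2_semi_inner R kappa T.

(** Near a point where they differ, continuous functions differ on an interval,
    which is not null. *)
Lemma ae_eq_continuous (f g : R -> R) : {within I, continuous f} ->
  {within I, continuous g} -> ae_eq mu I f g -> {in I, f =1 g}.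
Proof.
move=> cf cg [N [mN N0 sub]] t /set_mem It; apply: contrapT => fgt.
have ct : {within I, continuous (fun x => f x - g x)}.
  by move=> x; apply: cvgB; [exact: cf|exact: cg].
have d0 : 0 < `|f t - g t| by rewrite normr_gt0 subr_eq0; apply/eqP.
have := @subspace_continuousP _ I _ (fun x => f x - g x).
move=> /iffLR/(_ ct t It)/cvgrPdist_lt/(_ _ d0).
rewrite /within /= -nbhs_nearE => /nbhs_ballP[e /= e0 He].
have {He} He x : 0 <= x <= T -> `|t - x| < e -> f x <> g x.
  move=> xI tx fgx; have := He x tx; rewrite /= in_itv/= => /(_ xI).
  by rewrite fgx subrr subr0 ltxx.
have [a [b [ab abP]]] : exists a b, a < b /\
    forall x, a <= x <= b -> 0 <= x <= T /\ `|t - x| < e.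
  move: It; rewrite /= in_itv/= => /andP[t0 tT].
  have [tT'|tT'] := ltP t T.
    exists t, (Num.min T (t + e / 2)); split; first by rewrite lt_min tT' ltrDl divr_gt0.
    move=> x /andP[tx]; rewrite le_min => /andP[xT xe].
    by rewrite (le_trans t0 tx) xT ltr_distlC; split => //; apply/andP; split; lra.
  have tE : t = T by apply/eqP; rewrite eq_le tT.
  exists (Num.max 0 (T - e / 2)), T; split; first by rewrite gt_max T0 gtrBl divr_gt0.
  move=> x /andP[]; rewrite ge_max => /andP[x0 xe] xT; rewrite x0 xT tE ltr_distlC.
  by split => //; apply/andP; split; lra.
have : (mu `[a, b]%classic <= mu N)%E.
  apply: le_measure; rewrite ?inE// => x; rewrite /= in_itv/= => /abP[xI te]; apply: sub => /= h.
  by apply: (He x xI te); apply: h; rewrite /= in_itv.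
have := lebesgue_measure_itv `[a, b]; rewrite /= => ->; rewrite N0 lte_fin ab.
by rewrite -EFinB lee_fin subr_le0 leNgt ab.
Qed.

Lemma is_wderiv_id u : inH2 T u -> is_wderiv T 0 u u.
Proof.
move=> hu; split; first by apply/inL2P => c; exact: inH2_sqI.
by move=> c phi tphi; rewrite expr0 mul1r.
Qed.

Lemma ip_wderiv0 u c : inH2 T u ->
  ip (coordf c (wderiv T 0 u)) (coordf c (wderiv T 0 u)) = ip (coordf c u) (coordf c u).
Proof.
move=> hu; have s0 := wderiv_coord_sqI c hu (isT : (0 <= 2)%N).
have su := inH2_sqI c hu.
have e : ae_eq mu I (coordf c (wderiv T 0 u)) (coordf c u).
  by apply: is_wderiv_unique (is_wderiv_id hu); exact: wderivP.
by rewrite (ip_ae_eq s0 su s0 e) (siC siI)// (ip_ae_eq s0 su su e).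
Qed.

Lemma ip_wderiv_le i u c : (i <= 2)%N -> inH2 T u ->
  ip (coordf c (wderiv T i u)) (coordf c (wderiv T i u)) <= B u u.
Proof.
move=> i2 hu; rewrite /H2_inner (bigD1 (Ordinal (i2 : (i < 3)%N)))//= (bigD1 c)//=.
have pos j d : (j <= 2)%N -> 0 <= ip (coordf d (wderiv T j u)) (coordf d (wderiv T j u)).
  by move=> j2; apply: (si_ge0 siI); exact: wderiv_coord_sqI.
rewrite -addrA lerDl addr_ge0//; first by apply: sumr_ge0 => d _; exact: pos.
by apply: sumr_ge0 => j _; apply: sumr_ge0 => d _; apply: pos; exact: ord3_le2.
Qed.

Lemma H2_coord_primitive u c s t : inH2 T u -> 0 <= s <= T -> 0 <= t <= T ->
  coordf c u t - coordf c u s =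
  primitive (coordf c (wderiv T 1 u)) t - primitive (coordf c (wderiv T 1 u)) s.
Proof.
move=> hu sI tI; pose g := coordf c (wderiv T 1 u).
have sg : sqI g by exact: wderiv_coord_sqI.
have [_ w1] := wderivP hu (isT : (1 <= 2)%N).
have [|k uk] := weak_derivative_primitive T0 (inH2_sqI c hu) sg.
  by move=> phi tphi; have := weak_derivative_ip c w1 tphi; rewrite expr1 mulN1r.
have ck : {within I, continuous (fun t => k + primitive g t)}.
  move=> x; apply: cvgD; first exact: cvg_cst.
  exact: primitive_continuous.
have E := ae_eq_continuous (coord_within_continuous (c := c) hu.1) ck uk.
have Es : coordf c u s = k + primitive g s by apply: E; rewrite inE/= in_itv.
have Et : coordf c u t = k + primitive g t by apply: E; rewrite inE/= in_itv.
by rewrite Es Et opprD addrACA subrr add0r.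
Qed.

Lemma H2_holder u c s t : inH2 T u -> 0 <= s -> s <= t -> t <= T ->
  `|coordf c u t - coordf c u s| <= Num.sqrt (t - s) * Num.sqrt (B u u).
Proof.
move=> hu s0 st tT; rewrite H2_coord_primitive ?s0 ?tT ?(le_trans s0 st) ?(le_trans st tT)//.
have sg := wderiv_coord_sqI c hu (isT : (1 <= 2)%N).
apply: le_trans (primitive_holder sg s0 st tT) _.
by rewrite ler_wpM2l ?sqrtr_ge0// ler_wsqrtr// ip_wderiv_le.
Qed.

(** At the minimum of its absolute value a coordinate is at most its root mean
    square, and it moves away from there by the Hoelder bound. *)
Lemma H2_eval_bound u c t : inH2 T u -> 0 <= t <= T ->
  `|coordf c u t| <= ((Num.sqrt T)^-1 + Num.sqrt T) * Num.sqrt (B u u).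
Proof.
move=> hu /andP[t0 tT].
have cu : {within I, continuous (fun x => `|coordf c u x : R|)}.
  by move=> x; apply: cvg_norm; apply: coord_within_continuous; exact: hu.1.
have [s sI smin] := EVT_min (ltW T0) cu.
have BT0 : 0 <= B u u by exact: (si_ge0 siH).
have hs : `|coordf c u s| <= (Num.sqrt T)^-1 * Num.sqrt (B u u).
  rewrite -ler_pdivrMl ?invr_gt0 ?sqrtr_gt0// invrK.
  rewrite -(@ler_pXn2r _ 2) ?nnegrE ?mulr_ge0 ?sqrtr_ge0//.
  rewrite exprMn !sqr_sqrtr ?(ltW T0)//.
  apply: le_trans (ip_wderiv_le c (isT : (0 <= 2)%N) hu).
  have su := inH2_sqI c hu.
  rewrite ip_wderiv0//.
  have -> : T * `|coordf c u s| ^+ 2 = \int[mu]_(x in I) (`|coordf c u s| ^+ 2).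
    rewrite (@Rintegral_cst _ _ _ mu) // mulrC; congr (_ * _).
    have := lebesgue_measure_itv `[0, T]; rewrite /= lte_fin T0 sube0 => h.
    by apply/esym; exact: (congr1 (fine : \bar R -> R) h).
  apply: le_Rintegral => //.
  - exact: (sqI_integrable (sqI_cst T (`|coordf c u s| ^+ 2))).
  - exact: sq_integrable_mul.
  move=> x Ix; rewrite -[leRHS]expr2 -[leRHS]real_normK ?num_real//.
  by rewrite ler_pXn2r ?nnegrE//; exact: smin.
have sI' : 0 <= s <= T by move: sI; rewrite in_itv.
have hd : `|coordf c u t - coordf c u s| <= Num.sqrt T * Num.sqrt (B u u).
  case/andP: sI' => s0 sT; have [st|ts] := leP s t.
    apply: le_trans (H2_holder c hu s0 st tT) _.
    by rewrite ler_wpM2r ?sqrtr_ge0// ler_wsqrtr//; lra.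
  rewrite distrC; apply: le_trans (H2_holder c hu t0 (ltW ts) sT) _.
  by rewrite ler_wpM2r ?sqrtr_ge0// ler_wsqrtr//; lra.
rewrite -[X in `|X|](subrK (coordf c u s)); apply: le_trans (ler_normD _ _) _.
by rewrite mulrDl addrC lerD.
Qed.

Lemma H2_dual_eval c t : 0 <= t <= T -> si_dual (inH2 T : V -> Prop) B (fun u => u t ord0 c).
Proof.
move=> tI; split; first by move=> a u v _ _; rewrite !fctE !mxE.
by exists ((Num.sqrt T)^-1 + Num.sqrt T) => u hu; exact: H2_eval_bound.
Qed.

(** The derivatives of each order converge in square mean, and the relation
    defining weak derivatives passes to the limit. The limit of the first
    derivatives has a primitive that is almost everywhere the limit of the curves
    themselves; it is the continuous representative. *)
Lemma H2_complete : semi_complete (inH2 T : V -> Prop) B.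
Proof.
move=> u hu cu; pose E i c n := coordf c (wderiv T i (u n)).
have sE i c n : (i <= 2)%N -> sqI (E i c n) by move=> ?; exact: wderiv_coord_sqI.
have ipB i c m n : (i <= 2)%N -> ip (E i c m - E i c n) (E i c m - E i c n) =
    ip (coordf c (wderiv T i (u m - u n))) (coordf c (wderiv T i (u m - u n))).
  move=> i2; have hmn : inH2 T (u m - u n) by exact: (si_domB siH).
  have e : ae_eq mu I (coordf c (wderiv T i (u m - u n))) (E i c m - E i c n).
    rewrite /E [X in ae_eq _ _ _ X](_ : _ = coordf c ((-1) *: wderiv T i (u n) + wderiv T i (u m))).
      apply: (@is_wderiv_unique _ _ _ i (u m - u n)); first exact: wderivP.
      rewrite -[- u n]scaleN1r [u m + _]addrC.
      by apply: is_wderivP => //; exact: wderivP.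
    by rewrite coordfP scaleN1r addrC.
  have s1 : sqI (coordf c (wderiv T i (u m - u n))) by exact: wderiv_coord_sqI.
  have s2 : sqI (E i c m - E i c n) := sq_integrableB mI (sE i c m i2) (sE i c n i2).
  by rewrite (ip_ae_eq s1 s2 s1 e) (siC siI)// (ip_ae_eq s1 s2 s2 e).
have lim i c : exists g : R -> R^o, (i <= 2)%N -> sqI g /\ forall e : R, 0 < e ->
    exists N, forall n, (N <= n)%N -> ip (E i c n - g) (E i c n - g) < e.
  have [i2|i2] := boolP (i <= 2)%N; last by exists 0.
  have [|e e0|g gP] := @L2_complete _ _ _ mu _ mI (E i c); first by move=> n; exact: sE.
    have [N NP] := cu e e0; exists N => m n Nm Nn; rewrite ipB//.
    apply: le_lt_trans (NP m n Nm Nn); apply: ip_wderiv_le => //.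
    exact: (si_domB siH).
  by exists g.
pose g i c := sval (cid (lim i c)).
have gP i c : (i <= 2)%N -> sqI (g i c) /\ forall e : R, 0 < e ->
    exists N, forall n, (N <= n)%N -> ip (E i c n - g i c) (E i c n - g i c) < e.
  exact: (svalP (cid (lim i c))).
have cvgE i c (h : R -> R^o) : (i <= 2)%N -> sqI h -> (fun n => ip (E i c n) h) @ \oo --> ip (g i c) h.
  move=> i2 sh; apply/cvgrPdist_lt => e e0; have [sg gl] := gP i c i2.
  have ep : 0 < e / (nrm h + 1) by rewrite divr_gt0// ltr_wpDl// sqrtr_ge0.
  have [N NP] := gl _ (exprn_gt0 2 ep); exists N => // n /= Nn.
  rewrite distrC -(siBl siI (sE i c n i2) sg sh).
  apply: le_lt_trans (si_norm_cs siI (sq_integrableB mI (sE _ _ _ i2) sg) sh) _.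
  have h1 : nrm (E i c n - g i c) <= e / (nrm h + 1).
    rewrite -[leRHS](ger0_norm (ltW ep)) -sqrtr_sqr ler_wsqrtr//.
    exact: ltW (NP n Nn).
  apply: (@le_lt_trans _ _ (e / (nrm h + 1) * nrm h)).
    by rewrite ler_wpM2r ?sqrtr_ge0.
  rewrite mulrAC -mulrA gtr_pMr// ltr_pdivrMr ?mul1r ?ltrDl// ltr_wpDl// sqrtr_ge0//.
have wE i c phi : (i <= 2)%N -> test_function T phi ->
    ip (g 0%N c) (derive1n i phi) = (-1) ^+ i * ip (g i c) phi.
  move=> i2 tphi; have sphi := sqI_test tphi; have sti := sqI_test_iter i tphi.
  have c1 := cvgE 0%N c _ isT sti.
  have c2 : (fun n => (-1) ^+ i * ip (E i c n) phi) @ \oo --> (-1) ^+ i * ip (g i c) phi.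
    by apply: cvgMl_tmp; exact: cvgE.
  apply: (cvg_unique (@Rhausdorff R) c1).
  rewrite (_ : (fun n => _) = (fun n => (-1) ^+ i * ip (E i c n) phi))//.
  apply/funext => n; have [_ wi] := wderivP (hu n) i2.
  have [_ w0] := wderivP (hu n) (isT : (0 <= 2)%N).
  rewrite -(weak_derivative_ip c wi tphi).
  by have := weak_derivative_ip c w0 (test_function_iter i tphi); rewrite expr0 mul1r.
have prim c : exists k : R, ae_eq mu I (g 0%N c) (fun t => k + primitive (g 1%N c) t).
  apply: weak_derivative_primitive => //; try by apply: (gP _ _ _).1.
  by move=> phi tphi; have := wE 1%N c phi isT tphi; rewrite expr1 mulN1r.
pose k c := sval (cid (prim c)).
pose v : V := fun t => \row_c (k c + primitive (g 1%N c) t).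
have vc c : coordf c v = (fun t => k c + primitive (g 1%N c) t).
  by apply/funext => t; rewrite /coordf mxE.
have cvc c : {within I, continuous (coordf c v : R -> R)}.
  rewrite vc => x; apply: cvgD; first exact: cvg_cst.
  by apply: primitive_continuous; have [] := gP 1%N c isT.
have kP c : ae_eq mu I (g 0%N c) (coordf c v) by rewrite vc; exact: (svalP (cid (prim c))).
pose G i : V := fun t => \row_c g i c t.
have Gc i c : coordf c (G i) = g i c by apply/funext => t; rewrite /coordf mxE.
have wG i : (i <= 2)%N -> is_wderiv T i v (G i).
  move=> i2; split; first by apply/inL2P => c; rewrite Gc; have [] := gP i c i2.
  move=> c phi tphi; have := wE i c phi i2 tphi.
  rewrite (ip_ae_eq _ _ _ (kP c)) -?Gc//.
  - by rewrite Gc; have [] := gP 0%N c isT.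
  - by apply: sqI_continuous; exact: cvc.
  - exact: sqI_test_iter.
have hv : inH2 T v.
  split; first by apply: row_within_continuous => c; exact: cvc.
  by move=> i i2; exists (G i); exact: wG.
exists v; split => // e e0.
have e' : 0 < e / (3 * kappa.+1)%:R by rewrite divr_gt0// ltr0n.
have [N NP] : exists N, forall n (i : 'I_3) c, (N <= n)%N ->
    ip (E i c n - g i c) (E i c n - g i c) < e / (3 * kappa.+1)%:R.
  have H : \forall n \near \oo, forall (i : 'I_3) c,
      ip (E i c n - g i c) (E i c n - g i c) < e / (3 * kappa.+1)%:R.
    apply: filter_forall => i; apply: filter_forall => c.
    by have [N NP] := (gP i c (ord3_le2 i)).2 _ e'; exists N.
  by have [N _ NP] := H; exists N => n i c Nn; exact: NP.
exists N => n Nn; have huv : inH2 T (u n - v) by exact: (si_domB siH).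
apply: (@le_lt_trans _ _ (\sum_(i < 3) \sum_(c < kappa) (e / (3 * kappa.+1)%:R))).
  apply: ler_sum => i _; apply: ler_sum => c _; have i2 := ord3_le2 i.
  have e1 : ae_eq mu I (coordf c (wderiv T i (u n - v))) (E i c n - g i c).
    rewrite [X in ae_eq _ _ _ X](_ : _ = coordf c ((-1) *: G i + wderiv T i (u n))).
      apply: (@is_wderiv_unique _ _ _ i (u n - v)); first exact: wderivP.
      rewrite -[- v]scaleN1r [u n + _]addrC.
      by apply: is_wderivP => //; [exact: wG|exact: wderivP].
    by rewrite coordfP scaleN1r addrC Gc.
  have s1 : sqI (coordf c (wderiv T i (u n - v))) by exact: wderiv_coord_sqI.
  have s2 : sqI (E i c n - g i c) := sq_integrableB mI (sE i c n i2) (gP i c i2).1.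
  rewrite (ip_ae_eq s1 s2 s1 e1) (siC siI)// (ip_ae_eq s1 s2 s2 e1).
  by apply/ltW/NP.
rewrite !sumr_const !card_ord -mulrnA -[X in X < _]mulr_natr -mulrA [_^-1 * _]mulrC mulrA.
by rewrite ltr_pdivrMr ?ltr0n// ltr_pM2l// ltr_nat mulnC ltn_pmul2l.
Qed.

End H2_analysis.

(** * Weak convergence of curves *)

Lemma uniform_cvgP (R : realType) (kappa : nat) (A : set R)
    (u : nat -> R -> 'rV[R]_kappa) (v : R -> 'rV[R]_kappa) :
  (forall e : R, 0 < e -> \forall m \near \oo, forall t, A t -> forall c,
     `|u m t ord0 c - v t ord0 c| < e) ->
  {uniform A, u @ \oo --> v}.
Proof.
move=> uv P /uniform_nbhs[E [entE subP]].
have [e /= e0 eE] : exists2 e : R, 0 < e & [set xy | ball xy.1 e xy.2] `<=` E.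
  by move: entE; rewrite -entourage_ballE => -[e e0 sub]; exists e.
have := uv e e0; apply: filterS => m um; apply: subP => t At; apply: eE.
rewrite /= -ball_normE /=; apply: rv_norm_lt => // c.
by rewrite !mxE distrC; exact: um.
Qed.

Section H2_weak.
Context (R : realType) (kappa : nat) (T : R).
Hypothesis T0 : 0 < T.
Notation mu := (@lebesgue_measure R).
Notation I := (`[0, T]%classic : set R).
Notation sqI := (sq_integrable mu I).
Notation ip := (L2_inner mu I).
Notation nrm f := (Num.sqrt (ip f f)).
Notation V := (R -> 'rV[R]_kappa).
Notation B := (H2_inner T).
Implicit Types (u v w g h : R -> 'rV[R]_kappa).

Let mI : measurable (I : set (measurableTypeR R)).
Proof. exact: measurable_itv. Qed.
Let siI := L2_semi_inner mu mI.
Let siH := @H2_semi_inner R kappa T.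

Lemma H2_weak_cvg_eval (u : nat -> V) v c t : H2_weak_cvg T u v -> 0 <= t <= T ->
  (fun m => u m t ord0 c) @ \oo --> v t ord0 c.
Proof.
by move=> [hu hv uv] tI; apply: (uv (fun w => w t ord0 c)); apply/H2_dualE; exact: H2_dual_eval.
Qed.

Lemma H2_weak_cvg_bounded (u : nat -> V) v : H2_weak_cvg T u v ->
  exists M : R, forall m, B (u m) (u m) <= M.
Proof.
move=> [hu hv uv]; apply: (weakly_bounded_bounded siH (H2_complete T0)) => // y hy.
have dy : H2_dual T (B^~ y) by apply/H2_dualE; exact: (si_dual_inner siH).
have c : cvgn (fun m => B (u m) y) by apply/cvg_ex; exists (B v y); exact: uv _ dy.
have [M [_ MP]] := cvg_seq_bounded c; exists (M + 1) => n.
by apply: (MP (M + 1)); rewrite ?ltrDl.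
Qed.

(** A weakly convergent sequence is bounded, hence uniformly Hoelder continuous, so
    that convergence at the nodes of a fine enough mesh is enough. *)
Lemma H2_weak_cvg_sup (u : nat -> V) v : H2_weak_cvg T u v -> forall e : R, 0 < e ->
  \forall m \near \oo, forall t, I t -> forall c, `|u m t ord0 c - v t ord0 c| < e.
Proof.
move=> uv e e0; have [M uM] := H2_weak_cvg_bounded uv.
have [hu hv _] := uv.
pose L := Num.sqrt (Num.max M (B v v)) + 1.
have L0 : 0 < L by rewrite ltr_wpDl ?sqrtr_ge0.
have LP w : inH2 T w -> B w w <= Num.max M (B v v) -> Num.sqrt (B w w) <= L.
  by move=> hw Bw; rewrite (le_trans (ler_wsqrtr Bw))// lerDl.
have d0 : 0 < (e / 4 / L) ^+ 2 by rewrite exprn_gt0// !divr_gt0.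
pose n := (Num.trunc (T / (e / 4 / L) ^+ 2)).+1.
have n0 : (0 : R) < n%:R by rewrite ltr0n.
have mesh : Num.sqrt (T / n%:R) <= e / 4 / L.
  have q0 : 0 <= e / 4 / L by rewrite !divr_ge0// ltW.
  rewrite -[leRHS](ger0_norm q0) -sqrtr_sqr ler_wsqrtr// ler_pdivrMr// mulrC -ler_pdivrMr//.
  by apply/ltW; exact: truncnS_gt.
pose t (k : nat) : R := k%:R * (T / n%:R).
have Tn0 : 0 < T / n%:R by rewrite divr_gt0.
have tI (k : 'I_n) : 0 <= t k <= T.
  rewrite mulr_ge0 ?(ltW Tn0)//= /t mulrCA ger_pMr// ler_pdivrMr// mul1r ler_nat.
  exact: ltnW.
have : \forall m \near \oo, forall (k : 'I_n) c, `|v (t k) ord0 c - u m (t k) ord0 c| < e / 4.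
  apply: filter_forall => k; apply: filter_forall => c.
  have /cvgrPdist_lt := H2_weak_cvg_eval (c := c) uv (tI k).
  by apply; rewrite divr_gt0.
apply: filterS => m um s; rewrite /= in_itv/= => /andP[s0 sT] c.
have [k [tks skt]] : exists k : 'I_n, t k <= s /\ s - t k <= T / n%:R.
  pose k := Num.trunc (s / (T / n%:R)).
  have q0 : 0 <= s / (T / n%:R) by rewrite divr_ge0// ltW.
  have /andP[k1 k2] := truncn_itv q0.
  have [kn|nk] := ltnP k n.
    exists (Ordinal kn); rewrite /t /= -ler_pdivlMr// k1; split => //.
    rewrite lerBlDl -[X in _ <= _ + X]mul1r -mulrDl -ler_pdivrMr//.
    by rewrite natr1; exact: ltW.
  have nn : (n.-1 < n)%N by [].
  exists (Ordinal nn); rewrite /t /=; split.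
    rewrite -ler_pdivlMr//; apply: le_trans k1; rewrite ler_nat.
    by apply: leq_trans nk; exact: leq_pred.
  rewrite lerBlDl -[X in _ <= _ + X]mul1r -mulrDl natr1 -/n.
  by rewrite mulrC divfK// gt_eqF.
have /andP[tk0 tkT] := tI k.
have close w : inH2 T w -> B w w <= Num.max M (B v v) ->
    `|w s ord0 c - w (t k) ord0 c| <= e / 4.
  move=> hw Bw; apply: le_trans (H2_holder T0 c hw tk0 tks sT) _.
  apply: (@le_trans _ _ (e / 4 / L * L)); last by rewrite divfK// gt_eqF.
  rewrite ler_pM ?sqrtr_ge0 ?LP//.
  by apply: le_trans mesh; rewrite ler_wsqrtr.
have cu : `|u m s ord0 c - u m (t k) ord0 c| <= e / 4.
  by apply: close => //; rewrite le_max uM.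
have cv : `|v s ord0 c - v (t k) ord0 c| <= e / 4.
  by apply: close => //; rewrite le_max lexx orbT.
have cuv := um k c.
move: cu cv cuv; set a := u m s _ _; set b := u m (t k) _ _; set a' := v s _ _; set b' := v (t k) _ _.
rewrite !ler_norml !ltr_norml => /andP[? ?] /andP[? ?] /andP[? ?]; apply/andP; split; lra.
Qed.

Lemma H2_weak_cvg_uniform (u : nat -> V) v : H2_weak_cvg T u v ->
  {uniform I, u @ \oo --> v}.
Proof. by move=> uv; apply: uniform_cvgP; exact: H2_weak_cvg_sup. Qed.

Lemma L2norm_wderiv2 u : inH2 T u ->
  L2norm T (wderiv T 2 u) ^+ 2 =
  \sum_(c < kappa) ip (coordf c (wderiv T 2 u)) (coordf c (wderiv T 2 u)).
Proof. by move=> hu; apply: L2norm_sqr; have [] := wderivP hu (isT : (2 <= 2)%N). Qed.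

(** The squared seminorm |u''|^2 is the supremum over [v] of the weakly continuous
    affine functionals 2 <u'', v''> - |v''|^2. *)
Lemma H2_weak_lsc (u : nat -> V) v : H2_weak_cvg T u v -> forall e : R, 0 < e ->
  \forall m \near \oo, L2norm T (wderiv T 2 v) ^+ 2 - e <= L2norm T (wderiv T 2 (u m)) ^+ 2.
Proof.
move=> [hu hv uv] e e0.
have arith (x y z d : R) : z - y <= d / 2 -> 0 <= x - 2 * y + z -> z - d <= x by lra.
pose F w := \sum_(c < kappa) ip (coordf c (wderiv T 2 w)) (coordf c (wderiv T 2 v)).
have sv c : sqI (coordf c (wderiv T 2 v)) by exact: wderiv_coord_sqI.
have dF : H2_dual T F.
  apply/H2_dualE; split=> [a x y hx hy|].
    by rewrite /F mulr_sumr -big_split; apply: eq_bigr => c _; exact: ip_wderivP.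
  exists (\sum_(c < kappa) nrm (coordf c (wderiv T 2 v))) => w hw.
  apply: le_trans (ler_norm_sum _ _ _) _; rewrite mulr_suml; apply: ler_sum => c _.
  have sw : sqI (coordf c (wderiv T 2 w)) by exact: wderiv_coord_sqI.
  have h := si_norm_cs siI sw (sv c); apply: le_trans h _.
  rewrite [leLHS]mulrC; apply: ler_wpM2l; first exact: sqrtr_ge0.
  by apply: ler_wsqrtr; exact: ip_wderiv_le.
have Fv : F v = L2norm T (wderiv T 2 v) ^+ 2 by rewrite L2norm_wderiv2.
have /cvgrPdist_le := uv F dF; move=> /(_ (e / 2)); rewrite divr_gt0// => /(_ isT).
apply: filterS => m; rewrite Fv ler_norml => /andP[_ Fm].
suff : 0 <= L2norm T (wderiv T 2 (u m)) ^+ 2 - 2 * F (u m) + L2norm T (wderiv T 2 v) ^+ 2 by exact: arith Fm.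
have su c : sqI (coordf c (wderiv T 2 (u m))) by exact: wderiv_coord_sqI.
have h c : 0 <= ip (coordf c (wderiv T 2 (u m))) (coordf c (wderiv T 2 (u m))) -
    2 * ip (coordf c (wderiv T 2 (u m))) (coordf c (wderiv T 2 v)) +
    ip (coordf c (wderiv T 2 v)) (coordf c (wderiv T 2 v)).
  rewrite -(si_sqrB siI (su c) (sv c)); apply: (si_ge0 siI).
  exact: (sq_integrableB mI (su c) (sv c)).
have sum_sqr (x y z : 'I_kappa -> R) : (forall c, 0 <= x c - 2 * y c + z c) ->
    0 <= \sum_c x c - 2 * (\sum_c y c) + \sum_c z c.
  move=> xyz; rewrite mulr_sumr -sumrB -big_split.
  by apply: sumr_ge0 => c _; exact: xyz.
rewrite [X in 0 <= X - _ + _](L2norm_wderiv2 (hu m)).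
rewrite [X in 0 <= _ + X](L2norm_wderiv2 hv).
rewrite /F.
exact: (sum_sqr (fun c => ip _ _) (fun c => ip _ _) (fun c => ip _ _) h).
Qed.

Lemma Rintegral_cst_itv (r : R) : \int[mu]_(_ in I) r = r * T.
Proof.
rewrite (@Rintegral_cst _ _ _ mu) //; congr (_ * _).
have := lebesgue_measure_itv `[0, T]; rewrite /= lte_fin T0 sube0 => h.
exact: (congr1 (fine : \bar R -> R) h).
Qed.

Lemma ip_le_bound (f : R -> R^o) (K : R) : sqI f ->
  (\forall t \ae mu, I t -> `|f t| <= K) -> ip f f <= K ^+ 2 * T.
Proof.
move=> sf fK; have sK := sqI_cst T K.
have -> : K ^+ 2 * T = ip (cst K) (cst K).
  by rewrite expr2 -Rintegral_cst_itv.
rewrite -lee_fin !L2_innerE//; apply: ae_ge0_le_integral => //.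
- by move=> t _; rewrite lee_fin sqr_ge0.
- by apply/measurable_EFinP; apply: measurable_funX; exact: sf.1.
- by move=> t _; rewrite lee_fin sqr_ge0.
- by apply/measurable_EFinP; apply: measurable_funX; exact: sK.1.
- have [N [mN N0 sub]] := fK; exists N; split => // t h; apply: sub => /= h'; apply: h => It.
  rewrite lee_fin -real_normK ?num_real// ler_pXn2r ?nnegrE//; first exact: h'.
  exact: le_trans (h' It).
Qed.

Lemma primitive0 (g : R -> R^o) : primitive g 0 = 0.
Proof. by rewrite /primitive set_itv1 Rintegral_set1. Qed.

(** Interpolation: the mean of [u'] is controlled by the end points of [u] and
    its oscillation by [u'']. *)
Lemma H2_bounded (N M : R) : exists C : R, forall u, inY T N u ->
  L2norm T (wderiv T 2 u) ^+ 2 <= M -> B u u <= C.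
Proof.
(* [K] bounds u': the fraction bounds the constant [k] in u' = [k] + primitive of
   u'', and the last summand bounds that primitive. *)
pose K : R := (2 * N + T * (Num.sqrt T * Num.sqrt M)) / T + Num.sqrt T * Num.sqrt M.
exists (\sum_(i < 3) \sum_(c < kappa) (N ^+ 2 * T + K ^+ 2 * T + M)) => u [hu uN] uM.
have N0 : 0 <= N by apply: le_trans (uN 0 _); rewrite ?sqrtr_ge0// lexx ltW.
have M0 : 0 <= M by apply: le_trans uM; exact: sqr_ge0.
have uc c t : 0 <= t <= T -> `|coordf c u t| <= N.
  by move=> tI; apply: le_trans (uN t tI); exact: coord_le_enorm.
have ip2 c : ip (coordf c (wderiv T 2 u)) (coordf c (wderiv T 2 u)) <= M.
  apply: le_trans uM; rewrite L2norm_wderiv2// (bigD1 c)//= lerDl.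
  by apply: sumr_ge0 => i _; apply: (si_ge0 siI); exact: wderiv_coord_sqI.
have ip0 c : ip (coordf c (wderiv T 0 u)) (coordf c (wderiv T 0 u)) <= N ^+ 2 * T.
  rewrite ip_wderiv0//; apply: ip_le_bound; first exact: inH2_sqI.
  by apply: aeW => t; rewrite /= in_itv/=; exact: uc.
have ip1 c : ip (coordf c (wderiv T 1 u)) (coordf c (wderiv T 1 u)) <= K ^+ 2 * T.
  set g1 := coordf c (wderiv T 1 u); pose g2 := coordf c (wderiv T 2 u).
  have s1 : sqI g1 by exact: wderiv_coord_sqI.
  have s2 : sqI g2 by exact: wderiv_coord_sqI.
  have sp := sqI_primitive s2; have sc := sqI_cst T 1.
  pose b := Num.sqrt T * Num.sqrt M.
  have pb t : 0 <= t <= T -> `|primitive g2 t| <= b.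
    move=> /andP[t0 tT]; have := primitive_holder s2 (lexx 0) t0 tT.
    rewrite primitive0 !subr0 => /le_trans; apply.
    by rewrite ler_pM ?sqrtr_ge0// ler_wsqrtr//; exact: ip2.
  have [_ w1] := wderivP hu (isT : (1 <= 2)%N).
  have [_ w2] := wderivP hu (isT : (2 <= 2)%N).
  have [|k g1E] := weak_derivative_primitive T0 s1 s2.
    move=> phi tphi.
    have := weak_derivative_ip c w1 (test_function_derive tphi).
    have := weak_derivative_ip c w2 tphi.
    by rewrite derive1Sn sqrrN !expr1n mul1r expr1 mulN1r => -> ->; rewrite opprK.
  have sk : sqI (fun t => k + primitive g2 t).
    have -> : (fun t => k + primitive g2 t) = k *: (cst 1 : R -> R^o) + primitive g2.
      by apply/funext => t; rewrite -[k in LHS]mulr1.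
    exact: (si_domP siI).
  have kb : `|k| <= (2 * N + T * b) / T.
    have ippb : `|ip (primitive g2) (cst 1)| <= b * T.
      apply: le_trans (si_norm_cs siI sp sc) _.
      have h1 : ip (primitive g2) (primitive g2) <= b ^+ 2 * T.
        by apply: ip_le_bound => //; apply: aeW => t; rewrite /= in_itv/=; exact: pb.
      have h2 : ip (cst 1) (cst 1) <= 1 ^+ 2 * T.
        by apply: ip_le_bound => //; apply: aeW => t _; rewrite normr1.
      have b0 : 0 <= b by rewrite mulr_ge0 ?sqrtr_ge0.
      apply: (@le_trans _ _ (Num.sqrt (b ^+ 2 * T) * Num.sqrt (1 ^+ 2 * T))).
        by rewrite ler_pM ?sqrtr_ge0// ler_wsqrtr.
      rewrite expr1n mul1r sqrtrM ?sqr_ge0// sqrtr_sqr ger0_norm// -mulrA -expr2.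
      by rewrite sqr_sqrtr// ltW.
    have uT : `|coordf c u T - coordf c u 0| <= 2 * N.
      have := ler_normB (coordf c u T) (coordf c u 0).
      have := uc c T; have := uc c 0; rewrite !lexx (ltW T0) => /(_ isT) + /(_ isT); lra.
    have E : coordf c u T - coordf c u 0 = k * T + ip (primitive g2) (cst 1).
      rewrite (H2_coord_primitive T0) ?lexx ?(ltW T0)// primitive0 subr0.
      have -> : primitive g1 T = ip g1 (cst 1).
        by apply: eq_Rintegral => t _; rewrite mulr1.
      rewrite (ip_ae_eq s1 sk sc g1E).
      have -> : (fun t => k + primitive g2 t) = k *: (cst 1 : R -> R^o) + primitive g2.
        by apply/funext => t; rewrite -[k in LHS]mulr1.
      rewrite (siP siI)//; congr (_ * _ + _); rewrite -[RHS]mul1r.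
      by rewrite -[RHS](Rintegral_cst_itv 1); apply: eq_Rintegral => t _; rewrite mulr1.
    rewrite ler_pdivlMr// -{1}[T](gtr0_norm T0) -normrM.
    have -> : k * T = coordf c u T - coordf c u 0 - ip (primitive g2) (cst 1).
      by rewrite E addrK.
    apply: le_trans (ler_normB _ _) _; rewrite [T * b]mulrC; exact: lerD.
  apply: ip_le_bound => //; have [Z [mZ Z0 sub]] := g1E; exists Z; split => // t h.
  apply: sub => /= h'; apply: h => It; rewrite h'//.
  apply: le_trans (ler_normD _ _) _; apply: lerD => //.
  by apply: pb; move: It; rewrite /= in_itv.
rewrite /H2_inner; apply: ler_sum => i _; apply: ler_sum => c _.
have p0 : 0 <= N ^+ 2 * T by rewrite mulr_ge0 ?sqr_ge0// ltW.
have p1 : 0 <= K ^+ 2 * T by rewrite mulr_ge0 ?sqr_ge0// ltW.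
case: i => -[|[|[|//]]] i3 /=.
- by apply: le_trans (ip0 c) _; lra.
- by apply: le_trans (ip1 c) _; lra.
- by apply: le_trans (ip2 c) _; lra.
Qed.

Lemma H2_bounded_weak_subseq (u : nat -> V) (M : R) : (forall n, inH2 T (u n)) ->
  (forall n, B (u n) (u n) <= M) ->
  exists s v, extraction s /\ H2_weak_cvg T (fun m => u (s m)) v.
Proof.
move=> hu uM.
have [s [v [exs hv sv]]] := bounded_weak_subseq siH (H2_complete T0) hu uM.
by exists s, v; split => //; split => // F /H2_dualE; exact: sv.
Qed.

End H2_weak.

(** * Law of large numbers for events *)

Lemma square_bracket n : exists m, (m ^ 2 <= n < m.+1 ^ 2)%N.
Proof.
elim: n => [|n [m /andP[mn nm]]]; first by exists 0%N.
have [h|h] := ltnP n.+1 (m.+1 ^ 2).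
  by exists m; rewrite h andbT ltnW.
exists m.+1; rewrite h /= (leq_ltn_trans nm)// ltn_exp2r//.
Qed.

(** Averages of a sequence with increments in the unit interval converge as
    soon as they do along the squares, which have ratio tending to one. *)
Lemma mean_cvg_squares (R : realType) (C : nat -> R) (p : R) :
  C 0%N = 0 -> (forall n, 0 <= C n.+1 - C n <= 1) ->
  (fun m => (m.+1 ^ 2)%:R^-1 * C (m.+1 ^ 2)%N) @ \oo --> p ->
  (fun n => n%:R^-1 * C n) @ \oo --> p.
Proof.
move=> C0 dC Cp.
have incr m n : (m <= n)%N -> 0 <= C n - C m <= (n - m)%:R.
  move=> /subnKC <-; elim: (n - m)%N => [|k IH].
    by rewrite addn0 subrr subnn lexx.
  have := dC (m + k)%N; rewrite addnS.
  move: IH; rewrite !addKn -addnS addKn -natr1 => /andP[? ?] /andP[? ?].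
  by apply/andP; split; lra.
apply/cvgrPdist_lt => e e0; have e2 : 0 < e / 2 by lra.
have /cvgrPdist_lt/(_ _ e2)[M _ MP] := Cp.
pose K := maxn M.+1 (Num.trunc (8 / e)).+1.
exists (K ^ 2)%N => // n /= Kn.
have [m /andP[mn nm]] := square_bracket n.
have Km : (K <= m)%N.
  by rewrite -ltnS -(@ltn_exp2r _ _ 2)// (leq_ltn_trans Kn nm).
have m0 : (0 < m)%N by apply: leq_trans Km; rewrite leq_max.
have MmP : (M <= m.-1)%N by rewrite -ltnS prednK// (leq_trans _ Km)// leq_maxl.
have := MP m.-1 MmP; rewrite /= prednK// => h.
have mK : 8 / e < m%:R.
  apply: lt_le_trans (truncnS_gt _) _; rewrite ler_nat.
  by apply: leq_trans Km; exact: leq_maxr.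
have mR : 0 < m%:R :> R by rewrite ltr0n.
have m2R : 0 < (m ^ 2)%:R :> R by rewrite ltr0n expn_gt0 m0.
have n0 : 0 < n%:R :> R by rewrite (lt_le_trans m2R)// ler_nat.
have nm2 : (n - m ^ 2)%:R <= 2 * m%:R :> R.
  rewrite -natrM ler_nat leq_subLR; move: nm; rewrite -[m.+1]addn1 sqrnD; lia.
have /andP[i0 i1] := incr _ _ mn.
have c0 : 0 <= C (m ^ 2)%N <= (m ^ 2)%:R.
  by have := incr 0%N (m ^ 2)%N (leq0n _); rewrite C0 !subr0 subn0.
have sn : (m ^ 2)%:R <= n%:R :> R by rewrite ler_nat.
move: nm2 i1; rewrite natrB// => nm2 i1.
have sE : (m ^ 2)%:R = m%:R * m%:R :> R by rewrite -natrM.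
set q := (m ^ 2)%:R^-1 * C (m ^ 2)%N in h.
have qn : `|q - n%:R^-1 * C n| <= 2 * m%:R / n%:R.
  rewrite ler_pdivlMr// -[X in _ * X](gtr0_norm n0) -normrM.
  have -> : (q - n%:R^-1 * C n) * n%:R = q * (n%:R - (m ^ 2)%:R) - (C n - C (m ^ 2)%N).
    by rewrite /q; field; rewrite !gt_eqF.
  have /andP[q0 q1] : 0 <= q <= 1.
    case/andP: c0 => c0 c1.
    by rewrite /q mulr_ge0 ?invr_ge0//= mulrC ler_pdivrMr// mul1r.
  have d0 : 0 <= n%:R - (m ^ 2)%:R :> R by rewrite subr_ge0.
  have qd1 : q * (n%:R - (m ^ 2)%:R) <= n%:R - (m ^ 2)%:R by rewrite ler_piMl.
  have qd0 : 0 <= q * (n%:R - (m ^ 2)%:R) by rewrite mulr_ge0.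
  rewrite ler_norml; apply/andP; split; lra.
have mn2 : 2 * m%:R / n%:R < e / 2.
  rewrite ltr_pdivrMr//; apply: lt_le_trans (_ : e / 2 * (m%:R * m%:R) <= _); last first.
    by rewrite -sE ler_pM2l.
  rewrite mulrA ltr_pM2r//.
  by move: mK; rewrite ltr_pdivrMr// => mK; lra.
rewrite -[p](subrK q) -addrA; apply: le_lt_trans (ler_normD _ _) _; lra.
Qed.

Section lln.
Context (R : realType) (d : measure_display) (Omega : measurableType d)
  (Pr : probability Omega R).
Notation L2P := (sq_integrable Pr setT).
Notation ipP := (L2_inner Pr setT).

Lemma sum_inverse_squares n : \sum_(0 <= m < n) (m.+1%:R ^- 2 : R) <= 2.
Proof.
suff h k : \sum_(0 <= m < k.+1) (m.+1%:R ^- 2 : R) <= 2 - k.+1%:R^-1.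
  case: n => [|n]; first by rewrite big_geq//; lra.
  by apply: le_trans (h n) _; rewrite gerBl invr_ge0.
elim: k => [|k IH]; first by rewrite big_nat1 expr1n invr1; lra.
rewrite big_nat_recr//=; apply: le_trans (lerD IH (lexx _)) _.
have k1 : (0 : R) < k.+1%:R by [].
have k2 : k.+2%:R = k.+1%:R + 1 :> R by rewrite natr1.
rewrite -addrA lerD2l -subr_ge0 k2.
have -> (x : R) : 0 < x -> - (x + 1)^-1 - (- x^-1 + (x + 1) ^- 2) = (x * (x + 1) ^+ 2)^-1.
  by move=> x0; field; rewrite !gt_eqF//; lra.
  by rewrite invr_ge0 mulr_ge0 ?sqr_ge0 ?ltW.
by [].
Qed.

Lemma sq_integrable_bounded (f : Omega -> R^o) (K : R) :
  measurable_fun setT (f : Omega -> R) -> (forall x, `|f x| <= K) -> L2P f.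
Proof.
move=> mf fK; split => //.
apply: (@le_integrable _ _ _ Pr _ _ _ (fun=> (K ^+ 2)%:E)) => //.
- by apply/measurable_EFinP; exact: measurable_funX.
- move=> x _; rewrite /= lee_fin !ger0_norm ?sqr_ge0// -[leLHS]real_normK ?num_real//.
  by rewrite ler_pXn2r ?nnegrE//; exact: le_trans (fK x).
- exact: finite_measure_integrable_cst.
Qed.

Lemma Pr_Rintegral_cst (r : R) : \int[Pr]_(_ in setT) r = r.
Proof. by rewrite (@Rintegral_cst _ _ _ Pr) // (congr1 (fine : \bar R -> R) (probability_setT Pr)) mulr1. Qed.

Lemma Rintegral_indicT (A : set Omega) : measurable A ->
  \int[Pr]_(x in setT) \1_A x = fine (Pr A).
Proof. by move=> mA; rewrite /Rintegral integral_indic// setIT. Qed.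

(** Pairwise independence suffices: the variance of the centred partial sums
    grows linearly, so that it is summable along the squares. *)
Theorem lln_events (A : nat -> set Omega) (p : R) :
  (forall i, measurable (A i)) -> (forall i, Pr (A i) = p%:E) ->
  (forall i j, i != j -> Pr (A i `&` A j) = (p * p)%:E) ->
  \forall omega \ae Pr,
    (fun n => n%:R^-1 * \sum_(i < n) (\1_(A i) omega : R)) @ \oo --> p.
Proof.
move=> mA PA PAA.
have p01 : 0 <= p <= 1.
  by rewrite -!lee_fin -(PA 0%N) measure_ge0 probability_le1.
pose X i : Omega -> R^o := fun x => \1_(A i) x - p.
have mX i : measurable_fun setT (X i : Omega -> R).
  by apply: measurable_funB => //; exact: measurable_indic.
have X1 i x : `|X i x| <= 1.
  rewrite /X indicE ler_norml; case/andP: p01 => p0 p1.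
  by case: (_ \in _) => /=; apply/andP; split; lra.
have sX i : L2P (X i) by exact: sq_integrable_bounded (mX i) (X1 i).
have s1 (c : R) : L2P (cst c) by apply: (@sq_integrable_bounded _ `|c|).
have sA i : L2P (\1_(A i) : Omega -> R^o).
  apply: (@sq_integrable_bounded _ 1); first exact: measurable_indic.
  by move=> x; rewrite indicE; case: (_ \in _); rewrite ?normr1 ?normr0.
have si := @L2_semi_inner R d Omega Pr setT measurableT.
have XE i : X i = (\1_(A i) : Omega -> R^o) - cst p by [].
have ip1 i : ipP (\1_(A i)) (cst p) = p * p.
  rewrite /L2_inner RintegralZr//; last by apply: integrable_indic.
  by rewrite Rintegral_indicT// PA.
have ipc : ipP (cst p) (cst p) = p * p by rewrite -[RHS](Pr_Rintegral_cst (p * p)).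
have ipA i j : ipP (\1_(A i)) (\1_(A j)) = fine (Pr (A i `&` A j)).
  rewrite -Rintegral_indicT; last exact: measurableI.
  by apply: eq_Rintegral => x _; rewrite indicI.
have ipX i j : ipP (X i) (X j) = fine (Pr (A i `&` A j)) - p * p.
  rewrite !XE (siBl si)//; last exact: sq_integrableB.
  rewrite !(siBr si)// ipA ipc ip1 (siC si)// ip1; ring.
have X0 i j : i != j -> ipP (X i) (X j) = 0 by move=> ij; rewrite ipX PAA//= subrr.
have Xii i : ipP (X i) (X i) <= 1.
  rewrite ipX setIid PA /=; case/andP: p01 => p0 p1.
  by have := mulr_ge0 p0 p0; lra.
pose S n : Omega -> R^o := \sum_(i < n) X i.
have sS n : L2P (S n).
  rewrite /S; elim/big_ind: _ => //; first exact: (si_dom0 si).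
  by move=> x y; exact: (si_domD si).
have S0 n j : (n <= j)%N -> ipP (S n) (X j) = 0.
  elim: n => [|n IH] nj; first by rewrite /S big_ord0 (si0l si).
  rewrite /S big_ord_recr /= (siDl si)//; last exact: (sS n).
  by rewrite -/(S n) IH ?X0 ?addr0//; [rewrite ltn_eqF|exact: ltnW].
have SS n : ipP (S n) (S n) <= n%:R.
  elim: n => [|n IH]; first by rewrite /S big_ord0 (si0l si)//; exact: (si_dom0 si).
  rewrite /S big_ord_recr /= -/(S n) (si_sqrD si)// S0// mulr0 addr0 -natr1.
  exact: lerD.
pose Y m (x : Omega) : R := ((m.+1 ^ 2)%:R^-1 * (S (m.+1 ^ 2)%N x : R)) ^+ 2.
have mY m : measurable_fun setT (fun x => (Y m x)%:E).
  apply/measurable_EFinP; apply: measurable_funX; apply: measurable_funM => //.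
  exact: (sS _).1.
have IY m : (\int[Pr]_x (Y m x)%:E <= (m.+1%:R ^- 2)%:E)%E.
  have := L2_innerE measurableT (sS (m.+1 ^ 2)%N) => E.
  rewrite /Y; under eq_integral do rewrite exprMn EFinM.
  rewrite integralZl//; last exact: (sS _).2.
  rewrite -E -EFinM lee_fin.
  have m0 : (0 : R) < (m.+1 ^ 2)%:R by rewrite ltr0n expn_gt0.
  rewrite expr2 -mulrA -[leRHS]mulr1 -natrX ler_pM2l ?invr_gt0//.
  by rewrite mulrC ler_pdivrMr// mul1r.
have Y0 m x : 0 <= Y m x by exact: sqr_ge0.
have mSY : measurable_fun setT (fun x => \sum_(0 <= m <oo) (Y m x)%:E)%E.
  by apply: ge0_emeasurable_sum => // m x _; rewrite lee_fin.
have iSY : Pr.-integrable setT (fun x => \sum_(0 <= m <oo) (Y m x)%:E)%E.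
  apply/integrableP; split => //.
  have SY0 x : (0 <= \sum_(0 <= m <oo) (Y m x)%:E)%E.
    by apply: nneseries_ge0 => m _ _; rewrite lee_fin.
  under eq_integral do rewrite gee0_abs//.
  rewrite integral_nneseries//; last by move=> m x _; rewrite lee_fin.
  apply: (@le_lt_trans _ _ 2%:E); last by rewrite ltry.
  apply: (@le_trans _ _ (\sum_(0 <= m <oo) (m.+1%:R ^- 2 : R)%:E)%E).
    by apply: lee_nneseries => // m _ _; apply: integral_ge0 => x _; rewrite lee_fin.
  apply: lime_le.
    by apply: is_cvg_nneseries => m _ _; rewrite lee_fin invr_ge0 exprn_ge0.
  by apply: nearW => n; rewrite sumEFin lee_fin sum_inverse_squares.
have := integrable_ae measurableT iSY; apply: filterS => x /(_ I) fx.
apply: mean_cvg_squares.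
- by rewrite big_ord0.
- move=> n; rewrite big_ord_recr /= addrAC subrr add0r indicE.
  by case: (_ \in _); rewrite ?lexx ?ler01.
have Yx0 : (fun m => Y m x) @ \oo --> 0.
  suff : (fun m => (Y m x)%:E) @ \oo --> 0%:E by move/fine_cvg.
  have fin : (\sum_(0 <= k <oo) (Y k x)%:E < +oo)%E by rewrite ltey_eq fx.
  have tl := nneseries_tail_cvg fin (fun k _ => ltac:(by rewrite lee_fin)).
  apply: (squeeze_cvge _ (cvg_cst 0%E) tl); apply: nearW => m /=.
  rewrite lee_fin Y0 /=.
  apply: le_trans (nneseries_lim_ge m.+1 _); last by move=> k _ _; rewrite lee_fin.
  by rewrite big_nat1.
have cS0 : (fun m => (m.+1 ^ 2)%:R^-1 * (S (m.+1 ^ 2)%N x : R)) @ \oo --> (0 : R).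
  apply/cvgrPdist_lt => e e0; have /cvgrPdist_lt/(_ _ (exprn_gt0 2 e0)) := Yx0.
  apply: filterS => m; rewrite !sub0r !normrN /Y ger0_norm ?sqr_ge0//.
  by move=> h; rewrite -(@ltr_pXn2r _ 2) ?nnegrE ?(ltW e0)// real_normK ?num_real.
rewrite (_ : (fun m => _) = (fun m => (m.+1 ^ 2)%:R^-1 * (S (m.+1 ^ 2)%N x : R) + p)).
  by rewrite -[X in _ --> X]add0r; apply: cvgD => //; exact: cvg_cst.
apply/funext => m; have m0 : (m.+1 ^ 2)%:R != 0 :> R by rewrite pnatr_eq0 expn_eq0.
have -> : (S (m.+1 ^ 2)%N x : R) = \sum_(i < m.+1 ^ 2) \1_(A i) x - (m.+1 ^ 2)%:R * p.
  by rewrite /S fct_sumE /X sumrB sumr_const card_ord mulr_natl.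
by rewrite mulrBr mulKf// subrK.
Qed.

End lln.

Lemma lln_frequency (R : realType) (kappa : nat) (d : measure_display)
    (Omega : measurableType d) (Pr : probability Omega R)
    (P : probability (data R kappa) R) (xi : nat -> Omega -> data R kappa)
    (E : set (data R kappa)) :
  iid_samples Pr P xi -> measurable E ->
  \forall omega \ae Pr,
    (fun n => n%:R^-1 * \sum_(i < n) (\1_E (xi i omega) : R)) @ \oo --> fine (P E).
Proof.
move=> [mxi lxi ixi] mE.
have PE : P E = (fine (P E))%:E by rewrite fineK//; exact: fin_num_measure.
apply: (@lln_events _ _ _ _ (fun i => xi i @^-1` E)).
- by move=> i; rewrite -[X in measurable X]setTI; exact: mxi.
- by move=> i; rewrite lxi.
- move=> i j ij; have := ixi [fset i; j]%fset (fun=> E) (fun=> mE).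
  rewrite big_fsetU1/= ?inE// big_seq_fset1 !lxi// EFinM -PE => <-; congr (Pr _).
  apply/seteqP; split => [x [xi_ xj] k /=|x h].
    by rewrite !inE => /orP[] /eqP ->.
  by split; apply: h; rewrite /= !inE eqxx ?orbT.
Qed.

(** * Cells of the data space *)

Section cells.
Context (R : realType) (kappa : nat).
Notation pt := (R * 'rV[R]_kappa)%type.
Implicit Types (x y : pt) (m : nat).

Definition dcoord (o : option 'I_kappa) (x : pt) : R :=
  if o is Some c then x.2 ord0 c else x.1.

Lemma continuous_data_measurable (f : pt -> R) : continuous f ->
  measurable_fun setT (f : data R kappa -> R).
Proof.
move=> cf; apply: (measurability _ (RGenOpens.measurableE R)).
move=> _ [_ [a [b ->] <-]]; rewrite setTI; apply: sub_sigma_algebra.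
by apply: open_comp => [x _|]; [exact: cf|exact: interval_open].
Qed.

Lemma dcoord_continuous o : continuous (dcoord o).
Proof.
case: o => [c|] x /=; last exact: cvg_fst.
apply: (@continuous_comp _ _ _ (fun y : pt => y.2) (fun z : 'rV[R]_kappa => z ord0 c)).
  exact: cvg_snd.
exact: coord_continuous.
Qed.

Lemma dcoord_measurable o : measurable_fun setT (dcoord o : data R kappa -> R).
Proof. by apply: continuous_data_measurable; exact: dcoord_continuous. Qed.

Definition cell_code m (x : pt) : {ffun option 'I_kappa -> int} :=
  [ffun o => Num.floor (m.+1%:R * dcoord o x)].

Definition cell m (p : {ffun option 'I_kappa -> int}) : set (data R kappa) :=
  [set x | cell_code m x = p].

(** The time of the corner is at most that of the points of the cell and still
    nonnegative when theirs is, so that curves can be evaluated there. *)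
Definition corner m (p : {ffun option 'I_kappa -> int}) : pt :=
  ((p None)%:~R / m.+1%:R, \row_c ((p (Some c))%:~R / m.+1%:R)).

Lemma dcoord_corner m p o : dcoord o (corner m p) = (p o)%:~R / m.+1%:R.
Proof. by case: o => [c|] //=; rewrite mxE. Qed.

Lemma corner_code_near m x o :
  dcoord o (corner m (cell_code m x)) <= dcoord o x < dcoord o (corner m (cell_code m x)) + m.+1%:R^-1.
Proof.
rewrite dcoord_corner ffunE; have m0 : (0 : R) < m.+1%:R by [].
have /andP[f1 f2] := floor_itv (m.+1%:R * dcoord o x).
rewrite ler_pdivrMr// [_ * m.+1%:R]mulrC f1 /= -[X in _ < _ + X]mul1r -mulrDl.
by rewrite ltr_pdivlMr// mulrC; move: f2; rewrite intrD.
Qed.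

Lemma measurable_cell m p : measurable (cell m p).
Proof.
have -> : cell m p = \big[setI/setT]_(o <- index_enum (option 'I_kappa))
    (dcoord o @^-1` `[(p o)%:~R / m.+1%:R, (p o + 1)%:~R / m.+1%:R[ : set (data R kappa)).
  rewrite -bigcap_seq; apply/seteqP; split=> x /=.
    move=> <- o _; rewrite /= in_itv/= ffunE.
    have m0 : (0 : R) < m.+1%:R by [].
    by rewrite ler_pdivrMr// ltr_pdivlMr// mulrC floor_itv.
  move=> h; apply/ffunP => o; rewrite ffunE; apply: floor_def.
  have m0 : (0 : R) < m.+1%:R by [].
  have := h o; rewrite /= in_itv/= ler_pdivrMr// ltr_pdivlMr// mulrC; apply.
  by rewrite mem_index_enum.
apply: bigsetI_measurable => o _; rewrite -[X in measurable X]setTI.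
exact: dcoord_measurable.
Qed.

Lemma same_cell_near m x y o : cell_code m x = cell_code m y ->
  `|dcoord o x - dcoord o y| < m.+1%:R^-1.
Proof.
move=> xy; have /andP[x1 x2] := corner_code_near m x o.
have /andP[y1 y2] := corner_code_near m y o.
rewrite xy in x1 x2; rewrite ltr_distl; move: x1 x2 y1 y2.
set a := dcoord o x; set b := dcoord o y; set c := dcoord o _; set e := _^-1.
by move=> x1 x2 y1 y2; apply/andP; split; lra.
Qed.

(** Small cells exhaust every open set, so the complement of the support is
    covered by the countably many cells of measure zero. *)
Lemma msupport_full (P : probability (data R kappa) R) :
  exists N : set (data R kappa), [/\ measurable N, P N = 0%E & ~` (msupport P) `<=` N].
Proof.
pose F (k : nat) : set (data R kappa) :=
  if (choice.unpickle k : option (nat * {ffun option 'I_kappa -> int})) is Some (m, p)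
  then (if P (cell m p) == 0%E then cell m p else set0) else set0.
have mF k : measurable (F k).
  rewrite /F; case: choice.unpickle => [[m p]|//]; case: ifP => // _; exact: measurable_cell.
have PF k : P (F k) = 0%E.
  rewrite /F; case: choice.unpickle => [[m p]|]; last exact: measure0.
  by case: ifP => [/eqP//|_]; exact: measure0.
exists (\bigcup_k F k); split.
- exact: bigcup_measurable.
- apply/eqP; rewrite eq_le measure_ge0 andbT.
  apply: le_trans (measure_sigma_subadditive _ mF (bigcup_measurable (fun k _ => mF k)) (fun x h => h)) _.
  by rewrite (eq_eseriesr (fun i _ => PF i)) eseries0.
move=> x nx; have [U [oU Ux PU]] : exists U : set pt, [/\ open U, U x & P U = 0%E].
  apply: contrapT => nU; apply: nx => U oU Ux; rewrite lt0e measure_ge0 andbT.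
  by apply/negP => /eqP PU; apply: nU; exists U.
have : nbhs x U by exact: open_nbhs_nbhs.
move=> /nbhs_ballP[e /= e0 eU].
have [m _ /(_ m (leqnn m)) /= me] := near_infty_natSinv_lt (PosNum e0).
have sub : cell m (cell_code m x) `<=` U.
  move=> y /= yx; apply: eU; have h o := lt_trans (same_cell_near o yx) me.
  split; rewrite /= -ball_normE /= distrC; first exact: (h None).
  by apply: rv_norm_lt => // c; rewrite !mxE; exact: (h (Some c)).
have Pc : P (cell m (cell_code m x)) = 0%E.
  apply/eqP; rewrite eq_le measure_ge0 andbT -PU le_measure// inE.
    exact: measurable_cell.
  exact: sub_sigma_algebra.
exists (choice.pickle (m, cell_code m x)) => //; rewrite /F choice.pickleK Pc eqxx //.
Qed.

End cells.

(** * Empirical means over bounded data *)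

Section data_support.
Context (R : realType) (kappa : nat) (T : R).
Variable P : probability (data R kappa) R.

Lemma measurable_Xset : measurable (Xset kappa T).
Proof.
have -> : Xset kappa T = dcoord None @^-1` `[0, T].
  by apply/seteqP; split=> x /=; rewrite in_itv.
by rewrite -[X in measurable X]setTI; exact: dcoord_measurable.
Qed.

(** The region [E] carries all the mass and is bounded, so that almost surely
    no sample ever leaves it. *)
Lemma bounded_full_set : P (Xset kappa T) = 1%E -> compact (msupport P) ->
  exists E : set (data R kappa), exists L : R,
    [/\ measurable E, P (~` E) = 0%E, E `<=` Xset kappa T &
        forall x, E x -> forall o, `|dcoord o x| <= L].
Proof.
move=> PX /compact_bounded[L0 [_ /(_ (L0 + 1))/=]]; rewrite ltrDl ltr01 => /(_ isT) bL.
have [N [mN PN sN]] := msupport_full P.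
have mX := measurable_Xset.
exists (Xset kappa T `\` N), (L0 + 1); split.
- exact: measurableD.
- rewrite setDE setCI setCK; apply: null_set_setU => //; first exact: measurableC.
  by have := probability_setC P mX; rewrite PX subee.
- by move=> x [].
move=> x [xX nx] o; have /bL : msupport P x by apply: contrapT => /sN.
rewrite /= prod_normE ge_max => /andP[x1 x2].
case: o => [c|] /=; last exact: x1.
exact: le_trans (coord_le_norm _ _) x2.
Qed.

End data_support.

Lemma samples_avoid_null (R : realType) (kappa : nat) (d : measure_display)
    (Omega : measurableType d) (Pr : probability Omega R)
    (P : probability (data R kappa) R) (xi : nat -> Omega -> data R kappa)
    (E : set (data R kappa)) :
  iid_samples Pr P xi -> measurable E -> P (~` E) = 0%E ->
  \forall omega \ae Pr, forall i, E (xi i omega).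
Proof.
move=> [mxi lxi _] mE PE; apply: ae_foralln => i.
exists (xi i @^-1` (~` E)); split => //.
- by rewrite -[X in measurable X]setTI; apply: mxi => //; exact: measurableC.
- exact: etrans (lxi i _ (measurableC mE)) PE.
Qed.

(** Almost surely all cell frequencies converge at once, as there are only
    countably many cells. *)
Lemma cell_frequencies (R : realType) (kappa : nat) (d : measure_display)
    (Omega : measurableType d) (Pr : probability Omega R)
    (P : probability (data R kappa) R) (xi : nat -> Omega -> data R kappa) :
  iid_samples Pr P xi ->
  \forall omega \ae Pr, forall m p,
    (fun n => n%:R^-1 * \sum_(i < n) (\1_(cell m p) (xi i omega) : R)) @ \oo -->
    fine (P (cell m p)).
Proof.
move=> hxi.
pose Q (l : nat) omega :=
  if (choice.unpickle l : option (nat * {ffun option 'I_kappa -> int})) is Some (m, p)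
  then (fun n => n%:R^-1 * \sum_(i < n) (\1_(cell m p) (xi i omega) : R)) @ \oo -->
    fine (P (cell m p)) else True.
have /ae_foralln : forall l, \forall omega \ae Pr, Q l omega.
  move=> l; rewrite /Q; case: choice.unpickle => [[m p]|]; last exact: aeW.
  by apply: lln_frequency => //; exact: measurable_cell.
apply: filterS => omega h m p.
by have := h (choice.pickle (m, p)); rewrite /Q choice.pickleK.
Qed.

Lemma finitely_many_codes (R : realType) (kappa m : nat) (L : R) :
  exists s : seq {ffun option 'I_kappa -> int}, uniq s /\
    forall x : R * 'rV[R]_kappa, (forall o, `|dcoord o x| <= L) -> cell_code m x \in s.
Proof.
pose M := (Num.trunc (m.+1%:R * L)).+1.
pose g (f : {ffun option 'I_kappa -> 'I_(2 * M).+1}) : {ffun option 'I_kappa -> int} :=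
  [ffun o => (f o : nat)%:Z - M%:Z].
exists (undup (codom g)); split; first exact: undup_uniq.
move=> x xL; rewrite mem_undup; apply/codomP.
have h o : (absz (cell_code m x o + M%:Z)%R <= 2 * M)%N /\ 0 <= cell_code m x o + M%:Z.
  have : `|m.+1%:R * dcoord o x| <= M%:R.
    rewrite normrM ger0_norm//; apply: le_trans (_ : m.+1%:R * L <= _).
      by rewrite ler_pM2l//; exact: xL.
    exact: ltW (truncnS_gt _).
  rewrite ler_norml ffunE => /andP[a1 a2].
  have f1 : - M%:Z <= Num.floor (m.+1%:R * dcoord o x) by rewrite floor_ge_int rmorphN.
  have f2 : Num.floor (m.+1%:R * dcoord o x) <= M%:Z.
    by rewrite -(ler_int R); exact: le_trans (floor_le _) a2.
  by split; lia.
exists [ffun o => inord (absz (cell_code m x o + M%:Z))]; apply/ffunP => o.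
have [h1 h2] := h o; rewrite [RHS]ffunE [X in nat_of_ord X]ffunE inordK ?ltnS//.
by rewrite gez0_abs// addrK.
Qed.

Lemma cvg_big_seq (R : realType) (I : Type) (s : seq I) (u : I -> nat -> R) (l : I -> R) :
  (forall i, u i @ \oo --> l i) ->
  (fun n => \sum_(i <- s) u i n) @ \oo --> \sum_(i <- s) l i.
Proof.
move=> ul; elim: s => [|i s IH].
  by rewrite big_nil; under eq_fun do rewrite big_nil; exact: cvg_cst.
by rewrite big_cons; under eq_fun do rewrite big_cons; exact: cvgD.
Qed.

(** Replacing [h] by its values at the corners of small cells changes the means and
    the integral by little, and leaves finitely many frequencies to follow. *)
Lemma empirical_cvg (R : realType) (kappa : nat) (P : probability (data R kappa) R)
    (D E : set (data R kappa)) (L C : R) (x : nat -> data R kappa)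
    (h : R * 'rV[R]_kappa -> R) :
  measurable D -> measurable E -> P (~` E) = 0%E -> E `<=` D ->
  (forall y, E y -> forall o, `|dcoord o y| <= L) -> (forall i, E (x i)) ->
  (forall m p, (fun n => n%:R^-1 * \sum_(i < n) (\1_(cell m p) (x i) : R)) @ \oo -->
    fine (P (cell m p))) ->
  measurable_fun D (h : data R kappa -> R) -> (forall y, E y -> `|h y| <= C) ->
  (forall e : R, 0 < e -> exists m, forall y, E y -> `|h y - h (corner R m (cell_code m y))| <= e) ->
  (fun n => n%:R^-1 * \sum_(i < n) h (x i)) @ \oo --> \int[P]_(y in D) h y.
Proof.
move=> mD mE PE ED EL xE freq mh hC osc.
have PE1 : P E = 1%E.
  have := probability_setC P (measurableC mE); rewrite setCK => ->.
  by rewrite [X in (_ - X)%E]PE sube0.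
have PI A : measurable A -> P (A `&` E) = P A.
  move=> mA; rewrite -[in RHS](setIT A) -(setUv E) setIUr measureU0//.
  - exact: measurableI.
  - by apply: measurableI => //; exact: measurableC.
  - by apply: subset_measure0 PE => //; [apply: measurableI => //|]; exact: measurableC.
have ihE : P.-integrable E (EFin \o (h : data R kappa -> R)).
  apply: measurable_bounded_integrable => //.
  - by apply: le_lt_trans (probability_le1 P mE) _; rewrite ltry.
  - exact: measurable_funS mh.
  by exists C; split; [exact: num_real|move=> M CM y Ey; exact: le_trans (hC _ Ey) (ltW CM)].
have DE : D `\` ~` E = E by rewrite setDE setCK setIidr.
have ih : P.-integrable D (EFin \o (h : data R kappa -> R)).
  by apply/(negligible_integrable (measurableC mE)) => //; [exact/measurable_EFinP|rewrite DE].
have -> : \int[P]_(y in D) h y = \int[P]_(y in E) h y.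
  rewrite /Rintegral (@negligible_integral _ _ _ _ D (~` E))//; last exact: measurableC.
  by rewrite DE.
apply/cvgrPdist_lt => e e0; have e3 : 0 < e / 3 by lra.
have [m hm] := osc _ e3; have [s [us sP]] := @finitely_many_codes R kappa m L.
pose g (y : data R kappa) : R := \sum_(p <- s) h (corner R m p) * \1_(cell m p) y.
have gE y : E y -> g y = h (corner R m (cell_code m y)).
  move=> Ey; rewrite /g (big_rem (cell_code m y)) ?sP//=; last exact: EL.
  rewrite big_seq big1 => [|p].
    by rewrite addr0 indicE mem_set ?mulr1.
  rewrite mem_rem_uniq// => /andP[/= pc _]; rewrite indicE memNset ?mulr0//.
  by move=> /= pE; rewrite -pE eqxx in pc.
have ii p : P.-integrable E (EFin \o (\1_(cell m p) : data R kappa -> R)).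
  apply: measurable_bounded_integrable => //.
  - by apply: le_lt_trans (probability_le1 P mE) _; rewrite ltry.
  - by apply: measurable_indic; exact: measurable_cell.
  exists 1; split; [exact: num_real|move=> M M1 y _ /=].
  by rewrite indicE; case: (_ \in _); rewrite ?normr1 ?normr0 ltW// (lt_trans _ M1).
have ic p : P.-integrable E (EFin \o (fun y => h (corner R m p) * \1_(cell m p) y)).
  exact: (integrableZl mE (h (corner R m p)) (ii p)).
have [ig Ig] : P.-integrable E (EFin \o g) /\
    \int[P]_(y in E) g y = \sum_(p <- s) h (corner R m p) * fine (P (cell m p)).
  rewrite /g; elim: {us sP gE g} s => [|p s [IH1 IH2]].
    split; last by rewrite big_nil; under eq_Rintegral do rewrite big_nil; rewrite Rintegral_cst// mul0r.
    by under eq_fun do rewrite big_nil; exact: integrable0.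
  have -> : (fun y : data R kappa => \sum_(p0 <- p :: s) h (corner R m p0) * \1_(cell m p0) y) =
     (fun y => h (corner R m p) * \1_(cell m p) y + \sum_(p0 <- s) h (corner R m p0) * \1_(cell m p0) y).
    by apply/funext => y; rewrite big_cons.
  split; first exact: (integrableD mE (ic p) IH1).
  rewrite RintegralD// IH2 big_cons (RintegralZl _ mE (ii p)).
  congr (_ * _ + _); rewrite /Rintegral integral_indic//; last exact: measurable_cell.
  by congr fine; apply: PI; exact: measurable_cell.
have cg : (fun n => n%:R^-1 * \sum_(i < n) g (x i)) @ \oo --> \int[P]_(y in E) g y.
  rewrite Ig (_ : (fun n => _) = (fun n => \sum_(p <- s) h (corner R m p) *
      (n%:R^-1 * \sum_(i < n) (\1_(cell m p) (x i) : R)))).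
    apply: (@cvg_big_seq R _ s (fun p n => h (corner R m p) *
        (n%:R^-1 * \sum_(i < n) (\1_(cell m p) (x i) : R)))) => p.
    by apply: cvgM; [exact: cvg_cst|exact: freq].
  apply/funext => n; rewrite /g exchange_big mulr_sumr /=; apply: eq_bigr => p _.
  by rewrite -mulr_sumr mulrCA.
have d1 : `|\int[P]_(y in E) h y - \int[P]_(y in E) g y| <= e / 3.
  rewrite -RintegralB//; apply: le_trans (le_normr_Rintegral _ _) _ => //.
    exact: (integrableB mE ihE ig).
  apply: le_trans (_ : \int[P]_(y in E) (e / 3) <= _); last first.
    rewrite (Rintegral_cst P mE) -[leRHS]mulr1; rewrite le_eqVlt; apply/orP; left; apply/eqP; congr (_ * _).
    exact: (congr1 fine PE1).
  apply: le_Rintegral => //.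
  - exact: integrable_abse (integrableB mE ihE ig).
  - by apply: finite_measure_integrable_cst.
  - by move=> y Ey; rewrite gE// hm.
have d2 n : `|n%:R^-1 * \sum_(i < n) g (x i) - n%:R^-1 * \sum_(i < n) h (x i)| <= e / 3.
  rewrite -mulrBr -sumrB normrM ger0_norm ?invr_ge0//.
  case: n => [|n]; first by rewrite big_ord0 normr0 mulr0 ltW.
  rewrite mulrC ler_pdivrMr//; apply: le_trans (ler_norm_sum _ _ _) _.
  apply: le_trans (ler_sum _ (_ : forall i : 'I_n.+1, true -> _ <= e / 3)) _.
    by move=> i _; rewrite distrC gE// hm.
  by rewrite sumr_const card_ord mulr_natr.
move/cvgrPdist_lt : cg => /(_ _ e3); apply: filterS => n hn.
have := d2 n; move: d1 hn.
set a := \int[P]_(y in E) h y; set b := \int[P]_(y in E) g y.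
set c := n%:R^-1 * _; set f := n%:R^-1 * _ => ab bc cf.
rewrite (_ : a - f = (a - b) + (b - c) + (c - f)); last by ring.
apply: le_lt_trans (ler_normD _ _) _; apply: le_lt_trans (lerD (ler_normD _ _) (lexx _)) _.
move: ab bc cf; set A := `|_|; set B := `|_|; set F := `|_|; lra.
Qed.

(** * The distance to the nearest curve *)

Section min_dist.
Context (R : realType) (kappa : nat).
Implicit Types (x y : R * 'rV[R]_kappa) (a b : 'rV[R]_kappa) (D L N d : R).

Lemma enorm_sqr_close a b L d : 0 <= d ->
  (forall c, `|a ord0 c| <= L) -> (forall c, `|b ord0 c| <= L) ->
  (forall c, `|a ord0 c - b ord0 c| <= d) ->
  `|enorm a ^+ 2 - enorm b ^+ 2| <= kappa%:R * (2 * L * d).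
Proof.
move=> d0 aL bL ab; rewrite !enorm_sqr -sumrB.
apply: le_trans (ler_norm_sum _ _ _) _.
apply: le_trans (ler_sum _ (_ : forall c : 'I_kappa, true -> _ <= 2 * L * d)) _.
  move=> c _; rewrite subr_sqr normrM mulrC ler_pM//.
  by apply: le_trans (ler_normD _ _) _; have := lerD (aL c) (bL c); lra.
by rewrite sumr_const card_ord -[leLHS]mulr_natl.
Qed.

Lemma enorm_sqr_le a L : (forall c, `|a ord0 c| <= L) -> enorm a ^+ 2 <= kappa%:R * L ^+ 2.
Proof.
move=> aL; rewrite enorm_sqr.
apply: le_trans (ler_sum _ (_ : forall c : 'I_kappa, true -> _ <= L ^+ 2)) _.
  by move=> c _; rewrite -(@real_normK _ (a ord0 c)) ?num_real// lerXn2r ?nnegrE// (le_trans _ (aL c)).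
by rewrite sumr_const card_ord -[leLHS]mulr_natl.
Qed.

Context (k : nat) (hk : (0 < k)%N).
Implicit Types (mu nu : curves R k kappa).

Lemma sqdist_ge0 x (f : curve R kappa) : 0 <= sqdist x f.
Proof. exact: sqr_ge0. Qed.

Lemma min_dist_ge0 mu x : 0 <= min_dist hk mu x.
Proof. by apply/bigmin_geP; split=> [|j _]; exact: sqdist_ge0. Qed.

Lemma min_dist_le mu x j : min_dist hk mu x <= sqdist x (mu j).
Proof. exact: bigmin_le_cond. Qed.

(** A minimum depends on its arguments in a 1-Lipschitz way. *)
Lemma min_dist_close mu nu x y D :
  (forall j, `|sqdist x (mu j) - sqdist y (nu j)| <= D) ->
  `|min_dist hk mu x - min_dist hk nu y| <= D.
Proof.
have half mu1 nu1 x1 y1 : (forall j, sqdist y1 (nu1 j) - D <= sqdist x1 (mu1 j)) ->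
    min_dist hk nu1 y1 - D <= min_dist hk mu1 x1.
  move=> h; apply/bigmin_geP; split=> [|j _]; apply: le_trans (h _);
    by rewrite lerD2r min_dist_le.
move=> h; have h1 : min_dist hk nu y - D <= min_dist hk mu x.
  by apply: half => j; have := h j; rewrite ler_norml => /andP[? ?]; lra.
have h2 : min_dist hk mu x - D <= min_dist hk nu y.
  by apply: half => j; have := h j; rewrite ler_norml => /andP[? ?]; lra.
by rewrite ler_norml; apply/andP; split; lra.
Qed.

Lemma measurable_fun_bigmin (E : set (data R kappa)) (I : Type) (s : seq I)
    (f0 : data R kappa -> R) (f : I -> data R kappa -> R) :
  measurable_fun E f0 -> (forall i, measurable_fun E (f i)) ->
  measurable_fun E (fun x => \big[Num.min/f0 x]_(i <- s) f i x).
Proof.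
move=> mf0 mf; elim: s => [|i s IH]; first by under eq_fun do rewrite big_nil.
by under eq_fun do rewrite big_cons; exact: measurable_minr.
Qed.

Lemma min_dist_measurable (T : R) mu : (forall j, inH2 T (mu j)) ->
  measurable_fun (Xset kappa T) (min_dist hk mu : data R kappa -> R).
Proof.
move=> hmu.
have ms j : measurable_fun (Xset kappa T) ((fun x => sqdist x (mu j)) : data R kappa -> R).
  rewrite /sqdist; under eq_fun do rewrite enorm_sqr.
  apply: measurable_sum => c; apply: measurable_funX.
  under eq_fun do rewrite !mxE; apply: measurable_funB.
    exact: measurable_funS (dcoord_measurable (Some c)).
  apply: (@measurable_comp _ _ _ _ _ _ `[0, T] (fun t : R => mu j t ord0 c : R) _
    (dcoord None : data R kappa -> R)).
  - exact: measurable_itv.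
  - by move=> _ [x xX <-]; rewrite /= in_itv.
  - by case: (inH2_sqI c (hmu j)).
  - exact: measurable_funS (dcoord_measurable None).
exact: measurable_fun_bigmin.
Qed.

Lemma inY_coord (T N : R) (f : curve R kappa) t c : inY T N f -> 0 <= t <= T ->
  `|f t ord0 c| <= N.
Proof. by move=> [_ fN] tI; exact: le_trans (coord_le_enorm _ _) (fN _ tI). Qed.

Lemma min_dist_bounded (T N L : R) mu x : 0 <= N -> inYk T N mu -> 0 <= x.1 <= T ->
  (forall c, `|x.2 ord0 c| <= L) -> `|min_dist hk mu x| <= kappa%:R * (L + N) ^+ 2.
Proof.
move=> N0 Ymu xT xL; rewrite ger0_norm ?min_dist_ge0//.
apply: le_trans (min_dist_le _ _ (Ordinal hk)) _; apply: enorm_sqr_le => c.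
rewrite !mxE; apply: le_trans (ler_normB _ _) _.
by apply: lerD => //; exact: inY_coord (Ymu _) xT.
Qed.

(** Sobolev curves are Hoelder continuous, so that the distance varies
    little across small cells. *)
Lemma min_dist_osc (T N L : R) mu : 0 < T -> 0 < N -> 0 < L -> inYk T N mu ->
  forall e : R, 0 < e -> exists m, forall x, 0 <= x.1 <= T ->
    (forall o, `|dcoord o x| <= L) ->
    `|min_dist hk mu x - min_dist hk mu (corner R m (cell_code m x))| <= e.
Proof.
move=> T0 N0 L0 Ymu e e0.
pose S : R := 1 + \sum_(j < k) Num.sqrt (H2_inner T (mu j) (mu j)).
have S1 : 1 <= S by rewrite lerDl sumr_ge0// => j _; exact: sqrtr_ge0.
have SP j : Num.sqrt (H2_inner T (mu j) (mu j)) <= S - 1.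
  rewrite /S addrAC subrr add0r (bigD1 j)//= lerDl sumr_ge0// => i _; exact: sqrtr_ge0.
(* [S - 1] bounds the Hoelder constants of the curves, and [q] is the bound on the
   square root of the side of the cells that makes the final estimate at most [e]. *)
pose q : R := e / (kappa%:R * (2 * (L + 1 + N)) * S + 1).
have K0 : 0 <= kappa%:R * (2 * (L + 1 + N)) * S.
  by rewrite !mulr_ge0//; lra.
have q0 : 0 < q by rewrite divr_gt0// ltr_wpDl.
have [m _ /(_ m (leqnn m)) /= mq] := near_infty_natSinv_lt (PosNum (exprn_gt0 2 q0)).
exists m => x xT xL; set y := corner R m _.
have r1 : m.+1%:R^-1 <= 1 :> R by rewrite invf_le1// ler1n.
have r0 : 0 < m.+1%:R^-1 :> R by rewrite invr_gt0.
set r : R := m.+1%:R^-1 in mq r0 r1 *.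
have near o : dcoord o y <= dcoord o x < dcoord o y + r by exact: corner_code_near.
have sr : Num.sqrt r <= q.
  by rewrite -(ger0_norm (ltW q0)) -sqrtr_sqr ler_wsqrtr// ltW.
have rsr : r <= Num.sqrt r.
  rewrite -[leLHS](sqr_sqrtr (ltW r0)) expr2 ler_piMl ?sqrtr_ge0//.
  by rewrite -sqrtr1 ler_wsqrtr.
have /andP[x0 xT'] := xT; have /andP[y1 y2] := near None.
have y0 : 0 <= y.1.
  by rewrite /y /corner /= divr_ge0// ler0z ffunE floor_ge0 mulr_ge0.
have yT : 0 <= y.1 <= T by rewrite y0 (le_trans y1).
clearbody y; have dl : 0 <= q * S by rewrite mulr_ge0 ?(ltW q0)// (le_trans _ S1).
apply: le_trans (_ : kappa%:R * (2 * (L + 1 + N) * (q * S)) <= _).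
  apply: min_dist_close => j; have [hj _] := Ymu j.
  apply: enorm_sqr_close => // c; rewrite !mxE.
  - apply: le_trans (ler_normB _ _) _; apply: lerD; last exact: inY_coord (Ymu j) xT.
    by apply: le_trans (xL (Some c)) _; rewrite lerDl.
  - apply: le_trans (ler_normB _ _) _; apply: lerD; last exact: inY_coord (Ymu j) yT.
    have /andP[z1 z2] := near (Some c); have := xL (Some c).
    move: z1 z2; rewrite /= !ler_norml => z1 z2 /andP[? ?]; apply/andP; split; lra.
  have -> : x.2 ord0 c - mu j x.1 ord0 c - (y.2 ord0 c - mu j y.1 ord0 c) =
     (x.2 ord0 c - y.2 ord0 c) - (mu j x.1 ord0 c - mu j y.1 ord0 c) by ring.
  apply: le_trans (ler_normB _ _) _.
  have h1 : `|x.2 ord0 c - y.2 ord0 c| <= Num.sqrt r.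
    apply: le_trans rsr; have /andP[/= z1 z2] := near (Some c).
    by rewrite ler_norml; apply/andP; split; lra.
  have h2 : `|mu j x.1 ord0 c - mu j y.1 ord0 c| <= Num.sqrt r * (S - 1).
    apply: le_trans (H2_holder T0 c hj y0 y1 xT') _.
    rewrite ler_pM ?sqrtr_ge0// ler_wsqrtr//; move: y2; rewrite /=; lra.
  apply: le_trans (lerD h1 h2) _.
  by rewrite -[X in X + _]mulr1 -mulrDr addrC subrK ler_wpM2r// (le_trans _ S1).
rewrite (_ : _ * _ = (kappa%:R * (2 * (L + 1 + N)) * S) * q); last by ring.
rewrite /q mulrA ler_pdivrMr ?ltr_wpDl// mulrC ler_pM2l//.
by rewrite lerDl.
Qed.

Lemma weak_limit_inY (T N : R) (u : nat -> curve R kappa) v : 0 < T ->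
  (forall n, inY T N (u n)) -> H2_weak_cvg T u v -> inY T N v.
Proof.
move=> T0 Yu uv; split; first by case: uv.
move=> t tI; have N0 : 0 <= N by apply: le_trans (proj2 (Yu 0%N) t tI); exact: sqrtr_ge0.
rewrite -(@ler_pXn2r _ 2) ?nnegrE ?sqrtr_ge0// enorm_sqr.
have h : (fun n => enorm (u n t) ^+ 2) @ \oo --> \sum_(c < kappa) v t ord0 c ^+ 2.
  under eq_fun do rewrite enorm_sqr.
  apply: (@cvg_big_seq R _ _ (fun c n => u n t ord0 c ^+ 2)) => c.
  by have h := @H2_weak_cvg_eval R kappa T T0 _ _ c t uv tI; exact: (cvgM h h).
rewrite -(cvg_lim (@Rhausdorff R) h); apply: limr_le; first by apply/cvg_ex; eexists; exact: h.
apply: nearW => n; rewrite lerXn2r ?nnegrE ?sqrtr_ge0//; exact: (proj2 (Yu n)).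
Qed.

End min_dist.

(** * Convergence of minimizers *)

(** Weak compactness passes to [k]-tuples by extracting once per component. *)
Lemma bounded_weak_cvg_subseq (R : realType) (k kappa : nat) (T C : R)
    (u : nat -> curves R k kappa) : 0 < T ->
  (forall n j, inH2 T (u n j)) -> (forall n j, H2_inner T (u n j) (u n j) <= C) ->
  exists s v, extraction s /\ weak_cvg T (fun m => u (s m)) v.
Proof.
move=> T0 hu uC.
suff [s [v [exs sv]]] : exists s v, extraction s /\
    forall j, j \in enum 'I_k -> H2_weak_cvg T (fun m => u (s m) j) (v j).
  by exists s, v; split => // j; apply: sv; rewrite mem_enum.
elim: (enum 'I_k) => [|i l [s [v [exs sv]]]].
  by exists id, (fun=> 0); split.
have [s' [w [exs' w_cvg]]] := H2_bounded_weak_subseq T0 (fun n => hu (s n) i) (fun n => uC (s n) i).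
exists (s \o s'), (fun j => if j == i then w else v j).
split=> [|j]; first exact: extraction_comp.
rewrite inE; case: eqP => [-> _ //|_ /= /sv [h1 h2 h3]].
by split=> // F dF; exact: (extraction_cvg (u := fun m => F (u (s m) j)) exs' (h3 F dF)).
Qed.

Section minimizers.
Context (R : realType) (k kappa : nat) (hk : (0 < k)%N) (T N lambda : R).
Hypotheses (T0 : 0 < T) (N0 : 0 < N) (lambda0 : 0 < lambda).

Lemma mean_le (f : nat -> R) n C : 0 <= C -> (forall i, f i <= C) ->
  n%:R^-1 * \sum_(i < n) f i <= C.
Proof.
move=> C0 fC; case: n => [|n]; first by rewrite big_ord0 mulr0.
rewrite mulrC ler_pdivrMr//; apply: le_trans (_ : \sum_(i < n.+1) C <= _); first by apply: ler_sum.
by rewrite sumr_const card_ord mulr_natr.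
Qed.

Variables (L : R) (x : nat -> data R kappa).
Hypotheses (L0 : 0 < L) (xX : forall i, Xset kappa T (x i)).
Hypothesis xL : forall i c, `|(x i).2 ord0 c| <= L.

(** Comparison with the zero curves bounds the energy of the minimizers. *)
Lemma minimizers_bounded : exists C, forall n u,
  minimizer T N (f_emp hk T lambda x n) u -> forall j, H2_inner T (u j) (u j) <= C.
Proof.
pose z : curves R k kappa := fun=> 0.
have Yz : inYk T N z.
  move=> j; split; first exact: inH2_0.
  move=> t _; rewrite /enorm big1 ?sqrtr0 ?ltW// => c _.
  by rewrite mxE expr0n.
have K0 : 0 <= kappa%:R * (L + N) ^+ 2 by rewrite mulr_ge0// sqr_ge0.
have [C CP] := @H2_bounded R kappa T T0 N (lambda^-1 * (kappa%:R * (L + N) ^+ 2) + reg T z).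
exists C => n u [Yu /(_ z Yz) uz] j; apply: CP; first exact: Yu.
apply: le_trans (_ : reg T u <= _).
  by rewrite /reg (bigD1 j)//= lerDl sumr_ge0// => i _; exact: sqr_ge0.
have d0 : 0 <= n%:R^-1 * \sum_(i < n) min_dist hk u (x i).
  by rewrite mulr_ge0 ?invr_ge0// sumr_ge0// => i _; exact: min_dist_ge0.
have dz : n%:R^-1 * \sum_(i < n) min_dist hk z (x i) <= kappa%:R * (L + N) ^+ 2.
  apply: (mean_le (f := fun i => min_dist hk z (x i))) => // i.
  apply: le_trans (ler_norm _) _.
  by apply: min_dist_bounded (ltW N0) Yz (xX i) _ => c; exact: xL.
rewrite -(ler_pM2l lambda0) mulrDr mulVKf ?gt_eqF//.
rewrite -[leLHS]add0r; apply: le_trans (lerD d0 (lexx _)) _.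
by apply: le_trans uz _; rewrite lerD2r.
Qed.

Lemma minimizers_precompact (u : nat -> curves R k kappa) :
  (forall n, minimizer T N (f_emp hk T lambda x n.+1) (u n)) -> weakly_precompact T u.
Proof.
move=> hu s exs; have [C CP] := minimizers_bounded.
apply: (bounded_weak_cvg_subseq (u := fun m => u (s m)) (C := C) T0) => m j.
  by have [/(_ j)[]] := hu (s m).
exact: CP (hu (s m)) j.
Qed.

(** The data term is continuous along weakly convergent curves, uniformly in
    the number of samples. *)
Lemma empirical_weak_cvg (u : nat -> curves R k kappa) v :
  (forall m, inYk T N (u m)) -> weak_cvg T u v -> inYk T N v ->
  forall e : R, 0 < e -> \forall m \near \oo, forall n,
    `|n%:R^-1 * \sum_(i < n) min_dist hk v (x i) -
      n%:R^-1 * \sum_(i < n) min_dist hk (u m) (x i)| <= e.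
Proof.
move=> Yu uv Yv e e0; have K0 : 0 <= kappa%:R * (2 * (L + N)) by rewrite !mulr_ge0// addr_ge0// ltW.
pose d := e / (kappa%:R * (2 * (L + N)) + 1).
have d0 : 0 < d by rewrite divr_gt0// ltr_wpDl.
have : \forall m \near \oo, forall j t, `[0, T]%classic t -> forall c,
    `|u m j t ord0 c - v j t ord0 c| < d.
  by apply: filter_forall => j; exact: H2_weak_cvg_sup (uv j) _ d0.
apply: filterS => m um n; rewrite -mulrBr -sumrB.
apply: le_trans (_ : n%:R^-1 * \sum_(i < n) e <= _); last first.
  exact: (@mean_le (fun=> e) n e (ltW e0) (fun=> lexx e)).
rewrite normrM ger0_norm ?invr_ge0// ler_wpM2l ?invr_ge0//.
apply: le_trans (ler_norm_sum _ _ _) _; apply: ler_sum => i _.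
apply: le_trans (_ : kappa%:R * (2 * (L + N) * d) <= _).
  have xI : `[0, T]%classic (x i).1 by rewrite /= in_itv; exact: xX.
  have bd (w : curves R k kappa) j c : inYk T N w -> `|(x i).2 ord0 c - w j (x i).1 ord0 c| <= L + N.
    move=> Yw; apply: le_trans (ler_normB _ _) _; apply: lerD; first exact: xL.
    exact: inY_coord (Yw j) (xX i).
  apply: min_dist_close => j; apply: enorm_sqr_close (ltW d0) _ _ _ => c; rewrite !mxE.
  - exact: bd.
  - exact: bd.
  rewrite (_ : _ - _ = u m j (x i).1 ord0 c - v j (x i).1 ord0 c); last by ring.
  by apply: ltW; exact: um.
rewrite mulrA /d mulrA ler_pdivrMr ?ltr_wpDl// mulrC ler_pM2l//.
by rewrite lerDl.
Qed.

(** Lower semicontinuity of each of the [k] energies, with the error shared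
    evenly. *)
Lemma reg_weak_lsc (u : nat -> curves R k kappa) v : weak_cvg T u v ->
  forall e : R, 0 < e -> \forall m \near \oo, lambda * reg T v - e <= lambda * reg T (u m).
Proof.
move=> uv e e0; have k0 : (0 : R) < k%:R by rewrite ltr0n.
have d0 : 0 < e / (lambda * k%:R) by rewrite divr_gt0// mulr_gt0.
have : \forall m \near \oo, forall j, L2norm T (wderiv T 2 (v j)) ^+ 2 - e / (lambda * k%:R) <=
    L2norm T (wderiv T 2 (u m j)) ^+ 2.
  by apply: filter_forall => j; exact: H2_weak_lsc (uv j) _ d0.
apply: filterS => m um; have := ler_sum _ (fun j (_ : true) => um j) : \sum_(j < k) _ <= \sum_(j < k) _.
rewrite sumrB sumr_const card_ord -(ler_pM2l lambda0) mulrBr.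
suff -> : lambda * ((e / (lambda * k%:R)) *+ k) = e by [].
by rewrite -mulr_natr; field; rewrite !gt_eqF.
Qed.

Variables (P : probability (data R kappa) R) (E : set (data R kappa)).
Hypotheses (mE : measurable E) (PE : P (~` E) = 0%E) (EX : E `<=` Xset kappa T).
Hypothesis EL : forall y, E y -> forall o, `|dcoord o y| <= L.
Hypothesis xE : forall i, E (x i).
Hypothesis freq : forall m p,
  (fun n => n%:R^-1 * \sum_(i < n) (\1_(cell m p) (x i) : R)) @ \oo --> fine (P (cell m p)).

(** The set [E] and the frequencies do not mention [nu], so that one null set of
    samples serves all the competitors. *)
Lemma empirical_min_dist_cvg (nu : curves R k kappa) : inYk T N nu ->
  (fun n => n%:R^-1 * \sum_(i < n) min_dist hk nu (x i)) @ \oo -->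
  \int[P]_(y in Xset kappa T) min_dist hk nu y.
Proof.
move=> Ynu; apply: (empirical_cvg _ mE PE EX EL xE freq (C := kappa%:R * (L + N) ^+ 2)).
- exact: measurable_Xset.
- by apply: min_dist_measurable => j; case: (Ynu j).
- move=> y Ey; apply: min_dist_bounded (ltW N0) Ynu _ _; first exact: EX.
  by move=> c; exact: (EL Ey (Some c)).
- move=> e e0; have [m hm] := min_dist_osc hk T0 N0 L0 Ynu e0.
  by exists m => y Ey; apply: hm; [exact: EX|exact: EL].
Qed.

(** The four quarters of [e] pay for the two laws of large numbers at [v] and [nu],
    for replacing [u (s m)] by [v] in the data term, and for lower
    semicontinuity. *)
Lemma weak_limit_minimizes (u : nat -> curves R k kappa) v :
  (forall n, minimizer T N (f_emp hk T lambda x n.+1) (u n)) ->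
  weak_limit_point T u v -> minimizer T N (f_lim hk T lambda P) v.
Proof.
have arith (a b c f g p q r e : R) : `|b - g| <= e / 4 -> `|a - f| <= e / 4 ->
    `|g - c| <= e / 4 -> p - e / 4 <= q -> c + q <= f + r -> b + p <= a + r + e.
  by rewrite !ler_norml => /andP[? ?] /andP[? ?] /andP[? ?] ? ?; lra.
move=> hu [s [exs uv]].
have Yu m : inYk T N (u (s m)) by have [] := hu (s m).
have Yv : inYk T N v by move=> j; apply: weak_limit_inY (uv j) => // m; exact: Yu.
split; first exact: Yv.
move=> nu Ynu; apply/ler_addgt0Pr => e e0.
have e4 : 0 < e / 4 by rewrite divr_gt0.
(* The curves [u (s m)] are fitted to [(s m).+1] samples. *)
have exs1 : extraction (fun m => (s m).+1) by move=> m n mn; rewrite ltnS; exact: exs.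
have /cvgrPdist_le/(_ _ e4) cv := extraction_cvg exs1 (empirical_min_dist_cvg Yv).
have /cvgrPdist_le/(_ _ e4) cnu := extraction_cvg exs1 (empirical_min_dist_cvg Ynu).
have cuv := empirical_weak_cvg Yu uv Yv e4.
have cr := reg_weak_lsc uv e4.
have [m [[[h1 h2] h3] h4]] := filter_ex (filterI (filterI (filterI cv cnu) cuv) cr).
have h5 := (hu (s m)).2 nu Ynu; rewrite /f_emp in h5; rewrite /f_lim.
exact: (arith _ _ _ _ _ _ _ _ _ h1 h2 (h3 (s m).+1) h4 h5).
Qed.

End minimizers.

(* u n is mu^(n+1), a minimizer of f_(n+1): sequences are indexed by n >= 1. *)
Theorem theorem4p7 (R : realType) (k kappa : nat) (hk : (0 < k)%N)
    (hkappa : (0 < kappa)%N) (T N lambda : R)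
    (hT : 0 < T) (hN : 0 < N) (hlambda : 0 < lambda)
    (P : probability (data R kappa) R)
    (hPX : P (Xset kappa T) = 1%E) (hPsupp : compact (msupport P))
    (d : measure_display) (Omega : measurableType d) (Pr : probability Omega R)
    (xi : nat -> Omega -> data R kappa)
    (hxiX : forall i omega, Xset kappa T (xi i omega))
    (hxi : iid_samples Pr P xi) :
  {ae Pr, forall omega : Omega, forall u : nat -> curves R k kappa,
      (forall n, minimizer T N (f_emp hk T lambda (xi ^~ omega) n.+1) (u n)) ->
      weakly_precompact T u /\
      (forall v : curves R k kappa, weak_limit_point T u v ->
         minimizer T N (f_lim hk T lambda P) v)} /\
  (forall (omega : Omega) (u : nat -> curves R k kappa),
      (forall n, minimizer T N (f_emp hk T lambda (xi ^~ omega) n.+1) (u n)) ->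
      forall (s : nat -> nat) (v : curves R k kappa), extraction s ->
        weak_cvg T (fun m => u (s m)) v ->
        forall j : 'I_k,
          {uniform `[0, T], (fun m => u (s m) j) @ \oo --> (v j : R -> 'rV[R]_kappa)}).
Proof.
split; last by move=> omega u _ s v _ uv j; exact: H2_weak_cvg_uniform.
have [E [L0 [mE PE EX EL0]]] := bounded_full_set hPX hPsupp.
pose L := `|L0| + 1; have L0' : 0 < L by rewrite ltr_wpDl.
have EL y : E y -> forall o, `|dcoord o y| <= L.
  by move=> /EL0 h o; rewrite (le_trans (h o))// (le_trans (ler_norm _))// lerDl.
apply: filterS2 (samples_avoid_null hxi mE PE) (cell_frequencies hxi) => omega xE freq u hu.
have xX i : Xset kappa T (xi i omega) by exact: hxiX.
have xL i c : `|(xi i omega).2 ord0 c| <= L by exact: (EL _ (xE i) (Some c)).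
split; first exact: (minimizers_precompact hT hN hlambda xX xL hu).
by move=> v; exact: (weak_limit_minimizes hT hN hlambda L0' xX xL mE PE EX EL xE freq hu).
Qed.
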